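(* Let $k$ be an algebraically closed field of characteristic $0$, and let $R=k[x,y,z]$ be the polynomial ring in three variables, with the $\mathbb{N}$-grading $R=\bigoplus_{d\in\mathbb{N}}R_d$ as a $k$-algebra for which $x\in R_3$, $y\in R_2$, $z\in R_1$. Let $f\in R_9$ satisfy the following conditions: (C1) $f$ is irreducible; (C2) the curve $\operatorname{Proj}(R/fR)$ has at least two singular points; (C3) $f(x,y,0)=x(px^2+qy^3)$ for some $p,q\in k^*$; (C4) $f_z(x,y,0)=y(rx^2+sy^3)$ for some $r,s\in k$ with $\det\begin{pmatrix}3p & r\\ q& s\end{pmatrix}\neq 0$, where $f_z=\partial f/\partial z$ and $p,q$ are as in (C3). Let $n\ge 2$ be an integer with $n\notin 3\mathbb{Z}$, let $A=R[W]/(W^n+f)$ where $R[W]$ is the polynomial ring in one variable over $R$, and let $w\in A$ be the image of $W$. Let $\mathfrak{G}$ be the $\mathbb{N}$-grading $A=\bigoplus_{i\in\mathbb{N}}A_i$ of the $k$-algebra $A$ defined by declaring $x\in A_{3n}$, $y\in A_{2n}$, $z\in A_n$ and $w\in A_9$, and let $T(\mathfrak{G})$ be the subtorus of $\operatorname{Aut}_k(A)$ determined by $\mathfrak{G}$. Then $\operatorname{Aut}_k(A)=T(\mathfrak{G})\cong k^*$.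
   Context: $\operatorname{Aut}_k(A)$ is the group of $k$-algebra automorphisms of $A$. For the $\mathbb{N}$-grading $\mathfrak{G}$ given by $A=\bigoplus_{i\in\mathbb{N}}A_i$ and for $t\in k^*$, let $\phi_t\in\operatorname{Aut}_k(A)$ be defined by $\phi_t\left(\sum_i a_i\right)=\sum_i t^i a_i$ (where $a_i\in A_i$); then $T(\mathfrak{G})=\{\phi_t : t\in k^*\}$, a subgroup of $\operatorname{Aut}_k(A)$. *)

(* Defs.v *)
From HB Require Import structures.
From mathcomp Require Import all_boot all_order all_algebra.
From mathcomp Require Import generic_quotient ring_quotient qpoly.
From mathcomp Require Import boolp classical_sets.
From mathcomp Require Import ring.
From mathcomp.multinomials Require Import mpoly.

Set Implicit Arguments.
Unset Strict Implicit.
Unset Printing Implicit Defensive.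

Import GRing.Theory.
Import Pdiv.CommonRing Pdiv.RingMonic.
Local Open Scope ring_scope.
Local Open Scope classical_set_scope.
Local Open Scope quotient_scope.

Record grading (A : comNzRingType) := Grading {
  gpart :> nat -> set A;
  gpart0 : forall i, gpart i 0;
  gpartB : forall i a b, gpart i a -> gpart i b -> gpart i (a - b);
  gpart1 : gpart 0 1;
  gpartM : forall i j a b, gpart i a -> gpart j b -> gpart (i + j) (a * b);
  gpart_gen : forall a, exists (N : nat) (c : nat -> A),
    (forall i, gpart i (c i)) /\ a = \sum_(i < N) c i;
  gpart_indep : forall (N : nat) (c : nat -> A), (forall i, gpart i (c i)) ->
    \sum_(i < N) c i = 0 -> forall i, (i < N)%N -> c i = 0
}.

Lemma sum_trunc (V : nmodType) (N M : nat) (c : nat -> V) : (N <= M)%N ->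
  \sum_(i < M) (if (i < N)%N then c i else 0) = \sum_(i < N) c i.
Proof.
by move=> NM; rewrite (big_ord_widen M c NM) [RHS]big_mkcond.
Qed.

Section Sums.
Variables (A : zmodType) (P : nat -> set A).
Hypothesis P0 : forall i, P i 0.
Hypothesis PB : forall i a b, P i a -> P i b -> P i (a - b).

Definition gsum (a : A) := exists (N : nat) (c : nat -> A),
  (forall i, P i (c i)) /\ a = \sum_(i < N) c i.

Lemma PN i a : P i a -> P i (- a).
Proof. by move=> Pa; rewrite -[- a]sub0r; apply: PB. Qed.

Lemma PD i a b : P i a -> P i b -> P i (a + b).
Proof. by move=> Pa Pb; rewrite -[b]opprK; apply: PB => //; apply: PN. Qed.

Lemma gsum0 : gsum 0.
Proof. by exists 0%N, (fun=> 0); split=> //; rewrite big_ord0. Qed.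

Lemma gsumP i a : P i a -> gsum a.
Proof.
move=> Pa; exists i.+1, (fun j => if j == i then a else 0); split.
  by move=> j; case: eqP => [->|].
rewrite big_ord_recr /= eqxx big1 ?add0r // => j _.
by rewrite ltn_eqF.
Qed.

Lemma gsumD a b : gsum a -> gsum b -> gsum (a + b).
Proof.
move=> [N [c [Pc ->]]] [M [d [Pd ->]]].
exists (maxn N M), (fun i => (if (i < N)%N then c i else 0)
                      + (if (i < M)%N then d i else 0)); split.
  by move=> i; apply: PD; case: ifP.
by rewrite big_split /= !sum_trunc ?leq_maxl ?leq_maxr.
Qed.

Lemma gsum_sum I (r : seq I) (Q : pred I) F :
  (forall i, Q i -> gsum (F i)) -> gsum (\sum_(i <- r | Q i) F i).
Proof. by move=> ?; apply: big_ind => //; [exact: gsum0|exact: gsumD]. Qed.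

End Sums.

Section GradingTheory.
Variables (A : comNzRingType) (G : grading A).

Lemma gpartN i a : G i a -> G i (- a).
Proof. exact: PN (@gpart0 _ G) (@gpartB _ G) _ _. Qed.

Lemma gpartD i a b : G i a -> G i b -> G i (a + b).
Proof. exact: PD (@gpart0 _ G) (@gpartB _ G) _ _ _. Qed.

Definition gbound (a : A) : nat := projT1 (cid (gpart_gen G a)).

Definition gcomp (i : nat) (a : A) : A :=
  if (i < gbound a)%N then projT1 (cid (projT2 (cid (gpart_gen G a)))) i else 0.

Lemma gcompP i a : G i (gcomp i a).
Proof.
rewrite /gcomp; case: ifP => _; last exact: gpart0.
exact: (projT2 (cid (projT2 (cid (gpart_gen G a))))).1.
Qed.

Lemma gcomp_sum a : a = \sum_(i < gbound a) gcomp i a.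
Proof.
rewrite {1}(projT2 (cid (projT2 (cid (gpart_gen G a))))).2.
by apply: eq_bigr => i _; rewrite /gcomp ltn_ord.
Qed.

Lemma gcompE (N : nat) (c : nat -> A) : (forall i, G i (c i)) ->
  forall i, gcomp i (\sum_(j < N) c j) = if (i < N)%N then c i else 0.
Proof.
move=> Gc i; set a := \sum_(j < N) c j.
pose d j := gcomp j a - (if (j < N)%N then c j else 0).
have Gd j : G j (d j).
  by apply: gpartB; [exact: gcompP | case: ifP => // _; exact: gpart0].
pose M := maxn i.+1 (maxn N (gbound a)).
have d0 : \sum_(j < M) d j = 0.
  rewrite sumrB (@sum_trunc _ N M c); last by rewrite /M !leq_max leqnn /= orbT.
  have -> : \sum_(j < M) gcomp j a =
            \sum_(j < M) if (j < gbound a)%N then gcomp j a else 0.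
    by apply: eq_bigr => j _; rewrite /gcomp; case: ifP.
  rewrite (@sum_trunc _ _ _ (fun j => gcomp j a)) -?gcomp_sum ?subrr //.
  by rewrite /M !leq_max leqnn !orbT.
have iM : (i < M)%N by rewrite /M leq_max ltnSn.
by have /eqP := gpart_indep Gd d0 iM; rewrite subr_eq0 => /eqP.
Qed.

End GradingTheory.

(* Image of a grading under a surjection whose kernel is generated by one
   homogeneous element. *)
Section QuotientGrading.
Variables (A B : comNzRingType) (G : grading A) (pi : {rmorphism A -> B}).
Variables (d : nat) (g : A).
Hypothesis Gg : G d g.
Hypothesis pi_surj : forall b, exists a, pi a = b.
Hypothesis pi_ker : forall a, pi a = 0 <-> exists q, a = g * q.

Definition im_part (i : nat) : set B := pi @` G i.

Lemma im_part0 i : im_part i 0.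
Proof. by exists 0; [exact: gpart0 | rewrite rmorph0]. Qed.

Lemma im_partB i a b : im_part i a -> im_part i b -> im_part i (a - b).
Proof.
move=> [x Gx <-] [y Gy <-]; exists (x - y); first exact: gpartB.
by rewrite rmorphB.
Qed.

Lemma im_part1 : im_part 0 1.
Proof. by exists 1; [exact: gpart1 | rewrite rmorph1]. Qed.

Lemma im_partM i j a b : im_part i a -> im_part j b -> im_part (i + j) (a * b).
Proof.
move=> [x Gx <-] [y Gy <-]; exists (x * y); first exact: gpartM.
by rewrite rmorphM.
Qed.

Lemma im_part_gen a : gsum im_part a.
Proof.
have [x <-] := pi_surj a; have [N [c [Gc ->]]] := gpart_gen G x.
exists N, (fun i => pi (c i)); split; first by move=> i; exists (c i).
by rewrite rmorph_sum.
Qed.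

Lemma im_part_indep N (c : nat -> B) : (forall i, im_part i (c i)) ->
  \sum_(i < N) c i = 0 -> forall i, (i < N)%N -> c i = 0.
Proof.
move=> Pc c0.
have /choice[a aP] : forall i, exists x, G i x /\ pi x = c i.
  by move=> i; have [x] := Pc i; exists x.
have /pi_ker[q qE] : pi (\sum_(i < N) a i) = 0.
  by rewrite rmorph_sum -[RHS]c0; apply: eq_bigr => i _; case: (aP i).
move=> i iN; rewrite -(aP i).2; apply/pi_ker.
have sE := gcompE N (fun i => (aP i).1) i.
rewrite iN qE in sE; rewrite -{a aP qE}sE.
have [M [b [Gb ->]]] := gpart_gen G q.
pose e j := if (d <= j)%N then g * b (j - d)%N else 0.
have Ge j : G j (e j).
  rewrite /e; case: leqP => dj; last exact: gpart0.
  by rewrite -{1}(subnKC dj); apply: gpartM.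
have -> : g * \sum_(j < M) b j = \sum_(j < d + M) e j.
  rewrite big_split_ord /= [X in _ = X + _]big1 ?add0r.
    by rewrite mulr_sumr; apply: eq_bigr => j _; rewrite /e leq_addr addKn.
  by move=> j _; rewrite /e leqNgt ltn_ord.
rewrite gcompE //; case: ifP => _; last by exists 0; rewrite mulr0.
rewrite /e; case: ifP => _; last by exists 0; rewrite mulr0.
by exists (b (i - d)%N).
Qed.

Definition im_grading : grading B :=
  Grading im_part0 im_partB im_part1 im_partM im_part_gen im_part_indep.

End QuotientGrading.

(* The weighted grading of R[X_0, ..., X_(n-1)], with deg X_i = w i. *)
Section WeightedGrading.
Variables (n : nat) (R : comNzRingType) (w : 'I_n -> nat).

Definition wdeg (m : 'X_{1..n}) : nat := (\sum_i w i * m i)%N.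

Lemma wdeg0 : wdeg 0%MM = 0%N.
Proof. by rewrite /wdeg big1 // => i _; rewrite mnm0E muln0. Qed.

Lemma wdegD : {morph wdeg : m1 m2 / (m1 + m2)%MM >-> (m1 + m2)%N}.
Proof.
move=> m1 m2; rewrite /wdeg -big_split /=.
by apply: eq_bigr => i _; rewrite mnmDE mulnDr.
Qed.

HB.instance Definition _ := isMeasure.Build n wdeg wdeg0 wdegD.

Definition wpart (d : nat) : set {mpoly R[n]} :=
  [set p | p \is d.-homog for wdeg].

Lemma wpart0 d : wpart d 0.
Proof. exact: rpred0. Qed.

Lemma wpartB d p q : wpart d p -> wpart d q -> wpart d (p - q).
Proof. exact: rpredB. Qed.

Lemma wpart1 : wpart 0 1.
Proof. exact: dhomog1. Qed.

Lemma wpartM d e p q : wpart d p -> wpart e q -> wpart (d + e) (p * q).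
Proof. exact: dhomogM. Qed.

Lemma wpart_gen p : gsum wpart p.
Proof.
rewrite [p]mpolyE; apply: gsum_sum => [||m _]; first exact: wpart0.
  exact: wpartB.
apply: (@gsumP _ _ wpart0 (wdeg m)).
by apply: rpredZ; rewrite dhomogX.
Qed.

Lemma wpart_indep N (c : nat -> {mpoly R[n]}) : (forall i, wpart i (c i)) ->
  \sum_(i < N) c i = 0 -> forall i, (i < N)%N -> c i = 0.
Proof.
move=> Pc c0 i iN; apply/mpolyP => m; rewrite mcoeff0.
have [mi|mi] := eqVneq (wdeg m) i; last exact: dhomog_nemf_coeff (Pc i) mi.
have := congr1 (fun p => p@_m) c0.
rewrite raddf_sum /= mcoeff0 (bigD1 (Ordinal iN)) //= big1 ?addr0 // => j ji.
apply: (dhomog_nemf_coeff (Pc j)); apply: contra ji => /eqP mj.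
by apply/eqP/val_inj; rewrite /= -mj.
Qed.

Definition wgrading : grading {mpoly R[n]} :=
  Grading wpart0 wpartB wpart1 wpartM wpart_gen wpart_indep.

End WeightedGrading.

(* The grading of A[X] extending the one of A, with X homogeneous of degree e. *)
Section PolyGrading.
Variables (A : comNzRingType) (G : grading A) (e : nat).

Definition poly_part (d : nat) : set {poly A} :=
  [set p | forall j, if (e * j <= d)%N then G (d - e * j)%N p`_j else p`_j = 0].

Lemma poly_part0 d : poly_part d 0.
Proof. by move=> j; rewrite coef0; case: ifP => // _; exact: gpart0. Qed.

Lemma poly_partB d p q : poly_part d p -> poly_part d q -> poly_part d (p - q).
Proof.
move=> Pp Pq j; have := Pp j; have := Pq j; rewrite coefB.
by case: ifP => _; [move=> ? ?; exact: gpartB | move=> -> ->; rewrite subrr].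
Qed.

Lemma poly_partC d a : G d a -> poly_part d a%:P.
Proof.
move=> Ga [|j]; rewrite coefC /= ?muln0 ?leq0n ?subn0 //.
by case: ifP => // _; exact: gpart0.
Qed.

Lemma poly_partX : poly_part e 'X.
Proof.
move=> [|[|j]]; rewrite coefX /=.
- by rewrite muln0 leq0n subn0; exact: gpart0.
- by rewrite muln1 leqnn subnn; exact: gpart1.
- by case: ifP => // _; exact: gpart0.
Qed.

Lemma poly_part1 : poly_part 0 1.
Proof. by apply: poly_partC; exact: gpart1. Qed.

Lemma poly_partM d1 d2 p q :
  poly_part d1 p -> poly_part d2 q -> poly_part (d1 + d2) (p * q).
Proof.
move=> Pp Pq j; rewrite coefM.
have key (i : 'I_j.+1) : let x := p`_i * q`_(j - i) in
    if (e * j <= d1 + d2)%N then G (d1 + d2 - e * j)%N x else x = 0.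
  have ij : (i <= j)%N by rewrite -ltnS.
  have jE : (e * j = e * i + e * (j - i))%N by rewrite -mulnDr subnKC.
  move: (Pp i) (Pq (j - i)%N) => /=; rewrite jE.
  case: leqP => [h1|h1]; last first.
    by move=> -> _; rewrite mul0r; case: ifP => // _; exact: gpart0.
  case: leqP => [h2|h2]; last first.
    by move=> _ ->; rewrite mulr0; case: ifP => // _; exact: gpart0.
  move=> Gp Gq; rewrite leq_add //.
  have -> : (d1 + d2 - (e * i + e * (j - i))
             = (d1 - e * i) + (d2 - e * (j - i)))%N.
    by rewrite addnBA // addnBAC // subnDA.
  exact: gpartM.
case: ifP key => _ key; last by rewrite big1.
by apply: big_ind => [|x y|i _]; [exact: gpart0 | exact: gpartD | exact: key].
Qed.

Lemma poly_partXn j : poly_part (e * j) 'X^j.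
Proof.
elim: j => [|j IH]; first by rewrite muln0; exact: poly_part1.
by rewrite mulnS exprS; apply: poly_partM => //; exact: poly_partX.
Qed.

Lemma poly_part_gen p : gsum poly_part p.
Proof.
have sumG := gsum_sum poly_part0 poly_partB.
rewrite -[p]coefK poly_def; apply: (sumG) => j _.
have [N [c [Gc ->]]] := gpart_gen G p`_j.
rewrite scaler_suml; apply: (sumG) => i _.
rewrite -mul_polyC; apply: (@gsumP _ _ poly_part0 (i + e * j)%N).
by apply: poly_partM; [exact: poly_partC | exact: poly_partXn].
Qed.

Lemma poly_part_indep N (c : nat -> {poly A}) : (forall i, poly_part i (c i)) ->
  \sum_(i < N) c i = 0 -> forall i, (i < N)%N -> c i = 0.
Proof.
move=> Pc c0 i iN; apply/polyP => j; rewrite coef0.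
have := Pc i j; case: leqP => [ji _|//].
pose b l := (c (l + e * j)%N)`_j.
have Gb l : G l (b l).
  by have := Pc (l + e * j)%N j; rewrite leq_addl addnK.
have NE : (N = e * j + (N - e * j))%N by rewrite subnKC // (leq_trans ji) // ltnW.
have b0 : \sum_(l < N - e * j) b l = 0.
  have c0' : \sum_(i < e * j + (N - e * j)) c i = 0 by rewrite -NE.
  have := congr1 (fun p : {poly A} => p`_j) c0'.
  rewrite coef0 coef_sum big_split_ord /=.
  rewrite [X in X + _ = _]big1 ?add0r.
    by move=> s0; rewrite -[RHS]s0; apply: eq_bigr => l _; rewrite /b addnC.
  by move=> l _; have := Pc l j; rewrite leqNgt ltn_ord.
have := gpart_indep Gb b0 (i := (i - e * j)%N).
by rewrite /b subnK // => -> //; rewrite ltn_sub2r // (leq_ltn_trans ji).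
Qed.

Definition poly_grading : grading {poly A} :=
  Grading poly_part0 poly_partB poly_part1 poly_partM poly_part_gen
          poly_part_indep.

End PolyGrading.

Section AlgebraAutomorphisms.
Variables (k : fieldType) (A : comAlgType k).

Record kaut := KAut {
  kaut_fun :> A -> A;
  kaut_linear : linear kaut_fun;
  kaut_monoid_morphism : monoid_morphism kaut_fun;
  kaut_bij : bijective kaut_fun
}.

Lemma kautP (phi psi : kaut) : phi =1 psi -> phi = psi.
Proof.
case: phi psi => [f f1 f2 f3] [g g1 g2 g3] /= /funext fg.
by subst g; congr KAut; exact: Prop_irrelevance.
Qed.

HB.instance Definition _ := gen_eqMixin kaut.
HB.instance Definition _ := gen_choiceMixin kaut.

Definition kaut_one : kaut.
Proof.
by refine (@KAut id _ _ _) => //; exists id.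
Defined.

Definition kaut_mul (phi psi : kaut) : kaut.
Proof.
refine (@KAut (phi \o psi) _ _ _).
- by move=> c a b /=; rewrite !kaut_linear.
- have [p1 pM] := kaut_monoid_morphism phi.
  have [q1 qM] := kaut_monoid_morphism psi.
  by split=> [|a b] /=; rewrite ?q1 ?p1 // qM pM.
- exact: bij_comp (kaut_bij phi) (kaut_bij psi).
Defined.

Fact kaut_inv_subproof (phi : kaut) : exists psi : kaut,
  kaut_mul psi phi = kaut_one /\ kaut_mul phi psi = kaut_one.
Proof.
have [psi phiK psiK] := kaut_bij phi.
have [p1 pM] := kaut_monoid_morphism phi.
have psiL : linear psi.
  by move=> c a b; apply: (can_inj phiK); rewrite psiK kaut_linear !psiK.
have psiM : monoid_morphism psi.
  split; first by apply: (can_inj phiK); rewrite psiK p1.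
  by move=> a b; apply: (can_inj phiK); rewrite psiK pM !psiK.
exists (KAut psiL psiM (Bijective psiK phiK)).
by split; apply: kautP => a /=; rewrite ?phiK ?psiK.
Qed.

Definition kaut_inv (phi : kaut) : kaut := projT1 (cid (kaut_inv_subproof phi)).

Lemma kaut_mulA : associative kaut_mul.
Proof. by move=> phi psi chi; apply: kautP. Qed.

Lemma kaut_mul1 : left_id kaut_one kaut_mul.
Proof. by move=> phi; apply: kautP. Qed.

Lemma kaut_mule1 : right_id kaut_one kaut_mul.
Proof. by move=> phi; apply: kautP. Qed.

Lemma kaut_mulV : left_inverse kaut_one kaut_inv kaut_mul.
Proof. by move=> phi; exact: (projT2 (cid (kaut_inv_subproof phi))).1. Qed.

Lemma kaut_mulVr : right_inverse kaut_one kaut_inv kaut_mul.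
Proof. by move=> phi; exact: (projT2 (cid (kaut_inv_subproof phi))).2. Qed.

HB.instance Definition _ := isGroup.Build kaut
  kaut_mulA kaut_mul1 kaut_mule1 kaut_mulV kaut_mulVr.

End AlgebraAutomorphisms.

Arguments kaut : clear implicits.

Section UnitGroup.
Variable k : fieldType.

Record kstar := KStar { kstar_val :> k; _ : kstar_val != 0 }.

HB.instance Definition _ := [isSub for kstar_val].
HB.instance Definition _ := [Choice of kstar by <:].

Lemma kstar_neq0 (t : kstar) : val t != 0.
Proof. by case: t. Qed.

Definition kstar_one := KStar (oner_neq0 k).
Definition kstar_mul (s t : kstar) :=
  KStar (mulf_neq0 (kstar_neq0 s) (kstar_neq0 t)).
Definition kstar_inv (t : kstar) := KStar (invr_neq0 (kstar_neq0 t)).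

Lemma kstar_mulA : associative kstar_mul.
Proof. by move=> r s t; apply: val_inj; exact: mulrA. Qed.

Lemma kstar_mul1 : left_id kstar_one kstar_mul.
Proof. by move=> t; apply: val_inj; exact: mul1r. Qed.

Lemma kstar_mule1 : right_id kstar_one kstar_mul.
Proof. by move=> t; apply: val_inj; exact: mulr1. Qed.

Lemma kstar_mulV : left_inverse kstar_one kstar_inv kstar_mul.
Proof. by move=> t; apply: val_inj; exact: mulVf (kstar_neq0 t). Qed.

Lemma kstar_mulVr : right_inverse kstar_one kstar_inv kstar_mul.
Proof. by move=> t; apply: val_inj; exact: mulfV (kstar_neq0 t). Qed.

HB.instance Definition _ := isGroup.Build kstar
  kstar_mulA kstar_mul1 kstar_mule1 kstar_mulV kstar_mulVr.

End UnitGroup.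

Definition group_isomorphic (G H : groupType) : Prop :=
  exists h : G -> H, bijective h /\ {morph h : x y / (x * y)%g}.

Record alg_grading (k : fieldType) (A : comAlgType k) := AlgGrading {
  alg_gpart :> grading A;
  alg_gpartZ : forall i c a, alg_gpart i a -> alg_gpart i (c *: a)
}.

Section Torus.
Variables (k : fieldType) (A : comAlgType k) (G : alg_grading A).

Definition phi_fun (t : k) (a : A) : A :=
  \sum_(i < gbound G a) t ^+ i *: gcomp G i a.

Lemma phi_funE t N (c : nat -> A) : (forall i, G i (c i)) ->
  phi_fun t (\sum_(i < N) c i) = \sum_(i < N) t ^+ i *: c i.
Proof.
move=> Gc; rewrite /phi_fun; set a := \sum_(i < N) c i.
pose M := maxn N (gbound G a).
rewrite -(@sum_trunc _ _ M (fun i => t ^+ i *: c i)) ?leq_maxl //.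
rewrite -(@sum_trunc _ _ M (fun i => t ^+ i *: gcomp G i a)) ?leq_maxr //.
apply: eq_bigr => i _.
have -> : (if (i < N)%N then t ^+ i *: c i else 0) = t ^+ i *: gcomp G i a.
  by rewrite /a gcompE //; case: ifP => // _; rewrite scaler0.
case: (ltnP i (gbound G a)) => // h.
by rewrite /gcomp ltnNge h scaler0.
Qed.

Lemma phi_fun_part t i a : G i a -> phi_fun t a = t ^+ i *: a.
Proof.
move=> Ga; pose c j := if j == i then a else 0.
have Gc j : G j (c j) by rewrite /c; case: eqP => [->|_] //; exact: gpart0.
have sumE (s : nat -> k) : \sum_(j < i.+1) s j *: c j = s i *: a.
  rewrite big_ord_recr /= {2}/c eqxx big1 ?add0r // => j _.
  by rewrite /c ltn_eqF ?scaler0.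
rewrite -[RHS](sumE (fun j => t ^+ j)) -(phi_funE t i.+1 Gc).
congr phi_fun; rewrite -[LHS]scale1r -(sumE (fun=> 1)).
by apply: eq_bigr => j _; rewrite scale1r.
Qed.

Lemma phi_fun_linear t : linear (phi_fun t).
Proof.
move=> s a b; have [N [c [Gc ->]]] := gpart_gen G a.
have [M [d [Gd ->]]] := gpart_gen G b.
pose c' i := if (i < N)%N then c i else 0.
pose d' i := if (i < M)%N then d i else 0.
have Gc' i : G i (c' i) by rewrite /c'; case: ifP => // _; exact: gpart0.
have Gd' i : G i (d' i) by rewrite /d'; case: ifP => // _; exact: gpart0.
rewrite -(sum_trunc c (leq_maxl N M)) -(sum_trunc d (leq_maxr N M)).
rewrite scaler_sumr -big_split /=.
rewrite (phi_funE t _ (c := fun i => s *: c' i + d' i)); last first.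
  by move=> i; apply: gpartD => //; exact: alg_gpartZ.
rewrite (phi_funE t _ Gc') (phi_funE t _ Gd') scaler_sumr -big_split /=.
by apply: eq_bigr => i _; rewrite scalerDr !scalerA mulrC.
Qed.

Lemma phi_fun_sum t I (r : seq I) (P : pred I) F :
  phi_fun t (\sum_(i <- r | P i) F i) = \sum_(i <- r | P i) phi_fun t (F i).
Proof.
have phi0 : phi_fun t 0 = 0.
  by rewrite (phi_fun_part t (gpart0 G 0)) scaler0.
apply: (big_morph (phi_fun t)) => // a b.
by have := phi_fun_linear t 1 a b; rewrite !scale1r.
Qed.

Lemma phi_fun_monoid_morphism t : monoid_morphism (phi_fun t).
Proof.
split=> [|a b].
  by rewrite (phi_fun_part t (gpart1 G)) expr0 scale1r.
have [N [c [Gc ->]]] := gpart_gen G a; have [M [d [Gd ->]]] := gpart_gen G b.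
rewrite [in LHS]big_distrlr /= 3!phi_fun_sum [in RHS]big_distrlr /=.
apply: eq_bigr => i _; rewrite phi_fun_sum; apply: eq_bigr => j _.
rewrite (phi_fun_part t (gpartM (Gc i) (Gd j))) (phi_fun_part t (Gc i)).
by rewrite (phi_fun_part t (Gd j)) exprD -scalerAl -scalerAr scalerA.
Qed.

Lemma phi_funK s t : s * t = 1 -> cancel (phi_fun t) (phi_fun s).
Proof.
move=> st1 a; have [N [c [Gc ->]]] := gpart_gen G a.
rewrite [X in phi_fun s X]phi_fun_sum phi_fun_sum; apply: eq_bigr => i _.
rewrite (phi_fun_part t (Gc i)) (phi_fun_part s (alg_gpartZ _ (Gc i))).
by rewrite scalerA -exprMn st1 expr1n scale1r.
Qed.

Lemma phi_fun_bij (t : kstar k) : bijective (phi_fun (val t)).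
Proof.
exists (phi_fun (val t)^-1); apply: phi_funK; rewrite ?mulVf ?mulfV //;
  exact: kstar_neq0.
Qed.

Definition phi_t (t : kstar k) : kaut k A :=
  KAut (phi_fun_linear (val t)) (phi_fun_monoid_morphism (val t))
       (phi_fun_bij t).

Definition torus : set (kaut k A) := range phi_t.

End Torus.

Section CommutativeAlgebra.
Variable O : comNzRingType.
Implicit Types I J P M : set O.

Definition is_ideal I : Prop :=
  [/\ I 0, forall a b, I a -> I b -> I (a + b) & forall c a, I a -> I (c * a)].

Definition is_prime_ideal P : Prop :=
  [/\ is_ideal P, ~ P 1 & forall a b, P (a * b) -> P a \/ P b].

Definition is_maximal_ideal M : Prop :=
  [/\ is_ideal M, ~ M 1 &
      forall J, is_ideal J -> M `<=` J -> ~ J 1 -> J = M].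

Definition generated_by d I : Prop :=
  exists g : 'I_d -> O,
    I = [set a | exists c : 'I_d -> O, a = \sum_i c i * g i].

Definition noetherian : Prop :=
  forall I, is_ideal I -> exists d, generated_by d I.

Definition has_prime_chain (d : nat) : Prop :=
  exists P : nat -> set O,
    (forall i, (i <= d)%N -> is_prime_ideal (P i)) /\
    (forall i, (i < d)%N -> P i `<` P i.+1).

Definition has_krull_dim (d : nat) : Prop :=
  has_prime_chain d /\ ~ has_prime_chain d.+1.

(* A Noetherian local ring (O, M) is regular when the minimal number of
   generators of M is the Krull dimension of O. *)
Definition regular_local_ring : Prop :=
  noetherian /\
  exists M, [/\ is_maximal_ideal M,
    forall M', is_maximal_ideal M' -> M' = M &
    exists d, [/\ has_krull_dim d, generated_by d M &
                  forall e, (e < d)%N -> ~ generated_by e M]].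

End CommutativeAlgebra.

Section Proj.
Variables (B : comNzRingType) (G : grading B).

Definition homogeneous_ideal (P : set B) : Prop :=
  forall a, P a -> forall i, P (gcomp G i a).

Definition irrelevant_ideal : set B := [set a | gcomp G 0 a = 0].

Record Proj := MkProj {
  proj_ideal : set B;
  proj_prime : is_prime_ideal proj_ideal;
  proj_homogeneous : homogeneous_ideal proj_ideal;
  proj_relevant : ~ (irrelevant_ideal `<=` proj_ideal)
}.

End Proj.

(* The local ring of Proj B at p: the fractions a / s with a and s homogeneous
   of the same degree and s outside p. *)
Section Stalk.
Variables (B : comNzRingType) (G : grading B) (p : Proj G).

Record hfrac := HFrac {
  hnum : B;
  hden : B;
  hfrac_homog : exists d, G d hnum /\ G d hden;
  hfrac_den : ~ proj_ideal p hden
}.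

HB.instance Definition _ := gen_eqMixin hfrac.
HB.instance Definition _ := gen_choiceMixin hfrac.

Implicit Types x y z : hfrac.

Let homog_notin (u : B) := (exists d, G d u) /\ ~ proj_ideal p u.

Lemma homog_notinM u v : homog_notin u -> homog_notin v -> homog_notin (u * v).
Proof.
move=> [[d Gu] pu] [[e Gv] pv]; split; first by exists (d + e)%N; exact: gpartM.
by case: (proj_prime p) => _ _ pr /pr[].
Qed.

Lemma homog_notin1 : homog_notin 1.
Proof. by split; [exists 0%N; exact: gpart1 | case: (proj_prime p)]. Qed.

Lemma hden_homog_notin x : homog_notin (hden x).
Proof. by case: x => a s [d [_ Gs]] ps /=; split=> //; exists d. Qed.

Definition hequiv x y : bool :=
  `[< exists u, [/\ exists d, G d u, ~ proj_ideal p u &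
                    u * (hnum x * hden y - hnum y * hden x) = 0] >].

Lemma hequivP x y : reflect
  (exists u, homog_notin u /\ u * (hnum x * hden y - hnum y * hden x) = 0)
  (hequiv x y).
Proof.
apply: (iffP (asboolP _)) => [[u [Gu pu u0]]|[u [[Gu pu] u0]]].
  by exists u.
by exists u.
Qed.

Lemma hequiv1 x y : hnum x * hden y = hnum y * hden x -> hequiv x y.
Proof.
move=> xy; apply/hequivP; exists 1; split; first exact: homog_notin1.
by rewrite xy subrr mulr0.
Qed.

Lemma hequiv_refl : reflexive hequiv.
Proof. by move=> x; exact: hequiv1. Qed.

Lemma hequiv_sym : ssrbool.symmetric hequiv.
Proof.
move=> x y; apply/hequivP/hequivP => -[u [hu u0]]; exists u; split=> //.
  by rewrite -opprB mulrN u0 oppr0.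
by rewrite -opprB mulrN u0 oppr0.
Qed.

Lemma hequiv_trans : transitive hequiv.
Proof.
move=> y x z /hequivP[u [hu u0]] /hequivP[v [hv v0]]; apply/hequivP.
exists (u * v * hden y); split.
  by apply: homog_notinM; [exact: homog_notinM | exact: hden_homog_notin].
have -> : u * v * hden y * (hnum x * hden z - hnum z * hden x) =
    v * hden z * (u * (hnum x * hden y - hnum y * hden x))
    + u * hden x * (v * (hnum y * hden z - hnum z * hden y)) by ring.
by rewrite u0 v0 !mulr0 addr0.
Qed.

Canonical hequiv_equiv := EquivRel hequiv hequiv_refl hequiv_sym hequiv_trans.

Definition stalk := {eq_quot hequiv}.

HB.instance Definition _ : EqQuotient _ hequiv stalk := EqQuotient.on stalk.
HB.instance Definition _ := Choice.on stalk.

Fact hconst_homog a : G 0 a -> exists d, G d a /\ G d 1.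
Proof. by move=> Ga; exists 0%N; split=> //; exact: gpart1. Qed.

Definition hzero : hfrac := HFrac (hconst_homog (gpart0 G 0)) homog_notin1.2.
Definition hone : hfrac := HFrac (hconst_homog (gpart1 G)) homog_notin1.2.

Fact hopp_homog x : exists d, G d (- hnum x) /\ G d (hden x).
Proof.
by have [d [Ga Gs]] := hfrac_homog x; exists d; split=> //; exact: gpartN.
Qed.

Fact hadd_homog x y : exists d,
  G d (hnum x * hden y + hnum y * hden x) /\ G d (hden x * hden y).
Proof.
have [d [Ga Gs]] := hfrac_homog x; have [e [Gb Gt]] := hfrac_homog y.
exists (d + e)%N; split; last exact: gpartM.
apply: gpartD; first exact: gpartM.
by rewrite addnC; exact: gpartM.
Qed.

Fact hmul_homog x y : exists d,
  G d (hnum x * hnum y) /\ G d (hden x * hden y).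
Proof.
have [d [Ga Gs]] := hfrac_homog x; have [e [Gb Gt]] := hfrac_homog y.
by exists (d + e)%N; split; exact: gpartM.
Qed.

Fact hden_mul x y : ~ proj_ideal p (hden x * hden y).
Proof. exact: (homog_notinM (hden_homog_notin x) (hden_homog_notin y)).2. Qed.

Definition hopp x : hfrac := HFrac (hopp_homog x) (@hfrac_den x).
Definition hadd x y : hfrac := HFrac (hadd_homog x y) (@hden_mul x y).
Definition hmul x y : hfrac := HFrac (hmul_homog x y) (@hden_mul x y).

Definition stalk_zero : stalk := \pi_stalk hzero.
Definition stalk_one : stalk := \pi_stalk hone.
Definition stalk_opp (a : stalk) : stalk := \pi_stalk (hopp (repr a)).
Definition stalk_add (a b : stalk) : stalk := \pi_stalk (hadd (repr a) (repr b)).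
Definition stalk_mul (a b : stalk) : stalk := \pi_stalk (hmul (repr a) (repr b)).

Lemma stalk_eqP x y : hequiv x y -> \pi_stalk x = \pi_stalk y.
Proof. by move=> xy; apply/eqmodP. Qed.

Lemma repr_hequiv x : hequiv (repr (\pi_stalk x)) x.
Proof. by have /eqmodP := reprK (\pi_stalk x). Qed.

Lemma pi_hopp x : stalk_opp (\pi_stalk x) = \pi_stalk (hopp x).
Proof.
apply: stalk_eqP; have /hequivP[u [hu u0]] := repr_hequiv x.
apply/hequivP; exists u; split=> //=.
set y := repr _ in u0 *.
have -> : u * (- hnum y * hden x - - hnum x * hden y) =
          - (u * (hnum y * hden x - hnum x * hden y)) by ring.
by rewrite u0 oppr0.
Qed.

Lemma pi_hadd x y :
  stalk_add (\pi_stalk x) (\pi_stalk y) = \pi_stalk (hadd x y).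
Proof.
apply: stalk_eqP; have /hequivP[u [hu u0]] := repr_hequiv x.
have /hequivP[v [hv v0]] := repr_hequiv y.
apply/hequivP; exists (u * v); split=> /=; first exact: homog_notinM.
set x' := repr (\pi x) in u0 *; set y' := repr (\pi y) in v0 *.
transitivity
  (v * hden y' * hden y * (u * (hnum x' * hden x - hnum x * hden x')) +
   u * hden x' * hden x * (v * (hnum y' * hden y - hnum y * hden y'))).
  by ring.
by rewrite u0 v0 !mulr0 addr0.
Qed.

Lemma pi_hmul x y :
  stalk_mul (\pi_stalk x) (\pi_stalk y) = \pi_stalk (hmul x y).
Proof.
apply: stalk_eqP; have /hequivP[u [hu u0]] := repr_hequiv x.
have /hequivP[v [hv v0]] := repr_hequiv y.
apply/hequivP; exists (u * v); split=> /=; first exact: homog_notinM.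
set x' := repr (\pi x) in u0 *; set y' := repr (\pi y) in v0 *.
transitivity
  (v * hnum y' * hden y * (u * (hnum x' * hden x - hnum x * hden x')) +
   u * hnum x * hden x' * (v * (hnum y' * hden y - hnum y * hden y'))).
  by ring.
by rewrite u0 v0 !mulr0 addr0.
Qed.

Lemma stalk_addA : associative stalk_add.
Proof.
elim/quotW=> x; elim/quotW=> y; elim/quotW=> z.
rewrite (pi_hadd y z) (pi_hadd x y) (pi_hadd x (hadd y z)).
rewrite (pi_hadd (hadd x y) z).
by apply: stalk_eqP;
  apply: hequiv1 => /=; ring.
Qed.

Lemma stalk_addC : commutative stalk_add.
Proof.
elim/quotW=> x; elim/quotW=> y.
by rewrite (pi_hadd x y) (pi_hadd y x); apply: stalk_eqP;
  apply: hequiv1 => /=; ring.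
Qed.

Lemma stalk_add0 : left_id stalk_zero stalk_add.
Proof.
elim/quotW=> x.
by rewrite (pi_hadd hzero x); apply: stalk_eqP;
  apply: hequiv1 => /=; ring.
Qed.

Lemma stalk_addN : left_inverse stalk_zero stalk_opp stalk_add.
Proof.
elim/quotW=> x.
by rewrite (pi_hopp x) (pi_hadd (hopp x) x); apply: stalk_eqP;
  apply: hequiv1 => /=; ring.
Qed.

HB.instance Definition _ := GRing.isZmodule.Build stalk
  stalk_addA stalk_addC stalk_add0 stalk_addN.

Lemma stalk_mulA : associative stalk_mul.
Proof.
elim/quotW=> x; elim/quotW=> y; elim/quotW=> z.
rewrite (pi_hmul y z) (pi_hmul x y) (pi_hmul x (hmul y z)).
rewrite (pi_hmul (hmul x y) z).
by apply: stalk_eqP;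
  apply: hequiv1 => /=; ring.
Qed.

Lemma stalk_mulC : commutative stalk_mul.
Proof.
elim/quotW=> x; elim/quotW=> y.
by rewrite (pi_hmul x y) (pi_hmul y x); apply: stalk_eqP;
  apply: hequiv1 => /=; ring.
Qed.

Lemma stalk_mul1 : left_id stalk_one stalk_mul.
Proof.
elim/quotW=> x.
by rewrite (pi_hmul hone x); apply: stalk_eqP;
  apply: hequiv1 => /=; ring.
Qed.

Lemma stalk_mulD : left_distributive stalk_mul stalk_add.
Proof.
elim/quotW=> x; elim/quotW=> y; elim/quotW=> z.
rewrite (pi_hadd x y) (pi_hmul (hadd x y) z) (pi_hmul x z) (pi_hmul y z).
rewrite (pi_hadd (hmul x z) (hmul y z)); apply: stalk_eqP.
by apply: hequiv1 => /=; ring.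
Qed.

Lemma stalk_one_neq0 : stalk_one != stalk_zero.
Proof.
apply/eqP => /eqmodP /hequivP[u [[_ pu]]] /=.
rewrite mulr1 mul0r subr0 mulr1 => u0; apply: pu; rewrite u0.
by case: (proj_prime p) => -[].
Qed.

HB.instance Definition _ := GRing.Zmodule_isComNzRing.Build stalk
  stalk_mulA stalk_mulC stalk_mul1 stalk_mulD stalk_one_neq0.

Definition singular_point : Prop := ~ regular_local_ring stalk.

End Stalk.

(* pideal takes the proof that g is not a unit because {ideal_quot _} only
   exists for proper ideals. *)
Section PrincipalQuotient.
Variables (A : comUnitRingType) (g : A).

Definition pideal (gU : g \isn't a GRing.unit) : {pred A} :=
  fun a => `[< exists q, a = g * q >].

Hypothesis gU : g \isn't a GRing.unit.

Fact pideal_closed : idealr_closed (pideal gU).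
Proof.
split.
- by apply/asboolP; exists 0; rewrite mulr0.
- apply: contra gU => /asboolP[q gq]; apply/unitrPr.
  by exists q; rewrite -gq.
- move=> a u v /asboolP[q ->] /asboolP[r ->]; apply/asboolP.
  by exists (a * q + r); rewrite mulrDr mulrCA.
Qed.

HB.instance Definition _ := isIdealr.Build A (pideal gU) pideal_closed.

Definition pquot := {ideal_quot (pideal gU)}.
HB.instance Definition _ := GRing.ComNzRing.on pquot.

Definition pquot_pi : {rmorphism A -> pquot} := \pi_pquot.

Lemma pquot_surj b : exists a, pquot_pi a = b.
Proof. by exists (repr b); exact: reprK. Qed.

Lemma pquot_ker a : pquot_pi a = 0 <-> exists q, a = g * q.
Proof.
rewrite -(rmorph0 pquot_pi); split.
  by move/eqP; rewrite -Quotient.idealrBE subr0 => /asboolP.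
by move=> h; apply/eqP; rewrite -Quotient.idealrBE subr0; apply/asboolP.
Qed.

Variables (G : grading A) (d : nat).
Hypothesis Gg : G d g.

Definition pquot_grading : grading pquot :=
  im_grading Gg pquot_surj pquot_ker.

End PrincipalQuotient.

Definition irreducible_elt (A : idomainType) (a : A) : Prop :=
  [/\ a != 0, a \isn't a GRing.unit &
      forall b c, a = b * c -> b \is a GRing.unit \/ c \is a GRing.unit].

Lemma irreducible_nonunit (A : idomainType) (a : A) :
  irreducible_elt a -> a \isn't a GRing.unit.
Proof. by case. Qed.

(* The variables of R = k[x, y, z]. *)
Definition ix : 'I_3 := @Ordinal 3 0 isT.
Definition iy : 'I_3 := @Ordinal 3 1 isT.
Definition iz : 'I_3 := @Ordinal 3 2 isT.

Definition wt (i : 'I_3) : nat := nth 0%N [:: 3; 2; 1] i.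

Definition gradR (k : fieldType) : grading {mpoly k[3]} := wgrading k wt.

Definition at_z0 (k : fieldType) (f : {mpoly k[3]}) : {mpoly k[3]} :=
  f \mPo [tuple 'X_ix; 'X_iy; 0].

Definition mx22 (k : fieldType) (a b c d : k) : 'M[k]_2 :=
  \matrix_(i, j) nth 0 (nth [::] [:: [:: a; b]; [:: c; d]] i) j.

(* Proj (R / fR). *)
Section Curve.
Variables (k : fieldType) (f : {mpoly k[3]}) (d : nat).
Hypotheses (fd : gradR k d f) (f_irr : irreducible_elt f).

Definition curve_grading : grading (pquot (irreducible_nonunit f_irr)) :=
  pquot_grading (irreducible_nonunit f_irr) fd.

Definition curve : Type := Proj curve_grading.

Definition at_least_two_singular_points : Prop :=
  exists P Q : curve, [/\ P <> Q, singular_point P & singular_point Q].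

End Curve.

Section QuotientByMonic.
Variables (A : comNzRingType) (h : {poly A}).

Lemma in_qpoly_surj (a : {poly %/ h}) : exists p, in_qpoly h p = a.
Proof.
exists (val a); apply: val_inj => /=.
by apply: rmodp_small; exact: size_mk_monic.
Qed.

Lemma in_qpoly_eq0 (p : {poly A}) : (1 < size h)%N -> h \is monic ->
  in_qpoly h p = 0 <-> exists q, p = h * q.
Proof.
move=> h_gt1 hM; have hE : mk_monic h = h by rewrite /mk_monic h_gt1 hM.
split=> [/(congr1 val) /= p0|[q ->]].
  have := rdivp_eq hM p; rewrite hE in p0; rewrite p0 addr0 => ->.
  by exists (rdivp p h); rewrite mulrC.
by apply: val_inj; rewrite /= hE mulrC rmodp_mull.
Qed.

End QuotientByMonic.

(* cyclic_cover f n is A = R[W] / (W^n + f): for n > 0 the polynomial is monic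
   of positive degree, so {poly %/ _} is the quotient by it. *)
Section CoverRing.
Variables (k : fieldType) (f : {mpoly k[3]}) (n : nat).

Definition cover_poly : {poly {mpoly k[3]}} := 'X^n + f%:P.

Definition cyclic_cover : Type := {poly %/ cover_poly}.

HB.instance Definition _ := GRing.ComNzRing.on cyclic_cover.

Definition cover_pi : {rmorphism {poly {mpoly k[3]}} -> cyclic_cover} :=
  in_qpoly cover_poly.

Definition cover_scale (c : k) (a : cyclic_cover) : cyclic_cover :=
  cover_pi (c%:MP)%:P * a.

Lemma cover_scaleA c d a :
  cover_scale c (cover_scale d a) = cover_scale (c * d) a.
Proof. by rewrite /cover_scale mpolyCM polyCM rmorphM mulrA. Qed.

Lemma cover_scale1 : left_id 1 cover_scale.
Proof. by move=> a; rewrite /cover_scale mpolyC1 polyC1 rmorph1 mul1r. Qed.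

Lemma cover_scaleDr : right_distributive cover_scale +%R.
Proof. by move=> c a b; rewrite /cover_scale mulrDr. Qed.

Lemma cover_scaleDl a : {morph cover_scale^~ a : c d / c + d}.
Proof.
by move=> c d; rewrite /cover_scale mpolyCD polyCD rmorphD mulrDl.
Qed.

HB.instance Definition _ := GRing.Zmodule_isLmodule.Build k cyclic_cover
  cover_scaleA cover_scale1 cover_scaleDr cover_scaleDl.

Lemma cover_scaleAl (c : k) (a b : cyclic_cover) : c *: (a * b) = (c *: a) * b.
Proof. exact: mulrA. Qed.

HB.instance Definition _ :=
  GRing.Lmodule_isLalgebra.Build k cyclic_cover cover_scaleAl.
HB.instance Definition _ := GRing.Lalgebra_isComAlgebra.Build k cyclic_cover.

Lemma cover_surj a : exists p, cover_pi p = a.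
Proof. exact: in_qpoly_surj. Qed.

Hypothesis n_gt1 : (1 < n)%N.

Lemma size_cover_poly : size cover_poly = n.+1.
Proof.
rewrite /cover_poly size_polyDl size_polyXn // ltnS.
by rewrite (leq_trans (size_polyC_leq1 _)) // ltnW.
Qed.

Lemma cover_poly_monic : cover_poly \is monic.
Proof.
apply/monicP; rewrite lead_coefE size_cover_poly /= coefD coefXn eqxx coefC.
by case: n n_gt1 => // ? _; rewrite addr0.
Qed.

Lemma cover_ker p : cover_pi p = 0 <-> exists q, p = cover_poly * q.
Proof.
apply: in_qpoly_eq0; last exact: cover_poly_monic.
by rewrite size_cover_poly ltnS ltnW.
Qed.

Variable d : nat.
Hypothesis fd : gradR k d f.

(* deg x, deg y, deg z = 3n, 2n, n, and deg w = d. *)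
Definition wt_cover (i : 'I_3) : nat := (n * wt i)%N.

Lemma cover_poly_homog :
  poly_grading (wgrading k wt_cover) d (n * d)%N cover_poly.
Proof.
apply: (gpartD (G := poly_grading (wgrading k wt_cover) d)).
  by rewrite mulnC; exact: poly_partXn.
apply: poly_partC; apply/dhomogP => m /(dhomogP _ _ _ fd) <-.
by rewrite /wdeg big_distrr; apply: eq_bigr => i _; rewrite /= /wt_cover -mulnA.
Qed.

Definition cover_ring_grading : grading cyclic_cover :=
  im_grading cover_poly_homog cover_surj cover_ker.

Lemma cover_gradingZ i c (a : cyclic_cover) :
  cover_ring_grading i a -> cover_ring_grading i (c *: a).
Proof.
move=> ca; rewrite -[i]add0n; apply: gpartM ca.
exists (c%:MP)%:P => //; apply: poly_partC; apply/dhomogP => m.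
rewrite msuppC; case: eqP => //= _; rewrite inE => /eqP ->.
exact: wdeg0.
Qed.

Definition cover_grading : alg_grading cyclic_cover :=
  AlgGrading cover_gradingZ.

End CoverRing.

Section GeneratorDegrees.
Variables (k : fieldType) (f : {mpoly k[3]}) (n d : nat) (n_gt1 : (1 < n)%N).
Hypothesis fd : gradR k d f.
Let G := cover_grading n_gt1 fd.

Lemma wdegU (m : nat) (w : 'I_m -> nat) i : wdeg w U_(i) = w i.
Proof.
rewrite /wdeg (bigD1 i) //= mnm1E eqxx muln1 big1 ?addn0 // => j ji.
by rewrite mnm1E eq_sym (negPf ji) muln0.
Qed.

Lemma gradR_var i : gradR k (wt i) 'X_i.
Proof. by rewrite /= /wpart /= dhomogX; apply/eqP; exact: wdegU. Qed.

Lemma cover_grading_var i : G (n * wt i)%N (cover_pi f n ('X_i)%:P).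
Proof.
exists ('X_i)%:P => //; apply: poly_partC; rewrite /= /wpart /=.
by rewrite dhomogX; apply/eqP; exact: wdegU.
Qed.

Lemma cover_grading_w : G d (cover_pi f n 'X).
Proof. by exists 'X => //; exact: poly_partX. Qed.

End GeneratorDegrees.

(* Main.v *)
From HB Require Import structures.
Require Import Defs.
From mathcomp Require Import all_boot all_order all_algebra.
From mathcomp Require Import generic_quotient.
From mathcomp Require Import boolp classical_sets.
From mathcomp.multinomials Require Import mpoly.
From mathcomp Require Import zify ring.
Import GRing.Theory.
Local Open Scope ring_scope.
Local Open Scope classical_set_scope.

Set Implicit Arguments.
Unset Strict Implicit.
Unset Printing Implicit Defensive.

(** Let C = Proj (R / f R), and let w be the class of W.

    The grading of A is an Euler derivation, and an automorphism phi conjugates it to another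
    derivation E, diagonalizable with nonnegative integer eigenvalues. The homogeneous components
    of E are again derivations. Those of negative degree are locally nilpotent since degrees are
    bounded below, and so is the highest one if its degree is positive, because a product of
    factors E - j kills any given element (top_comp_nilpotent). If A has no nonzero homogeneous
    locally nilpotent derivation, E is therefore homogeneous of degree 0, and the gradings of A and
    of its image under phi are compatible (compatible_gradings). Then the conjugate by phi of the
    element 2 of the torus is a graded automorphism; graded automorphisms lie in the torus
    (graded_hom_torus), and comparing the eigenvalues of that element with those of 2 shows that
    phi itself is graded (aut_graded), hence in the torus.

    Graded automorphisms. Such an automorphism sends z to l z, y to d y + e z ^ 2, x to
    a x + b y z + c z ^ 3 and w to mu w, and multiplies f by mu ^ n. Comparing coefficients of z ^ i
    for i <= 3, and using the values of f and f_z on z = 0 and the determinant, one gets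
    b = c = e = 0, d = l ^ 2, a = l ^ 3 and mu ^ n = l ^ 9 (ninth_jets). As n and 9 are coprime, l
    and mu are t ^ n and t ^ 9 for some t.

    Rigidity of A (cover_rigid). A nonzero homogeneous locally nilpotent derivation D of A maps R to
    R w ^ j for some j < n, since 9 is invertible modulo n. The derivation d of R with D = w ^ j d
    on R is locally nilpotent and satisfies d (d f) = 0 (cover_lnd_restrict). It remains to see that
    C then has at most one singular point (lnd_singular_unique). The main tool is a graded domain of
    transcendence degree at most 2 with a homogeneous locally nilpotent derivation: its homogeneous kernel
    elements of equal degree are proportional (ker_proportional), so that the curve it defines
    contains an affine line, with a coordinate F / U and at most one further point
    (lnd_affine_chart, infinity_subset). The line is regular, because F / U has a zero of a definite
    order at each point (stalk_regular).
    - If d f = 0, after division by powers of f the derivation d does not vanish modulo f, and the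
      tool applies to R / f R.
    - If d f is a nonzero kernel element, let F and U be independent kernel elements of least equal
      degree; they exist because the kernel is too large otherwise (ker_pencil_ex). Almost all
      members F - c U of the pencil are irreducible, and applying the tool to their quotients shows
      that the kernel in degrees divisible by that of U consists of binary forms in F and U
      (ker_binary_form). Since f is a slice up to the factor d f, the function field of C is
      k(F / U), so F and U vanish at each singular point (slice_birational). On an irreducible
      member F - c U, the points with U = 0 are those outside an affine line, so there is at most
      one of them (base_point_unique).

    The quotients by irreducible polynomials are domains because polynomial rings are factorial
    (mpoly_euclid), and they have transcendence degree at most 2 by counting monomials
    (mpoly_alg_dep3_mod). *)


(** * Divisibility and factoriality of polynomial rings *)

Section Divisibility.
Variable D : comNzRingType.
Implicit Types a b c : D.

Definition divides a b := exists c, b = a * c.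

Lemma dvd0 a : divides a 0.
Proof. by exists 0; rewrite mulr0. Qed.

Lemma dvd_refl a : divides a a.
Proof. by exists 1; rewrite mulr1. Qed.

Lemma dvdD a b c : divides a b -> divides a c -> divides a (b + c).
Proof. by move=> [x ->] [y ->]; exists (x + y); rewrite mulrDr. Qed.

Lemma dvdMr a b c : divides a b -> divides a (b * c).
Proof. by move=> [x ->]; exists (x * c); rewrite mulrA. Qed.

Lemma dvdMl a b c : divides a c -> divides a (b * c).
Proof. by rewrite mulrC; exact: dvdMr. Qed.

Lemma dvdN a b : divides a b -> divides a (- b).
Proof. by move=> [x ->]; exists (- x); rewrite mulrN. Qed.

Lemma dvdB a b c : divides a b -> divides a c -> divides a (b - c).
Proof. by move=> ab ac; apply: dvdD => //; exact: dvdN. Qed.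

Lemma dvd_trans a b c : divides a b -> divides b c -> divides a c.
Proof. by move=> [x ->] bc; case: bc => y ->; exists (x * y); rewrite mulrA. Qed.

Lemma dvd_sum a I (r : seq I) (P : pred I) F :
  (forall i, P i -> divides a (F i)) -> divides a (\sum_(i <- r | P i) F i).
Proof. by move=> h; apply: big_ind => //; [exact: dvd0 | exact: dvdD]. Qed.

Definition prime_elt a := forall b c, divides a (b * c) -> divides a b \/ divides a c.

End Divisibility.

(** A size that decreases along proper factorizations makes them terminate. *)
Definition factor_size (D : idomainType) (N : D -> nat) :=
  (forall a b, a != 0 -> b != 0 -> N (a * b) = (N a + N b)%N) /\
  (forall a, a != 0 -> N a = 0%N -> a \is a GRing.unit).

(** Euclid's lemma; together with a size function it makes D factorial. *)
Definition euclid (D : idomainType) :=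
  forall h : D, irreducible_elt h -> prime_elt h.

Lemma irreducible_factor (D : idomainType) (N : D -> nat) (c : D) :
  factor_size N -> c != 0 -> c \isn't a GRing.unit ->
  exists p, irreducible_elt p /\ divides p c.
Proof.
move=> [NM N0]; have [m] := ubnP (N c); elim: m c => // m IH c cm c0 cU.
case: (pselect (irreducible_elt c)) => [ci|]; first by exists c; split=> //; exact: dvd_refl.
move=> nci.
have [a [b [cE aU bU]]] : exists a b,
    [/\ c = a * b, a \isn't a GRing.unit & b \isn't a GRing.unit].
  apply: contrapT => h; apply: nci; split=> // a b cE.
  case: (boolP (a \is a GRing.unit)) => aU; first by left.
  case: (boolP (b \is a GRing.unit)) => bU; first by right.
  by case: h; exists a, b.
move: c0; rewrite cE mulf_eq0 negb_or => /andP[a0 b0].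
have b1 : (0 < N b)%N by rewrite lt0n; apply/eqP => /(N0 _ b0); apply/negP.
have aN : (N a < m)%N.
  by move: cm; rewrite cE NM //; case: (N b) b1 => // l _; rewrite addnS ltnS => /(leq_ltn_trans (leq_addr _ _)).
have [p [pi pa]] := IH a aN a0 aU.
by exists p; split=> //; apply: dvdMr.
Qed.

Lemma dvd_polyC (D : comNzRingType) (p : D) (A : {poly D}) :
  divides p%:P A <-> forall i, divides p A`_i.
Proof.
split=> [[Q ->] i|h]; first by rewrite coefCM; exists Q`_i.
have [q qE] := choice h.
exists (\poly_(i < size A) q i); apply/polyP => i; rewrite coefCM coef_poly.
by case: ltnP => iA; [exact: qE | rewrite mulr0 nth_default].
Qed.

(** If p divides neither A nor B, let i and j be the first indices with A_i and B_j not divisible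
    by p; modulo p, the coefficient of index i + j of A B is A_i B_j. *)
Lemma prime_polyC (D : idomainType) (p : D) : prime_elt p -> prime_elt p%:P.
Proof.
move=> pp A B pAB; apply: contrapT => /not_orP[/dvd_polyC nA /dvd_polyC nB].
have low (C : {poly D}) : ~ (forall i, divides p C`_i) ->
    exists i, ~ divides p C`_i /\ forall j, (j < i)%N -> divides p C`_j.
  move/existsNP => [i]; have [m] := ubnP i; elim: m i => // m IH i im ni.
  have [h|] := pselect (forall j, (j < i)%N -> divides p C`_j); first by exists i.
  move=> /existsNP[j /not_implyP[ji nj]].
  by apply: (IH j) => //; apply: leq_trans ji _; rewrite -ltnS.
have [i [iA hA]] := low A nA; have [j [jB hB]] := low B nB.
have /dvd_polyC/(_ (i + j)%N) := pAB; rewrite coefM.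
have ij : (i < (i + j).+1)%N by rewrite ltnS leq_addr.
rewrite (bigD1 (Ordinal ij)) //= addKn => h.
have rest : divides p (\sum_(l < (i + j).+1 | l != Ordinal ij) A`_l * B`_(i + j - l)).
  apply: dvd_sum => l lij.
  have [li|il] := ltnP l i; first by apply: dvdMr; exact: hA.
  apply: dvdMl; apply: hB; rewrite ltn_subLR; last by rewrite -ltnS.
  rewrite ltn_add2r ltn_neqAle il andbT eq_sym.
  by apply: contra lij => /eqP e; apply/eqP/val_inj.
have := dvdB h rest; rewrite addrK => /pp[]; [exact: iA | exact: jB].
Qed.

(** Gauss's lemma: the primes of D remain prime in D[X], so the constants brought in by
    pseudo-division can be cancelled one prime at a time. *)
Section Gauss.
Variables (D : idomainType) (N : D -> nat).
Hypotheses (NP : factor_size N) (eD : euclid D).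

Lemma const_ind (T : D -> Prop) :
  (forall c, c \is a GRing.unit -> T c) ->
  (forall p c, irreducible_elt p -> c != 0 -> T c -> T (p * c)) ->
  forall c, c != 0 -> T c.
Proof.
move=> Tu Tp c; have [m] := ubnP (N c); elim: m c => // m IH c cm c0.
case: (boolP (c \is a GRing.unit)) => cU; first exact: Tu.
have [p [pi [d cE]]] := irreducible_factor NP c0 cU.
move: c0; rewrite cE mulf_eq0 negb_or => /andP[p0 d0].
have p1 : (0 < N p)%N.
  by rewrite lt0n; apply/eqP => /(NP.2 _ p0); apply/negP; case: pi.
apply: Tp => //; apply: IH => //; move: cm; rewrite cE NP.1 //.
by case: (N p) p1 => // l _; rewrite addSn ltnS => /(leq_ltn_trans (leq_addl _ _)).
Qed.

Lemma prime_const (p : D) : irreducible_elt p -> prime_elt p%:P.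
Proof. by move=> pi; apply: prime_polyC; exact: eD. Qed.

Variable F : {poly D}.
Hypotheses (Fi : irreducible_elt F) (F1 : (1 < size F)%N).

Lemma polyC_ndvd_irr (p : D) : irreducible_elt p -> ~ divides p%:P F.
Proof.
move=> [p0 pU _] [Q FE]; case: Fi => _ _ /(_ _ _ FE)[].
  by rewrite poly_unitE coefC /= (negPf pU) andbF.
rewrite poly_unitE => /andP[/eqP sQ _].
by move: F1; rewrite FE size_Cmul // sQ.
Qed.

Lemma dvd_strip (c : D) (A : {poly D}) : c != 0 -> divides F (c%:P * A) -> divides F A.
Proof.
move=> c0; move: c c0 A; apply: const_ind => [c cU|p c pi c0 IH] A.
  move=> [Q AE]; exists ((c^-1)%:P * Q).
  by rewrite mulrCA -AE mulrA -polyCM mulVr // mul1r.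
rewrite polyCM -mulrA => -[Q AE]; apply: IH.
have /(prime_const pi) : divides p%:P (F * Q) by exists (c%:P * A).
case=> [/(polyC_ndvd_irr pi)//|[Q' QE]].
exists Q'; apply: (@mulfI _ p%:P); first by rewrite polyC_eq0; case: pi.
by rewrite AE QE mulrCA.
Qed.

Lemma factor_strip (c : D) (A B : {poly D}) : c != 0 -> c%:P * F = A * B ->
  exists A' B' b, [/\ F = A' * B', size B' = size B, b != 0 & B = b%:P * B'].
Proof.
move=> c0; move: c c0 A B; apply: const_ind => [c cU|p c pi c0 IH] A B AB.
  exists ((c^-1)%:P * A), B, 1; rewrite oner_neq0 polyC1 mul1r; split=> //.
  by rewrite -mulrA -AB mulrA -polyCM mulVr // mul1r.
have p0 : p%:P != 0 by rewrite polyC_eq0; case: pi.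
have : divides p%:P (A * B) by exists (c%:P * F); rewrite -AB polyCM mulrA.
case/(prime_const pi) => -[C CE].
  have : c%:P * F = C * B.
    by apply: (mulfI p0); rewrite mulrA -polyCM AB CE mulrA.
  exact: IH.
have : c%:P * F = A * C.
  by apply: (mulfI p0); rewrite mulrA -polyCM AB CE mulrCA.
move=> /IH[A' [B' [b [FE sB b0 CbB]]]]; exists A', B', (p * b).
rewrite CE size_Cmul; last by case: pi.
by rewrite sB mulf_neq0 //; [split=> //; rewrite CbB polyCM mulrA | case: pi].
Qed.

(** The pseudo-gcd of F and A is constant or, up to constants, F itself. In the first case
    Bezout's identity shows that F divides a constant multiple of B. *)
Lemma irreducible_poly_prime : prime_elt F.
Proof.
move=> A B FAB; set G := gcdp F A.
have F0 : F != 0 by case: Fi.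
have G0 : G != 0 by rewrite /G gcdp_eq0 negb_and F0.
have [sG|sG] := leqP (size G) 1.
  right; have [[u v] /= uv] := Bezoutp F A.
  have [[c1 c2] /= /andP[c10 c20] cE] := eqpP _ _ uv.
  have GE := size1_polyC sG.
  have g0 : G`_0 != 0 by rewrite -polyC_eq0 -GE.
  apply: (@dvd_strip (c2 * G`_0)); first exact: mulf_neq0.
  rewrite polyCM -GE mul_polyC -cE -mul_polyC -mulrA mulrDl; apply: dvdMl.
  apply: dvdD; first by rewrite mulrAC; apply: dvdMl; exact: dvd_refl.
  by rewrite -mulrA; apply: dvdMl.
left; have [[c Q] /= c0 cE] := Pdiv.WeakIdomain.dvdpP _ _ (dvdp_gcdl F A).
have [[c' Q'] /= c'0 cE'] := Pdiv.WeakIdomain.dvdpP _ _ (dvdp_gcdr F A).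
rewrite -mul_polyC in cE; have [A' [B' [b [FE sB b0 GE]]]] := factor_strip c0 cE.
apply: (@dvd_strip c') => //; rewrite mul_polyC cE' -/G /G GE.
apply: dvdMl; apply: dvdMl.
case: (Fi) => _ _ /(_ _ _ FE)[A'U|].
  by exists (A'^-1); rewrite FE mulrC mulrA mulVr // mul1r.
by rewrite poly_unitE sB => /andP[/eqP sG1]; move: sG; rewrite /G sG1.
Qed.

End Gauss.

Lemma euclid_poly (D : idomainType) (N : D -> nat) :
  factor_size N -> euclid D -> euclid {poly D}.
Proof.
move=> NP eD F Fi; have [sF|sF] := leqP (size F) 1; last exact: irreducible_poly_prime NP eD F Fi sF.
have FE := size1_polyC sF; rewrite FE; apply: prime_polyC; apply: eD.
case: (Fi) => F0 FU Fm; split.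
- by rewrite -polyC_eq0 -FE.
- by apply: contra FU => cU; rewrite FE poly_unitE size_polyC coefC /= cU andbT eqb1; apply: contraTneq cU => ->; rewrite unitr0.
- move=> b c bc; have /Fm : F = b%:P * c%:P by rewrite FE bc polyCM.
  by rewrite !poly_unitE !coefC /= => -[]/andP[_ ?]; [left|right].
Qed.

Lemma euclid_iso (D D' : idomainType) (u : {rmorphism D -> D'})
  (v : {rmorphism D' -> D}) : cancel u v -> cancel v u -> euclid D' -> euclid D.
Proof.
move=> uK vK eD' h [h0 hU hm] a b [c abE].
have uh : irreducible_elt (u h).
  split.
  - by rewrite -(rmorph0 u) (can_eq uK).
  - by apply: contra hU => /(rmorph_unit v); rewrite uK.
  - move=> x y uhE; have /hm : h = v x * v y by rewrite -rmorphM -uhE uK.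
    by case=> /(rmorph_unit u); rewrite vK; [left|right].
have : divides (u h) (u a * u b) by exists (u c); rewrite -!rmorphM abE.
case/(eD' _ uh) => -[d dE]; [left|right]; exists (v d);
  by apply: (can_inj uK); rewrite rmorphM vK.
Qed.

Section MpolyEuclid.
Variable k : fieldType.

Lemma mpoly_factor_size n :
  factor_size (fun p : {mpoly k[n]} => (msize p).-1).
Proof.
split=> [a b a0 b0|a a0 sa].
  rewrite msizeM //; move: a0 b0; rewrite -!msize_poly_eq0.
  by case: (msize a) (msize b) => [|i] [|j] //=; rewrite addnS.
have : (msize a <= 1)%N by move: sa; case: (msize a) => [|[]].
move/msize1_polyC => aE; rewrite aE; apply: rmorph_unit; rewrite unitfE.
by apply: contra a0 => /eqP a0; rewrite aE a0.
Qed.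

(** The inverse of muni: polynomials in n + 1 variables are polynomials in the last one. *)
Definition mlast_poly n (p : {poly {mpoly k[n]}}) : {mpoly k[n.+1]} :=
  (map_poly (@mwiden n k) p).['X_ord_max].

Fact mlast_polyD n : zmod_morphism (@mlast_poly n).
Proof. by move=> p q; rewrite /mlast_poly rmorphB hornerD hornerN. Qed.

Fact mlast_polyM n : monoid_morphism (@mlast_poly n).
Proof.
by split=> [|p q]; rewrite /mlast_poly ?rmorph1 ?hornerC // rmorphM hornerM.
Qed.

HB.instance Definition _ n := GRing.isZmodMorphism.Build _ _ _ (@mlast_polyD n).
HB.instance Definition _ n := GRing.isMonoidMorphism.Build _ _ _ (@mlast_polyM n).

Lemma mlast_polyC n (p : {mpoly k[n]}) : mlast_poly p%:P = mwiden p.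
Proof. by rewrite /mlast_poly map_polyC hornerC. Qed.

Lemma mlast_polyX n : mlast_poly 'X = 'X_ord_max :> {mpoly k[n.+1]}.
Proof. by rewrite /mlast_poly map_polyX hornerX. Qed.

Lemma ord_widenP n (T : 'I_n.+1 -> Prop) :
  (forall i : 'I_n, T (widen_ord (leqnSn n) i)) -> T ord_max -> forall i, T i.
Proof.
move=> Tw Tm i; case: (unliftP ord_max i) => [j ->|->] //.
have -> // : lift ord_max j = widen_ord (leqnSn n) j.
by apply/val_inj; rewrite /= /bump leqNgt ltn_ord.
Qed.

Lemma muni_widen n (i : 'I_n) : muni ('X_(widen_ord (leqnSn n) i) : {mpoly k[n.+1]}) = ('X_i)%:P.
Proof.
rewrite muniE msuppX big_seq1 mcoeffX eqxx scale1r mnm1E.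
rewrite (_ : _ == _ = false) ?expr0 ?alg_polyC; last first.
  by apply/negbTE/eqP => /(congr1 val) /= e; have := ltn_ord i; rewrite e ltnn.
by congr (mpolyX _ _)%:P; apply/mnmP => j; rewrite mnmE !mnm1E.
Qed.

Lemma muni_max n : muni ('X_ord_max : {mpoly k[n.+1]}) = 'X.
Proof.
rewrite muniE msuppX big_seq1 mcoeffX eqxx scale1r mnm1E eqxx expr1.
rewrite (_ : [multinom _ | _ < _] = 0%MM) ?mpolyX0 ?scale1r //.
apply/mnmP => j; rewrite mnmE mnm1E mnm0E.
by apply/eqP; rewrite eqb0; apply/eqP => /(congr1 val) /= e; have := ltn_ord j; rewrite -e ltnn.
Qed.

Lemma mpoly_rmorph_ext n (S : comNzRingType) (u v : {rmorphism {mpoly k[n]} -> S}) :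
  (forall c, u c%:MP = v c%:MP) -> (forall i, u 'X_i = v 'X_i) -> u =1 v.
Proof.
move=> uC uX p; rewrite (mpolyE p) !rmorph_sum; apply: eq_bigr => m _.
rewrite -mul_mpolyC !rmorphM uC; congr (_ * _); rewrite mpolyXE_id !rmorph_prod.
by apply: eq_bigr => i _; rewrite !rmorphXn uX.
Qed.

Lemma muniK n : cancel (@muni n k) (@mlast_poly n).
Proof.
move=> p.
apply: (@mpoly_rmorph_ext _ _ (@mlast_poly n \o @muni n k) idfun) => [c|i] /=.
  by rewrite muniC mlast_polyC mwidenC.
elim/ord_widenP: i => [i|]; last by rewrite muni_max mlast_polyX.
by rewrite muni_widen mlast_polyC mwidenX mnmwiden1.
Qed.

Lemma mlast_polyK n : cancel (@mlast_poly n) (@muni n k).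
Proof.
move=> p; elim/poly_ind: p => [|p c IH]; first by rewrite !rmorph0.
rewrite !rmorphD !rmorphM /= IH mlast_polyX muni_max; congr (_ + _).
rewrite mlast_polyC.
apply: (@mpoly_rmorph_ext _ _ (@muni n k \o @mwiden n k) polyC) => [a|i] /=.
  by rewrite mwidenC muniC.
by rewrite mwidenX mnmwiden1 muni_widen.
Qed.

Theorem mpoly_euclid n : euclid {mpoly k[n]}.
Proof.
elim: n => [|n IH]; last first.
  apply: (euclid_iso (@muniK n) (@mlast_polyK n)).
  exact: euclid_poly (mpoly_factor_size n) IH.
move=> h [h0 hU _]; case/negP: hU; apply: (mpoly_factor_size 0).2 => //.
rewrite (_ : h = (h@_0)%:MP); first by rewrite msizeC; case: eqP.
apply/mpolyP => m; rewrite mcoeffC (_ : m = 0%MM) ?eqxx ?mulr1 //.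
by apply/mnmP => -[].
Qed.

End MpolyEuclid.

(** * Algebraic dependence *)

(** At most D ^ n monomials have degree less than D, so the coefficient matrix of more
    vectors than that has a nontrivial kernel. *)
Lemma mpoly_lin_dep (k : fieldType) (n D : nat) (I : finType)
    (v : I -> {mpoly k[n]}) :
  (forall i, msize (v i) <= D)%N -> (D ^ n < #|I|)%N ->
  exists c : I -> k, (exists i, c i != 0) /\ \sum_i c i *: v i = 0.
Proof.
move=> vD DI; pose J : finType := 'X_{1..n < D}.
pose M : 'M[k]_(#|I|, #|J|) := \matrix_(i < #|I|, j < #|J|)
    (v (enum_val i))@_(val (enum_val j : J)).
have mi (m : J) i : (val m i < D)%N.
  by apply: leq_ltn_trans (bmdeg m); rewrite mdegE (bigD1 i) //= leq_addr.
have cJ : (#|J| <= D ^ n)%N.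
  pose u (m : J) : {ffun 'I_n -> 'I_D} :=
    [ffun i => Ordinal (mi m i)].
  rewrite -[n in (D ^ n)%N]card_ord -[D in (D ^ _)%N]card_ord -card_ffun.
  apply: (@leq_card _ _ u) => m1 m2 m12; apply/val_inj/mnmP => i.
  by have /ffunP/(_ i) := m12; rewrite !ffunE => /(congr1 val).
have kM : kermx M != 0.
  rewrite -mxrank_eq0 mxrank_ker subn_eq0 -ltnNge.
  exact: leq_ltn_trans (rank_leq_col M) (leq_ltn_trans cJ DI).
have /rowV0Pn[u /sub_kermxP uM u0] := kM.
exists (fun i => u 0 (enum_rank i)); split.
  have /rV0Pn[i ui] := u0; exists (enum_val i); by rewrite enum_valK.
apply/mpolyP => m; rewrite mcoeff0 raddf_sum /=.
have [Dm|mD] := leqP D (mdeg m).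
  rewrite big1 // => i _; rewrite mcoeffZ memN_msupp_eq0 ?mulr0 //.
  by apply: msize_mdeg_ge; apply: leq_trans Dm.
have := congr1 (fun A : 'rV_ _ => A 0 (enum_rank (BMultinom mD))) uM.
rewrite !mxE => uMm; rewrite -[RHS]uMm (reindex (@enum_val I I)) /=; last first.
  by apply: onW_bij; exact: enum_val_bij.
by apply: eq_bigr => i _; rewrite mcoeffZ mxE enum_valK enum_rankK.
Qed.

Lemma msize_exp_le (k : fieldType) n (a : {mpoly k[n]}) S N i :
  (0 < S)%N -> (msize a <= S)%N -> (i < N)%N -> (msize (a ^+ i) <= N * S)%N.
Proof.
move=> S0 aS iN; have [->|a0] := eqVneq a 0.
  rewrite expr0n; case: (i == 0%N); last by rewrite msize0.
  by rewrite msize1 muln_gt0 S0 (leq_ltn_trans _ iN).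
apply: (@leq_trans (i * S).+1); last first.
  by apply: leq_trans (leq_mul iN (leqnn S)); rewrite mulSn -add1n leq_add.
elim: i {iN} => [|i IH]; first by rewrite expr0 msize1.
rewrite exprS msizeM ?expf_neq0 // mulSn.
move: IH; case: (msize (a ^+ i)) => [|m] /= IH.
  by rewrite addn0; apply: leq_trans (leq_pred _) (leq_trans aS _); rewrite -addnS leq_addr.
by rewrite addnS /= -addnS leq_add // ltnW.
Qed.

Lemma msizeM_leD (k : fieldType) n (a b : {mpoly k[n]}) S S' :
  (msize a <= S)%N -> (msize b <= S')%N -> (msize (a * b) <= S + S')%N.
Proof.
move=> aS bS; have [->|a0] := eqVneq a 0; first by rewrite mul0r msize0.
have [->|b0] := eqVneq b 0; first by rewrite mulr0 msize0.
by rewrite msizeM //; apply: leq_trans (leq_pred _) (leq_add aS bS).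
Qed.

Lemma sum_pair (V : nmodType) (I J : finType) (F : I * J -> V) :
  \sum_x F x = \sum_i \sum_j F (i, j).
Proof. by rewrite pair_bigA; apply: eq_bigr => -[]. Qed.

Definition combo4 (k : fieldType) n (a b s h : {mpoly k[n]}) N
    (c : nat -> nat -> nat -> nat -> k) :=
  \sum_(m < N) (\sum_(l < N) \sum_(j < N) \sum_(i < N)
    c i j l m *: (a ^+ i * b ^+ j * s ^+ l)) * h ^+ m.

(** Four polynomials in three variables are algebraically dependent: for N large
    the N ^ 4 monomials in them outnumber the monomials that can occur. *)
Lemma mpoly_alg_dep4 (k : fieldType) (a b s h : {mpoly k[3]}) :
  exists N c, (exists i j l m, [/\ (i < N)%N, (j < N)%N, (l < N)%N, (m < N)%N
    & c i j l m != 0]) /\ combo4 a b s h N c = 0.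
Proof.
pose S := (maxn (maxn (msize a) (msize b)) (maxn (msize s) (msize h))).+1.
have [aS bS sS hS] : [/\ msize a <= S, msize b <= S, msize s <= S & msize h <= S]%N.
  by split; apply: leqW; rewrite !leq_max leqnn ?orbT.
pose N := (64 * S ^ 3).+1; pose I : finType := ('I_N * ('I_N * ('I_N * 'I_N)))%type.
pose v (x : I) := a ^+ x.2.2.2 * b ^+ x.2.2.1 * s ^+ x.2.1 * h ^+ x.1.
have vS x : (msize (v x) <= (N * S + N * S + N * S) + N * S)%N.
  by do ?apply: msizeM_leD; apply: msize_exp_le.
have DI : ((N * S + N * S + N * S + N * S) ^ 3 < #|I|)%N.
  rewrite !card_prod card_ord.
  have -> : ((N * S + N * S + N * S + N * S) ^ 3 = (64 * S ^ 3) * (N * (N * N)))%N.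
    by rewrite !expnS expn0; lia.
  by rewrite ltn_mul2r /N ltnSn andbT !muln_gt0.
have [c [[x cx] c0]] := mpoly_lin_dep vS DI.
pose o i : 'I_N := inord i.
exists N, (fun i j l m => c (o m, (o l, (o j, o i)))); split.
  exists x.2.2.2, x.2.2.1, x.2.1, x.1; split=> //.
  by rewrite /o !inord_val; case: x cx => [? [? [? ?]]].
rewrite -[RHS]c0 /combo4.
rewrite sum_pair /=.
apply: eq_bigr => m _; rewrite mulr_suml.
rewrite sum_pair /=.
apply: eq_bigr => l _; rewrite mulr_suml.
rewrite sum_pair /=.
apply: eq_bigr => j _; rewrite mulr_suml; apply: eq_bigr => i _.
by rewrite /o !inord_val -scalerAl.
Qed.

(** Dividing a dependence of a, b, s and h by a power of h leaves one of a, b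
    and s modulo h: the quotient by h has transcendence degree at most 2. *)
Lemma mpoly_alg_dep3_mod (k : fieldType) (a b s h : {mpoly k[3]}) : h != 0 ->
  exists N (c : nat -> nat -> nat -> k),
    (exists i j l, [/\ (i < N)%N, (j < N)%N, (l < N)%N & c i j l != 0]) /\
    divides h (\sum_(l < N) \sum_(j < N) \sum_(i < N)
      c i j l *: (a ^+ i * b ^+ j * s ^+ l)).
Proof.
move=> h0; have [N [c [[i [j [l [m [iN jN lN mN]]]]]]]] := mpoly_alg_dep4 a b s h.
have [n] := ubnP m; elim: n m i j l mN iN jN lN => // n IH m i j l mN iN jN lN mn cm c0.
have [[m' [i' [j' [l' [m'm [i'N j'N l'N c']]]]]]|h'] := pselect (exists m' i' j' l',
    (m' < m)%N /\ [/\ (i' < N)%N, (j' < N)%N, (l' < N)%N & c i' j' l' m' != 0]).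
  apply: (IH m' i' j' l') => //; first exact: ltn_trans m'm mN.
  by apply: leq_trans m'm _; rewrite -ltnS.
exists N, (fun i j l => c i j l m); split; first by exists i, j, l.
have hm : h ^+ m != 0 by rewrite expf_neq0.
move: c0; rewrite /combo4 (bigD1 (Ordinal mN)) //=.
set A := (X in X * _ + _); set B := (X in _ + X).
have [q ->] : divides (h ^+ m * h) B.
  apply: dvd_sum => m' m'm; have [lt|ge] := ltnP m' m.
    rewrite big1 ?mul0r; first exact: dvd0.
    move=> l' _; rewrite big1 // => j' _; rewrite big1 // => i' _.
    case: (eqVneq (c i' j' l' m') 0) => [->|c']; first by rewrite scale0r.
    by case: h'; exists m', i', j', l'.
  apply: dvdMl; exists (h ^+ (m' - m.+1)); rewrite -exprSr -exprD subnKC //.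
  by rewrite ltn_neqAle ge andbT eq_sym.
rewrite mulrC -!mulrA -mulrDr => /eqP; rewrite mulf_eq0 (negPf hm) /=.
by rewrite addr_eq0 /A => /eqP /= ->; apply: dvdN; exists q.
Qed.

(** * Locally nilpotent derivations of integral domains *)

Definition integral (B : comNzRingType) :=
  forall a b : B, a * b = 0 -> a = 0 \/ b = 0.

Definition char0 (B : nzRingType) := forall n, n.+1%:R != 0 :> B.

Definition derivation (B : comNzRingType) (d : B -> B) :=
  {morph d : a b / a + b} /\ forall a b, d (a * b) = d a * b + a * d b.

Definition loc_nilpotent (B : nmodType) (d : B -> B) :=
  forall a, exists n, iter n d a = 0.

Section Derivation.
Variables (B : comNzRingType) (d : B -> B).
Hypothesis dd : derivation d.

Lemma derD a b : d (a + b) = d a + d b.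
Proof. exact: dd.1. Qed.

Lemma derM a b : d (a * b) = d a * b + a * d b.
Proof. exact: dd.2. Qed.

Lemma der0 : d 0 = 0.
Proof. by apply: (addrI (d 0)); rewrite -derD !addr0. Qed.

Lemma derN a : d (- a) = - d a.
Proof. by apply: (addrI (d a)); rewrite -derD !subrr der0. Qed.

Lemma derB a b : d (a - b) = d a - d b.
Proof. by rewrite derD derN. Qed.

Lemma der1 : d 1 = 0.
Proof. by apply: (addrI (d 1)); have := derM 1 1; rewrite !mulr1 mul1r addr0. Qed.

Lemma der_sum I (r : seq I) (P : pred I) F :
  d (\sum_(i <- r | P i) F i) = \sum_(i <- r | P i) d (F i).
Proof. exact: (big_morph d derD der0). Qed.

Lemma der_mulrn a n : d (a *+ n) = d a *+ n.
Proof. by elim: n => [|n IH]; rewrite ?mulr0n ?der0 // !mulrS derD IH. Qed.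

Lemma der_natr n : d n%:R = 0.
Proof. by rewrite der_mulrn der1 mul0rn. Qed.

Lemma derX a n : d (a ^+ n) = n%:R * a ^+ n.-1 * d a.
Proof.
elim: n => [|[|n] IH]; first by rewrite expr0 der1 !mul0r.
  by rewrite expr1 expr0 !mul1r.
by rewrite exprS derM IH /= [n.+2%:R]mulrS !exprS; ring.
Qed.

Lemma derMl c a : d c = 0 -> d (c * a) = c * d a.
Proof. by move=> c0; rewrite derM c0 mul0r add0r. Qed.

Lemma iter_derD n a b : iter n d (a + b) = iter n d a + iter n d b.
Proof. by elim: n => //= n ->; rewrite derD. Qed.

Lemma iter_der0 n : iter n d 0 = 0.
Proof. by elim: n => //= n ->; exact: der0. Qed.

Lemma iter_der_sum n I (r : seq I) (P : pred I) F :
  iter n d (\sum_(i <- r | P i) F i) = \sum_(i <- r | P i) iter n d (F i).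
Proof. exact: (big_morph (iter n d) (iter_derD n) (iter_der0 n)). Qed.

Lemma iter_derMl n c a : d c = 0 -> iter n d (c * a) = c * iter n d a.
Proof. by move=> c0; elim: n => //= n ->; exact: derMl. Qed.

Lemma iter_der_ge0 n m a : iter n d a = 0 -> (n <= m)%N -> iter m d a = 0.
Proof. by move=> a0 nm; rewrite -(subnK nm) iterD a0 iter_der0. Qed.

Lemma der_exp0 a n : d a = 0 -> d (a ^+ n) = 0.
Proof. by move=> a0; rewrite derX a0 mulr0. Qed.

Lemma derM0 a b : d a = 0 -> d b = 0 -> d (a * b) = 0.
Proof. by move=> a0 b0; rewrite derM a0 b0 mulr0 mul0r addr0. Qed.

Lemma leibniz n a b :
  iter n d (a * b) = \sum_(i < n.+1) 'C(n, i)%:R * (iter i d a * iter (n - i) d b).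
Proof.
elim: n => [|n IH]; first by rewrite big_ord_recl big_ord0 /= bin0 mul1r addr0.
rewrite iterS IH der_sum.
under eq_bigr => i _ do rewrite derM der_natr mul0r add0r derM mulrDr -!iterS.
rewrite big_split /= [RHS]big_ord_recl bin0 mul1r subn0.
under [in RHS]eq_bigr => i _ do rewrite !lift0 binS subSS natrD mulrDl.
rewrite big_split /= addrA addrC; congr (_ + _).
rewrite big_ord_recl bin0 mul1r subn0 [in RHS]big_ord_recr /=.
rewrite bin_small // mul0r addr0; congr (_ + _).
by apply: eq_bigr => i _; rewrite /bump /= add1n add0n -(subnSK (ltn_ord i)).
Qed.

Lemma iter_derM_eq0 m n a b : iter m.+1 d a = 0 -> iter n.+1 d b = 0 ->
  iter (m + n).+1 d (a * b) = 0.
Proof.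
move=> a0 b0; rewrite leibniz big1 // => i _.
have [im|mi] := leqP i m; last by rewrite (iter_der_ge0 a0 mi) mul0r mulr0.
by rewrite (@iter_der_ge0 n.+1 (_ - i) b) ?mulr0 // ltn_subRL; lia.
Qed.

Lemma iter_derM_top m n a b : iter m.+1 d a = 0 -> iter n.+1 d b = 0 ->
  iter (m + n) d (a * b) = 'C(m + n, m)%:R * (iter m d a * iter n d b).
Proof.
move=> a0 b0; rewrite leibniz.
have mmn : (m < (m + n).+1)%N by rewrite ltnS leq_addr.
rewrite (bigD1 (Ordinal mmn)) //= addKn big1 ?addr0 // => i im.
have {}im : (i != m :> nat)%N by apply: contra im => /eqP im; apply/eqP/val_inj.
have [{}im|mi] := ltnP i m; last first.
  by rewrite (@iter_der_ge0 m.+1 i a) ?mul0r ?mulr0 //; lia.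
by rewrite (@iter_der_ge0 n.+1 (_ - i) b) ?mulr0 //; lia.
Qed.

Lemma iter_derX_eq0 m n a : iter m.+1 d a = 0 -> iter (m * n).+1 d (a ^+ n) = 0.
Proof.
move=> a0; elim: n => [|n IH]; first by rewrite muln0 expr0 /= der1.
by rewrite exprS mulnS; exact: iter_derM_eq0.
Qed.

End Derivation.

Section LND.
Variables (B : comNzRingType) (d : B -> B).
Hypotheses (dB : integral B) (B0 : char0 B).
Hypotheses (dd : derivation d) (dn : loc_nilpotent d).

Lemma integral_mulf (a b : B) : a <> 0 -> b <> 0 -> a * b <> 0.
Proof. by move=> a0 b0 /dB[]. Qed.

Lemma integral_mulI (a b c : B) : a <> 0 -> a * b = a * c -> b = c.
Proof.
move=> a0 /eqP; rewrite -subr_eq0 -mulrBr => /eqP /dB[//|/eqP].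
by rewrite subr_eq0 => /eqP.
Qed.

Lemma integral_exp0 (a : B) n : a ^+ n = 0 -> a = 0.
Proof.
elim: n => [|n IH]; first by rewrite expr0 => /eqP; rewrite oner_eq0.
by rewrite exprS => /dB[].
Qed.

Lemma char0_neq0 n : (0 < n)%N -> n%:R <> 0 :> B.
Proof. by case: n => // n _; apply/eqP; exact: B0. Qed.

Lemma char0_natr_inj : injective (fun n => n%:R : B).
Proof.
move=> i j; wlog le : i j / (i <= j)%N => [h|].
  by case: (leqP i j) => [/(h _ _)//|/ltnW/(h _ _) h' /esym/h' ->].
move=> ij; apply/eqP; rewrite eqn_leq le leqNgt -subn_gt0 /=; apply/negP => /char0_neq0; apply.
by rewrite natrB // -ij subrr.
Qed.

(** The degree of an element along a locally nilpotent derivation. *)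
Definition lnd_deg a n := iter n.+1 d a = 0 /\ iter n d a <> 0.

Lemma lnd_deg_ex a : a <> 0 -> exists n, lnd_deg a n.
Proof.
move=> a0; have [n an] := dn a; elim: n an => [|n IH] an //.
by have [/IH//|h] := pselect (iter n d a = 0); exists n.
Qed.

Lemma lnd_deg_neq0 a n : lnd_deg a n -> a <> 0.
Proof. by move=> [_ an] a0; apply: an; rewrite a0 iter_der0. Qed.

Lemma lnd_deg_uniq a m n : lnd_deg a m -> lnd_deg a n -> m = n.
Proof.
move=> [am am'] [an an']; apply/eqP; rewrite eqn_leq; apply/andP; split;
  rewrite leqNgt; apply/negP => h.
- by apply: am'; exact: iter_der_ge0 an h.
- by apply: an'; exact: iter_der_ge0 am h.
Qed.

Lemma lnd_deg_der a n : lnd_deg a n.+1 -> lnd_deg (d a) n.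
Proof. by move=> [an an']; split; rewrite -iterSr. Qed.

Lemma lnd_deg0 a : a <> 0 -> d a = 0 -> lnd_deg a 0.
Proof. by []. Qed.

Lemma lnd_deg_ker a : lnd_deg a 0 -> d a = 0.
Proof. by case. Qed.

(** The highest term of Leibniz's rule has a binomial coefficient that is not zero in
    characteristic 0. *)
Lemma lnd_degM a b m n : lnd_deg a m -> lnd_deg b n -> lnd_deg (a * b) (m + n).
Proof.
move=> [am am'] [bn bn']; split; first exact: iter_derM_eq0.
rewrite iter_derM_top //; apply: integral_mulf; last exact: integral_mulf.
by apply: char0_neq0; rewrite bin_gt0 leq_addr.
Qed.

Lemma lnd_degX a m n : lnd_deg a m -> lnd_deg (a ^+ n) (m * n).
Proof.
move=> am; elim: n => [|n IH]; last by rewrite exprS mulnS; exact: lnd_degM.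
rewrite muln0 expr0; split; first by rewrite /= der1.
by apply/eqP; exact: oner_neq0.
Qed.

(** The kernel is factorially closed: degrees along d add up. *)
Lemma lnd_ker_factor a b : a * b <> 0 -> d (a * b) = 0 -> d a = 0.
Proof.
move=> ab0 dab.
have a0 : a <> 0 by move=> a0; apply: ab0; rewrite a0 mul0r.
have b0 : b <> 0 by move=> b0; apply: ab0; rewrite b0 mulr0.
have [m am] := lnd_deg_ex a0; have [n bn] := lnd_deg_ex b0.
have := lnd_deg_uniq (lnd_degM am bn) (lnd_deg0 ab0 dab).
by case: m am => // am _; exact: lnd_deg_ker.
Qed.

(** The degree of d a is one less than that of a, so d a is no nonzero multiple of a. *)
Lemma lnd_dvd_ker a b : d a = a * b -> d a = 0.
Proof.
move=> dab; have [->|a0] := pselect (a = 0); first exact: der0.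
have [m am] := lnd_deg_ex a0; case: m am => [/lnd_deg_ker//|m am].
have am' := lnd_deg_der am; have := lnd_deg_neq0 am'; rewrite {1}dab => ab0.
have b0 : b <> 0 by move=> b0; apply: ab0; rewrite b0 mulr0.
have [n bn] := lnd_deg_ex b0; have := lnd_degM am bn; rewrite -dab => am''.
by have := lnd_deg_uniq am' am''; lia.
Qed.

Lemma lnd_unit a b : a * b = 1 -> d a = 0.
Proof.
move=> ab1; apply: (@lnd_ker_factor a b); rewrite ab1; last exact: der1.
by apply/eqP; exact: oner_neq0.
Qed.

(** The terms c_j s ^ j have distinct degrees along d. *)
Lemma lnd_transcendental s N (c : nat -> B) : d s <> 0 ->
  (forall j, d (c j) = 0) -> \sum_(j < N) c j * s ^+ j = 0 ->
  forall j, (j < N)%N -> c j = 0.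
Proof.
move=> ds dc; elim: N => [|N IH] // cs j jN.
have s0 : s <> 0 by move=> s0; apply: ds; rewrite s0 der0.
have [m sm] := lnd_deg_ex s0.
have m0 : (0 < m)%N by case: m sm => // /lnd_deg_ker.
have cN : c N = 0.
  apply: contrapT => cN; have [_] := lnd_degM (lnd_deg0 cN (dc N)) (lnd_degX N sm).
  rewrite add0n; apply; move: cs; rewrite big_ord_recr /= => cs.
  have -> : c N * s ^+ N = - \sum_(i < N) c i * s ^+ i.
    by apply: (addrI (\sum_(i < N) c i * s ^+ i)); rewrite cs subrr.
  rewrite -sumrN (iter_der_sum dd) big1 // => i _.
  have := (lnd_degX i sm).1; rewrite -mulNr (iter_derMl dd); last first.
    by rewrite (derN dd) dc oppr0.
  move=> /(iter_der_ge0 dd) -> ; rewrite ?mulr0 //.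
  by rewrite ltn_pmul2l.
have [->//|jN'] := eqVneq j N.
apply: IH; last by rewrite ltn_neqAle jN' -ltnS.
by move: cs; rewrite big_ord_recr /= cN mul0r addr0.
Qed.

End LND.

(** * Graded integral domains *)

Section GradedRing.
Variables (B : comNzRingType) (G : grading B).

Lemma gpart_sum e I (r : seq I) (P : pred I) F :
  (forall i, P i -> G e (F i)) -> G e (\sum_(i <- r | P i) F i).
Proof.
by move=> h; apply: big_ind => //; [exact: gpart0 | exact: gpartD].
Qed.

Lemma gpartX e a n : G e a -> G (n * e)%N (a ^+ n).
Proof.
move=> Ga; elim: n => [|n IH]; first by rewrite expr0; exact: gpart1.
by rewrite exprS mulSn; exact: gpartM.
Qed.

Lemma gpartM_eq e i j a b : G i a -> G j b -> (i + j)%N = e -> G e (a * b).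
Proof. by move=> Ga Gb <-; exact: gpartM. Qed.

Lemma gpart_natr n : G 0%N n%:R.
Proof.
elim: n => [|n IH]; first exact: gpart0.
by rewrite mulrS; apply: gpartD => //; exact: gpart1.
Qed.

Lemma gcomp_part i j a : G i a -> gcomp G j a = if j == i then a else 0.
Proof.
move=> Ga; pose c l := if l == i then a else 0.
have Gc l : G l (c l) by rewrite /c; case: eqP => [->|_] //; exact: gpart0.
have aE : \sum_(l < (i + j).+1) c l = a.
  have ij : (i < (i + j).+1)%N by rewrite ltnS leq_addr.
  rewrite (bigD1 (Ordinal ij)) //= /c eqxx big1 ?addr0 // => l li.
  by case: eqP => // e; case/eqP: li; apply: val_inj.
by rewrite -{1}aE gcompE // ltnS leq_addl.
Qed.

Lemma gpart_disj i j a : G i a -> G j a -> i <> j -> a = 0.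
Proof.
by move=> Gi Gj ij; have := gcomp_part j Gi; rewrite (gcomp_part j Gj) eqxx; case: eqP => // /esym.
Qed.

Lemma gcomp_big a N : (gbound G a <= N)%N -> a = \sum_(i < N) gcomp G i a.
Proof.
move=> aN; rewrite {1}(gcomp_sum G a) -(sum_trunc (fun i => gcomp G i a) aN).
by apply: eq_bigr => i _; case: ifP => // h; rewrite /gcomp h.
Qed.

Lemma gcompD i a b : gcomp G i (a + b) = gcomp G i a + gcomp G i b.
Proof.
pose N := maxn i.+1 (maxn (gbound G a) (gbound G b)).
have aN : (gbound G a <= N)%N by rewrite !leq_max leqnn ?orbT.
have bN : (gbound G b <= N)%N by rewrite !leq_max leqnn ?orbT.
rewrite {1}(gcomp_big aN) {1}(gcomp_big bN).
rewrite -big_split /= (gcompE N (c := fun i => gcomp G i a + gcomp G i b)).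
  by rewrite leq_max ltnSn.
by move=> j; apply: gpartD; exact: gcompP.
Qed.

Lemma gcomp0 i : gcomp G i 0 = 0.
Proof. by apply: (addrI (gcomp G i 0)); rewrite -gcompD !addr0. Qed.

Lemma gcompN i a : gcomp G i (- a) = - gcomp G i a.
Proof. by apply: (addrI (gcomp G i a)); rewrite -gcompD !subrr gcomp0. Qed.

Lemma gcomp_sumr i I (r : seq I) (P : pred I) F :
  gcomp G i (\sum_(j <- r | P j) F j) = \sum_(j <- r | P j) gcomp G i (F j).
Proof. exact: (big_morph _ (gcompD i) (gcomp0 i)). Qed.

Lemma gcomp_ext a b : (forall i, gcomp G i a = gcomp G i b) -> a = b.
Proof.
move=> ab; pose N := maxn (gbound G a) (gbound G b).
rewrite (@gcomp_big a N) ?leq_maxl // (@gcomp_big b N) ?leq_maxr //.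
by apply: eq_bigr.
Qed.

Lemma gcomp_eq0 a : (forall i, gcomp G i a = 0) -> a = 0.
Proof. by move=> a0; apply: gcomp_ext => i; rewrite a0 gcomp0. Qed.

Lemma gcomp_bounded a : exists N, forall i, (N <= i)%N -> gcomp G i a = 0.
Proof. by exists (gbound G a) => i; rewrite /gcomp leqNgt => /negPf ->. Qed.

Lemma gcompMl e a b i : G e a -> gcomp G (e + i) (a * b) = a * gcomp G i b.
Proof.
move=> Ga; pose N := maxn i.+1 (gbound G b).
rewrite {1}(@gcomp_big b N) ?leq_maxr // mulr_sumr gcomp_sumr.
have iN : (i < N)%N by rewrite leq_max ltnSn.
rewrite (bigD1 (Ordinal iN)) //= (gcomp_part _ (gpartM Ga (gcompP G i b))) eqxx.
rewrite big1 ?addr0 // => j ji.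
rewrite (gcomp_part _ (gpartM Ga (gcompP G j b))) eqn_add2l.
by case: eqP => // e'; case/eqP: ji; apply: val_inj.
Qed.

Lemma gcompMl_lt e a b i : G e a -> (i < e)%N -> gcomp G i (a * b) = 0.
Proof.
move=> Ga ie; rewrite {1}(gcomp_sum G b) mulr_sumr gcomp_sumr big1 // => j _.
rewrite (gcomp_part _ (gpartM Ga (gcompP G j b))).
by case: eqP => // e'; move: ie; rewrite e' ltnNge leq_addr.
Qed.

Definition homogeneous a := exists e, G e a.

Hypothesis dB : integral B.

(** The products of the lowest and of the highest components of two factors
    are components of their product, so a homogeneous product has homogeneous
    factors. *)
Lemma homogeneous_factor e a b : a * b <> 0 -> G e (a * b) -> homogeneous a.
Proof.
move=> ab0 Gab.
have a0 : a <> 0 by move=> a0; apply: ab0; rewrite a0 mul0r.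
have b0 : b <> 0 by move=> b0; apply: ab0; rewrite b0 mulr0.
have ne (c : B) : c <> 0 -> exists i : 'I_(gbound G c), gcomp G i c != 0.
  move=> c0; apply: contrapT => /forallNP h; apply: c0.
  by rewrite (gcomp_sum G c) big1 // => i _; apply/eqP; apply: contrapT => /negP /h.
have low (c : B) : c <> 0 -> exists i, gcomp G i c <> 0 /\
    forall j, (j < i)%N -> gcomp G j c = 0.
  move=> /ne[i ci]; case: (@ex_minnP (fun i => gcomp G i c != 0)); first by exists i.
  move=> m /eqP cm mm; exists m; split=> // j jm; apply/eqP; apply: contraTT jm.
  by rewrite -leqNgt; exact: mm.
have top (c : B) : c <> 0 -> exists i, gcomp G i c <> 0 /\
    forall j, (i < j)%N -> gcomp G j c = 0.
  move=> /ne[i ci].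
  case: (@ex_maxnP (fun i => gcomp G i c != 0) (gbound G c)); first by exists i.
    move=> j; apply: contraTT; rewrite -ltnNge => /ltnW h.
    by rewrite negbK /gcomp ltnNge h.
  move=> m /eqP cm mm; exists m; split=> // j jm; apply/eqP; apply: contraTT jm.
  by rewrite -leqNgt; exact: mm.
have [i1 [ai1 li1]] := low a a0; have [j1 [bj1 lj1]] := low b b0.
have [i2 [ai2 li2]] := top a a0; have [j2 [bj2 lj2]] := top b b0.
have prodE (i j : nat) :
    (forall i' j', (i' + j' = i + j)%N -> i' != i ->
       gcomp G i' a * gcomp G j' b = 0) ->
    gcomp G (i + j) (a * b) = gcomp G i a * gcomp G j b.
  move=> h; pose N := maxn i.+1 (gbound G a).
  rewrite {1}(@gcomp_big a N) ?leq_maxr // mulr_suml gcomp_sumr.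
  have iN : (i < N)%N by rewrite leq_max ltnSn.
  rewrite (bigD1 (Ordinal iN)) //= gcompMl; last exact: gcompP.
  rewrite big1 ?addr0 // => i' ii'.
  have [le|lt] := leqP i' (i + j); last by apply: gcompMl_lt lt; exact: gcompP.
  rewrite -(subnKC le) gcompMl; last exact: gcompP.
  apply: h; first by rewrite subnKC.
  by apply: contra ii' => /eqP e'; apply/eqP/val_inj.
have e1 : (i1 + j1)%N = e.
  have := gcomp_part (i1 + j1) Gab; rewrite prodE; last first.
    move=> i' j' ij ni; have [lt|] := ltnP i' i1; first by rewrite li1 ?mul0r.
    by move=> ge; rewrite lj1 ?mulr0 //; lia.
  by case: eqP => // _ /dB[].
have e2 : (i2 + j2)%N = e.
  have := gcomp_part (i2 + j2) Gab; rewrite prodE; last first.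
    move=> i' j' ij ni; have [lt|] := ltnP i2 i'; first by rewrite li2 ?mul0r.
    by move=> ge; rewrite lj2 ?mulr0 //; lia.
  by case: eqP => // _ /dB[].
have i12 : (i1 <= i2)%N by rewrite leqNgt; apply/negP => /li2.
have j12 : (j1 <= j2)%N by rewrite leqNgt; apply/negP => /lj2.
exists i1; have -> : a = gcomp G i1 a; last exact: gcompP.
apply: gcomp_ext => i; rewrite (gcomp_part i (gcompP G i1 a)).
case: eqP => [->//|ii1]; have [lt|ge] := ltnP i i1; first exact: li1.
by apply: li2; lia.
Qed.

Lemma homogeneous_factor_deg e i a b : a <> 0 -> G i a -> G e (a * b) ->
  a * b <> 0 -> exists j, (i + j = e)%N /\ G j b.
Proof.
move=> a0 Ga Gab ab0; have [j Gb] : homogeneous b.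
  by apply: (@homogeneous_factor e b a); rewrite mulrC.
exists j; split=> //; apply: contrapT => h; apply: ab0.
exact: gpart_disj (gpartM Ga Gb) Gab h.
Qed.

End GradedRing.

(** A map of degree b - c, stated without negative degrees. *)
Definition shift (B : comNzRingType) (G : grading B) (b c : nat) (d : B -> B) :=
  forall e a, G e a -> d a = 0 \/ exists e', (e' + c = e + b)%N /\ G e' (d a).

Lemma shift_iter (B : comNzRingType) (G : grading B) b c (d : B -> B) n e a :
  derivation d -> shift G b c d -> G e a -> iter n d a = 0 \/
  exists e', (e' + n * c = e + n * b)%N /\ G e' (iter n d a).
Proof.
move=> dd ds Ga; elim: n => [|n [IH|[e1 [e1E IH]]]]; first by right; exists e; rewrite !mul0n.
  by left; rewrite iterS IH der0.
have [|[e2 [e2E h]]] := ds _ _ IH; first by left.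
by right; exists e2; split=> //; rewrite !mulSn; lia.
Qed.

(** * Binary forms in two elements of equal degree *)

Section Forms.
Variables (k : closedFieldType) (B : comNzRingType) (iota : {rmorphism k -> B}).
Variables (F U : B).
Implicit Types (p q : {poly k}) (M N : nat).

(** The homogenization of degree M of p, evaluated at (F, U). *)
Definition binform M p := \sum_(i < M.+1) iota p`_i * (F ^+ i * U ^+ (M - i)).

Lemma binformD M p q : binform M (p + q) = binform M p + binform M q.
Proof.
by rewrite /binform -big_split; apply: eq_bigr => i _; rewrite /= coefD rmorphD mulrDl.
Qed.

Lemma binformZ M c p : binform M (c *: p) = iota c * binform M p.
Proof.
rewrite /binform mulr_sumr; apply: eq_bigr => i _. by rewrite coefZ rmorphM -mulrA.
Qed.

Lemma binform0 M : binform M 0 = 0.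
Proof. by rewrite -(scale0r 0) binformZ rmorph0 mul0r. Qed.

Lemma binformN M p : binform M (- p) = - binform M p.
Proof. by rewrite -scaleN1r binformZ rmorphN1 mulN1r. Qed.

Lemma binform_sum M I (r : seq I) (P : pred I) (f : I -> {poly k}) :
  binform M (\sum_(i <- r | P i) f i) = \sum_(i <- r | P i) binform M (f i).
Proof. exact: (big_morph _ (binformD M) (binform0 M)). Qed.

Lemma binform_Xn M i : (i <= M)%N -> binform M 'X^i = F ^+ i * U ^+ (M - i).
Proof.
move=> iM; have iM' : (i < M.+1)%N by [].
rewrite /binform (bigD1 (Ordinal iM')) //= coefXn eqxx rmorph1 mul1r big1 ?addr0 //.
move=> j ji; rewrite coefXn; case: eqP => [e|_]; last by rewrite rmorph0 mul0r.
by case/eqP: ji; apply: val_inj.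
Qed.

Lemma poly_sum M p : (size p <= M.+1)%N -> p = \sum_(i < M.+1) p`_i *: 'X^i.
Proof.
move=> pM; rewrite -poly_def; apply/polyP => i; rewrite coef_poly.
by case: ltnP => // h; rewrite nth_default // (leq_trans pM).
Qed.

Lemma binformM M N p q : (size p <= M.+1)%N -> (size q <= N.+1)%N ->
  binform (M + N) (p * q) = binform M p * binform N q.
Proof.
move=> /poly_sum -> /poly_sum ->; rewrite [in LHS]big_distrlr /= binform_sum.
rewrite !binform_sum big_distrlr /=; apply: eq_bigr => i _.
rewrite binform_sum; apply: eq_bigr => j _.
have iM := ltn_ord i; have jN := ltn_ord j.
rewrite -scalerAl -scalerAr -exprD !binformZ !binform_Xn //; last by lia.
rewrite (_ : M + N - (i + j) = (M - i) + (N - j))%N; last by lia.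
by rewrite !exprD; ring.
Qed.

Lemma binform_constE : binform 0 1 = 1.
Proof. by rewrite -(expr0 'X) binform_Xn // !expr0 mulr1. Qed.

Lemma binformU M N p : (size p <= M.+1)%N -> binform (M + N) p = U ^+ N * binform M p.
Proof.
move=> pM; have h : (size (1%R : {poly k}) <= N.+1)%N by rewrite size_poly1.
rewrite -{1}[p]mulr1 (binformM pM h) mulrC -(expr0 'X) binform_Xn //.
by rewrite expr0 mul1r subn0.
Qed.

Lemma binformX M n p : (size p <= M.+1)%N -> binform (n * M) (p ^+ n) = binform M p ^+ n.
Proof.
move=> pM; elim: n => [|n IH]; first by rewrite !expr0 mul0n binform_constE.
rewrite !exprS mulSn binformM ?IH //.
apply: leq_trans (size_poly_exp_leq _ _) _; rewrite ltnS mulnC leq_mul //.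
by case: (size p) pM.
Qed.

Lemma binform_linear c : binform 1 ('X - c%:P) = F - iota c * U.
Proof.
rewrite binformD binformN -['X]expr1 binform_Xn // -[c%:P]mulr1 mul_polyC binformZ.
by rewrite -(expr0 'X) binform_Xn // expr1 !expr0 expr1 mulr1 mul1r.
Qed.

(** Modulo F - c U, a form depends only on the value of its polynomial at c. *)
Lemma binform_horner M q c : (size q <= M.+1)%N -> exists r,
  binform M q = iota q.[c] * U ^+ M + (F - iota c * U) * r.
Proof.
move=> qM; have q0 : (q - (q.[c])%:P).[c] == 0 by rewrite hornerD hornerN hornerC subrr.
have [r rE] := factor_theorem _ _ q0.
have -> : q = (q.[c])%:P + r * ('X - c%:P) by rewrite -rE addrC subrK.
rewrite binformD hornerD hornerM hornerXsubC subrr mulr0 addr0 hornerC.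
have -> : binform M (q.[c])%:P = iota q.[c] * U ^+ M.
  by rewrite -[_%:P]mulr1 mul_polyC binformZ -(expr0 'X) binform_Xn // expr0 mul1r subn0.
have sM : (size (r * ('X - c%:P))%R <= M.+1)%N.
  rewrite -rE; apply: leq_trans (size_polyD _ _) _; rewrite geq_max qM size_polyN.
  by apply: leq_trans (size_polyC_leq1 _) _.
have [->|r0] := eqVneq r 0; first by exists 0; rewrite mul0r binform0 mulr0.
move: sM; rewrite size_Mmonic ?monicXsubC // size_XsubC addn2 /= ltnS.
case: M {qM} => [|M] rM; first by move: r0; rewrite -size_poly_eq0; case: (size r) rM.
exists (binform M r); rewrite -[M.+1]addn1 binformM ?size_XsubC // binform_linear.
by rewrite [_ * binform M r]mulrC.
Qed.

Hypotheses (dB : integral B) (U0 : U <> 0).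

(** Over an algebraically closed field a binary form is a product of linear
    forms, so two elements are independent as soon as they are not
    proportional. *)
Lemma binform_eq0 M p : (forall c, F <> iota c * U) -> (size p <= M.+1)%N ->
  binform M p = 0 -> p = 0.
Proof.
move=> FU; elim: M p => [|M IH] p pM pF.
  have := poly_sum pM; rewrite big_ord1 expr0 => pE.
  have := pF; rewrite /binform big_ord1 expr0 mul1r expr0 mulr1 => c0.
  have /eqP : iota p`_0 = 0 by [].
  by rewrite fmorph_eq0 => /eqP c; rewrite pE c scale0r.
have [p1|p1] := boolP (size p == 1%N).
  have pM' : (size p <= M.+1)%N by rewrite (eqP p1).
  apply: IH => //; move: pF; rewrite -addn1 binformU // expr1 => /dB[].
    by move/U0.
  by [].
have /closed_rootP[c /factor_theorem[q pE]] := p1.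
have [q0|q0] := eqVneq q 0; first by rewrite pE q0 mul0r.
have qM : (size q <= M.+1)%N.
  by move: pM; rewrite pE size_Mmonic ?monicXsubC // size_XsubC addn2 /= ltnS.
move: pF; rewrite pE -addn1 binformM ?size_XsubC // binform_linear => /dB[/(IH _ qM)|].
  by move/eqP; rewrite (negPf q0).
by move/eqP; rewrite subr_eq0 => /eqP /FU.
Qed.

Variable G : grading B.
Hypothesis Gi : forall c, G 0%N (iota c).

Lemma binform_part d M p : G d F -> G d U -> G (M * d)%N (binform M p).
Proof.
move=> GF GU; apply: gpart_sum => i _; rewrite -[(M * d)%N]add0n.
apply: gpartM => //; apply: (gpartM_eq (gpartX i GF) (gpartX (M - i) GU)).
by rewrite -mulnDl subnKC // -ltnS.
Qed.

End Forms.

(** * Graded surfaces with a locally nilpotent derivation *)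

Definition const_part (k : closedFieldType) (B : comNzRingType)
    (iota : {rmorphism k -> B}) (G : grading B) :=
  forall b, G 0%N b <-> exists c, b = iota c.

Definition trdeg_le2 (k : closedFieldType) (B : comNzRingType)
    (iota : {rmorphism k -> B}) :=
  forall a b s : B, exists N (c : nat -> nat -> nat -> k),
    (exists i j l, [/\ (i < N)%N, (j < N)%N, (l < N)%N & c i j l != 0]) /\
    \sum_(l < N) \sum_(j < N) \sum_(i < N)
      iota (c i j l) * (a ^+ i * b ^+ j * s ^+ l) = 0.

Section Surface.
Variables (k : closedFieldType) (B : comNzRingType) (iota : {rmorphism k -> B}).
Variables (G : grading B).
Hypotheses (dB : integral B) (k0 : char0 k) (GC : const_part iota G).

Lemma const_gpart c : G 0%N (iota c).
Proof. by apply/GC; exists c. Qed.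

Lemma char0_alg : char0 B.
Proof. by move=> n; rewrite -(rmorph_nat iota) fmorph_eq0; exact: k0. Qed.

Variable d : B -> B.
Hypotheses (dd : derivation d) (dn : loc_nilpotent d).

Lemma lnd_const c : d (iota c) = 0.
Proof.
have [->|c0] := eqVneq c 0; first by rewrite rmorph0 der0.
apply: (lnd_unit dB char0_alg dd dn (b := iota c^-1)).
by rewrite -rmorphM divff // rmorph1.
Qed.

Hypothesis td : trdeg_le2 iota.

(** The kernel has transcendence degree at most 1, because an element outside it is
    transcendental over it. A homogeneous relation between a and b is a binary form,
    hence a product of linear forms. *)
Lemma ker_proportional e a b s : d s <> 0 -> (0 < e)%N ->
  G e a -> G e b -> d a = 0 -> d b = 0 -> b <> 0 -> exists c, a = iota c * b.
Proof.
move=> ds e0 Ga Gb da db b0; apply: contrapT => /forallNP ab.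
have [N [c [[i0 [j0 [l0 [iN jN lN cn]]]]]]] := td a b s => rel.
pose S l := \sum_(j < N) \sum_(i < N) iota (c i j l) * (a ^+ i * b ^+ j).
have S0 : S l0 = 0.
  apply: (lnd_transcendental dB char0_alg dd dn ds (N := N)) => // [l|].
    rewrite /S (der_sum dd) big1 // => j _; rewrite (der_sum dd) big1 // => i _.
    rewrite derM0 ?lnd_const //; rewrite derM0 //; exact: der_exp0.
  rewrite -[RHS]rel; apply: eq_bigr => l _; rewrite /S mulr_suml.
  apply: eq_bigr => j _; rewrite mulr_suml; apply: eq_bigr => i _.
  by rewrite !mulrA.
pose D := (i0 + j0)%N.
pose p := \poly_(i < D.+1) (if (i < N)%N && (D - i < N)%N then c i (D - i)%N l0 else 0).
have p0 : p = 0.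
  apply: (binform_eq0 dB b0 ab (size_poly _ _)).
  have := congr1 (gcomp G (D * e)) S0; rewrite gcomp0 /S gcomp_sumr => <-.
  pose g i := if (D - i < N)%N
    then iota (c i (D - i)%N l0) * (a ^+ i * b ^+ (D - i)) else 0.
  transitivity (\sum_(i < D.+1) if (i < N)%N then g i else 0).
    apply: eq_bigr => i _; rewrite coef_poly ltn_ord /g.
    by case: (i < N)%N => /=; case: (D - i < N)%N; rewrite ?rmorph0 ?mul0r.
  transitivity (\sum_(i < N) if (i < D.+1)%N then g i else 0).
    rewrite -(@sum_trunc _ D.+1 (D.+1 + N) (fun i => if (i < N)%N then g i else 0)) ?leq_addr //.
    rewrite -(@sum_trunc _ N (D.+1 + N) (fun i => if (i < D.+1)%N then g i else 0)) ?leq_addl //.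
    by apply: eq_bigr => i _; case: ifP; case: ifP.
  under [RHS]eq_bigr => j _ do rewrite gcomp_sumr.
  rewrite [RHS]exchange_big /=; apply: eq_bigr => i _.
  have term (j : nat) : gcomp G (D * e) (iota (c i j l0) * (a ^+ i * b ^+ j)) =
      if (i + j == D)%N then iota (c i j l0) * (a ^+ i * b ^+ j) else 0.
    have Gt : G ((i + j) * e)%N (iota (c i j l0) * (a ^+ i * b ^+ j)).
      rewrite -[((i + j) * e)%N]add0n mulnDl; apply: gpartM; first exact: const_gpart.
      by apply: gpartM; exact: gpartX.
    by rewrite (gcomp_part _ Gt) eqn_pmul2r // eq_sym.
  under [RHS]eq_bigr => j _ do rewrite term.
  rewrite /g; case: ltnP => iD; last first.
    by rewrite big1 // => j _; case: eqP => // e'; lia.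
  case: ltnP => DiN; last first.
    by rewrite big1 // => j _; case: eqP => // e'; have := ltn_ord j; lia.
  rewrite (bigD1 (Ordinal DiN)) //= subnKC // eqxx big1 ?addr0 // => j jD.
  case: eqP => // e'; case/eqP: jD; apply: val_inj => /=; lia.
have := congr1 (fun p : {poly k} => p`_i0) p0.
rewrite coef_poly coef0 iN ltnS leq_addr addKn jN /= => c0.
by rewrite c0 eqxx in cn.
Qed.

End Surface.

Section AffineChart.
Variables (k : closedFieldType) (B : comNzRingType) (iota : {rmorphism k -> B}).
Variables (G : grading B).
Hypotheses (dB : integral B) (k0 : char0 k) (GC : const_part iota G).
Variable d : B -> B.
Hypotheses (dd : derivation d) (dn : loc_nilpotent d).
Variables (b0 c0 : nat).
Hypothesis ds : shift G b0 c0 d.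

Let B0 : char0 B := char0_alg iota k0.

Lemma iter_der_slice s n : d (d s) = 0 ->
  iter n d (s ^+ n) = n`!%:R * d s ^+ n /\ iter n.+1 d (s ^+ n) = 0.
Proof.
move=> d2s; have s2 : iter 2 d s = 0 by [].
split; last by have := iter_derX_eq0 dd n s2; rewrite mul1n.
elim: n => [|n IH]; first by rewrite !expr0 mulr1.
have sn : iter n.+1 d (s ^+ n) = 0.
  by have := iter_derX_eq0 dd n s2; rewrite mul1n.
rewrite exprS -[n.+1]add1n (iter_derM_top dd s2 sn) IH bin1 add1n /=.
by rewrite factS natrM exprS; ring.
Qed.

(** If d ^ n b is the last nonzero iterate, subtracting (d ^ n b) s ^ n from n! (d s) ^ n b lowers
    the degree along d. *)
Lemma slice_expansion s es et e b : G es s -> G et (d s) -> d (d s) = 0 ->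
  (et + c0 = es + b0)%N -> G e b ->
  exists N J (a : nat -> B), [/\ forall j, d (a j) = 0,
    forall j, a j = 0 \/
      exists ej, (ej + j * es = e + N * et)%N /\ G ej (a j)
    & d s ^+ N * b = \sum_(j < J) a j * s ^+ j].
Proof.
move=> Gs Gt d2s est; have [n] := dn b; elim: n e b => [|n IH] e b /= bn Gb.
  exists 0%N, 0%N, (fun=> 0); split=> [j|j|]; first exact: der0.
    by left.
  by rewrite bn mulr0 big_ord0.
pose c := iter n d b; have dc : d c = 0 by [].
have d2sn m : d (d s ^+ m) = 0 by exact: der_exp0.
have Gc : c = 0 \/ exists ec, (ec + n * es = e + n * et)%N /\ G ec c.
  case: (shift_iter n dd ds Gb) => [|[ec [ecE Gc]]]; first by left.
  by right; exists ec; split=> //; have := congr1 (muln n) est; rewrite !mulnDr; lia.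
pose b' := n`!%:R * (d s ^+ n * b) - c * s ^+ n.
have b'n : iter n d b' = 0.
  rewrite /b' -mulNr (iter_derD dd) !(iter_derMl dd) ?(der_natr dd) ?(derN dd) ?dc ?oppr0 //.
  by rewrite (iter_der_slice n d2s).1 -/c; ring.
have Gb' : G (e + n * et)%N b'.
  apply: gpartB.
    rewrite -[(e + n * et)%N]add0n; apply: gpartM; first exact: gpart_natr.
    by rewrite addnC; apply: gpartM => //; exact: gpartX.
  case: Gc => [->|[ec [<- Gc]]]; first by rewrite mul0r; exact: gpart0.
  by apply: gpartM => //; exact: gpartX.
have [N [J [a [da Ga aE]]]] := IH _ _ b'n Gb'.
pose f := iota (n`!%:R)^-1.
have f1 : f * n`!%:R = 1.
  rewrite /f -(rmorph_nat iota) -rmorphM mulVf ?rmorph1 //.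
  by have := fact_gt0 n; case: (n`!) => // m _; exact: k0.
have df : d f = 0 by exact: lnd_const.
pose a' j := f * ((if (j < J)%N then a j else 0) +
                  (if (j < n.+1)%N then if j == n then d s ^+ N * c else 0 else 0)).
exists (N + n)%N, (J + n.+1)%N, a'; split=> [j|j|].
- have dsNc : d (d s ^+ N * c) = 0 by exact: derM0.
  rewrite /a' derM0 // (derD dd); case: (j < J)%N; case: (j < n.+1)%N;
    try case: (j == n); by rewrite ?da ?(der0 dd) ?dsNc ?addr0.
- have h1 : (if (j < J)%N then a j else 0) = 0 \/ exists ej,
      (ej + j * es = e + (N + n) * et)%N /\ G ej (if (j < J)%N then a j else 0).
    case: ifP => _; last by left.
    by case: (Ga j) => [|[ej [ejE Gej]]]; [left|right; exists ej; split=> //; rewrite mulnDl; lia].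
  have h2 : (if (j < n.+1)%N then if j == n then d s ^+ N * c else 0 else 0) = 0 \/
      exists ej, (ej + j * es = e + (N + n) * et)%N /\
       G ej (if (j < n.+1)%N then if j == n then d s ^+ N * c else 0 else 0).
    case: ifP => _; last by left.
    case: eqP => [->|_]; last by left.
    case: Gc => [->|[ec [ecE Gc]]]; first by left; rewrite mulr0.
    right; exists (N * et + ec)%N; split; first by rewrite mulnDl; lia.
    by apply: gpartM => //; exact: gpartX.
  have Gf : G 0%N f by apply: const_gpart.
  rewrite /a'; case: h1 => [->|[e1 [e1E G1]]].
    case: h2 => [->|[e2 [e2E G2]]]; first by left; rewrite addr0 mulr0.
    by right; exists e2; rewrite add0r; split=> //; rewrite -[e2]add0n; exact: gpartM.
  right; exists e1; split=> //; rewrite -[e1]add0n; apply: gpartM => //.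
  apply: gpartD => //; case: h2 => [->|[e2 [e2E G2]]]; first exact: gpart0.
  by have -> : e1 = e2 by lia.
- rewrite /a'; under eq_bigr => j _ do rewrite -mulrA mulrDl.
  rewrite -mulr_sumr big_split /=.
  under eq_bigr => j _ do rewrite (fun_if (fun z => z * s ^+ j)) mul0r.
  rewrite (sum_trunc (fun j => a j * s ^+ j)) ?leq_addr //.
  under [X in _ + X]eq_bigr => j _ do rewrite (fun_if (fun z => z * s ^+ j)) mul0r.
  rewrite (sum_trunc (fun j => (if j == n then d s ^+ N * c else 0) * s ^+ j)) ?leq_addl //.
  rewrite -aE big_ord_recr /= eqxx big1 ?add0r; last first.
    by move=> j _; rewrite ltn_eqF ?mul0r.
  transitivity (f * n`!%:R * (d s ^+ (N + n) * b)); first by rewrite f1 mul1r.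
  by rewrite /b' exprD; ring.
Qed.

Lemma local_slice : (exists a, d a <> 0) ->
  exists s es et, [/\ G es s, G et (d s), d s <> 0, d (d s) = 0 & (et + c0 = es + b0)%N].
Proof.
move=> [a da].
have [i di] : exists i, d (gcomp G i a) <> 0.
  apply: contrapT => /forallNP h; apply: da; rewrite (gcomp_sum G a) (der_sum dd).
  by rewrite big1 // => i _; apply: contrapT; exact: h.
set b := gcomp G i a in di; have Gb : G i b by exact: gcompP.
have b1 : b <> 0 by move=> b1; apply: di; rewrite b1 der0.
have [[|n] [bn bn']] := lnd_deg_ex dn b1; first by case: di.
have [h|[es [esE Gs]]] := shift_iter n dd ds Gb.
  by case: bn'; rewrite iterS h der0.
have [h|[et [etE Gt]]] := ds Gs; first by case: bn'.
by exists (iter n d b), es, et.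
Qed.

Hypothesis td : trdeg_le2 iota.

Lemma ker_proportional0 e a b s : d s <> 0 ->
  G e a -> G e b -> d a = 0 -> d b = 0 -> b <> 0 -> exists c, a = iota c * b.
Proof.
move=> dds Ga Gb da db b1; case: (posnP e) => [e0|e_gt0]; last first.
  exact: (ker_proportional dB k0 GC dd dn td dds e_gt0).
move: Ga Gb; rewrite e0 => /GC[x ->] /GC[y yE]; exists (x / y).
rewrite yE -rmorphM divfK //; apply/eqP => y0; apply: b1.
by rewrite yE y0 rmorph0.
Qed.

(** The open set U <> 0 of the curve is an affine line with coordinate F / U. *)
Definition affine_chart (F U : B) dg :=
  [/\ (0 < dg)%N, G dg F, G dg U, U <> 0 &
    forall m b, G (m * dg)%N b -> exists N (p : {poly k}), (size p <= (N + m).+1)%N /\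
      U ^+ N * b = binform iota F U (N + m) p].

(** Let s be a local slice and j0 > 0 the least exponent such that some kernel multiple of s ^ j0
    has the degree of a kernel element. By homogeneity, only powers of s ^ j0 occur in the
    expansion along s of an element whose degree is a multiple of dg, and their coefficients,
    lying in the kernel, are known up to constants. *)
Lemma lnd_affine_chart u eu : (exists a, d a <> 0) ->
  G eu u -> (0 < eu)%N -> u <> 0 -> d u = 0 ->
  exists F U dg, [/\ affine_chart F U dg, d U = 0 & forall c, F <> iota c * U].
Proof.
move=> /local_slice[s [es [et [Gs Gt dds d2s est]]]] Gu eu0 u0 du.
have s0 : s <> 0 by move=> s0; apply: dds; rewrite s0 der0.
pose R j := (0 < j)%N /\ exists e1 c1 e2 c2,
  [/\ [/\ G e1 c1, d c1 = 0 & c1 <> 0], [/\ G e2 c2, d c2 = 0 & c2 <> 0]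
    & (e1 + j * es = e2)%N].
have expne (x : B) m : x <> 0 -> x ^+ m <> 0 by move=> x0 /integral_exp0 -/(_ dB).
have [j0 [Rj0 minj0]] : exists j0, R j0 /\ forall j, R j -> (j0 <= j)%N.
  have exR : exists j, `[< R j >].
    exists eu; apply/asboolP; split=> //; exists eu, u, (es.+1 * eu)%N, (u ^+ es.+1).
    by split; [split|split|lia] => //; [exact: gpartX|exact: der_exp0|exact: expne].
  have [j0 /asboolP Rj0 minj0] := ex_minnP exR; exists j0; split=> // j Rj.
  by apply: minj0; apply/asboolP.
have [j0_gt0 [e1 [c1 [e2 [c2 [[G1 d1 n1] [G2 d2 n2] e12]]]]]] := Rj0.
(* The factor u makes the degree of F and U positive. *)
pose dg := (eu + e2)%N; pose F := u * c1 * s ^+ j0; pose U := u * c2.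
have U0 : U <> 0 by exact: (integral_mulf dB).
have dU : d U = 0 by exact: derM0.
have GU : G dg U by exact: gpartM.
have GF : G dg F.
  apply: (gpartM_eq (gpartM Gu G1) (gpartX j0 Gs)); rewrite /dg; lia.
exists F, U, dg; split=> //; last first.
  move=> c FU; have : d F = 0 by rewrite FU derM0 // lnd_const.
  rewrite derMl ?derM0 //; apply: (integral_mulf dB) => //; first exact: (integral_mulf dB).
  rewrite derX //; apply: (integral_mulf dB) => //; apply: (integral_mulf dB) => //; last exact: expne.
  exact: char0_neq0.
split=> //; first by rewrite /dg addn_gt0 eu0.
move=> m b Gb.
have [N [J [a [da Ga aE]]]] := slice_expansion Gs Gt d2s est Gb.
have key j : exists li : k * nat, (li.2 <= j)%N /\ ((j < J)%N -> a j * s ^+ j * U ^+ J =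
    iota li.1 * (d s ^+ N * (F ^+ li.2 * U ^+ (J + m - li.2)))).
  case: (pselect (a j = 0)) => [aj0|aj0].
    by exists (0, 0%N); split=> // _; rewrite aj0 rmorph0 !mul0r.
  have [//|[ej [ejE Gej]]] := Ga j.
  pose i := (j %/ j0)%N; pose r := (j %% j0)%N.
  have jE : (j = i * j0 + r)%N by exact: divn_eq.
  pose C1 := a j * U ^+ i; pose C2 := U ^+ m * d s ^+ N * (u * c1) ^+ i.
  have GC1 : G (ej + i * dg)%N C1 by apply: gpartM => //; exact: gpartX.
  have GC2 : G (m * dg + N * et + i * (eu + e1))%N C2.
    by apply: gpartM; [apply: gpartM|]; apply: gpartX => //; exact: gpartM.
  have dC1 : d C1 = 0 by apply: derM0 => //; exact: der_exp0.
  have dC2 : d C2 = 0 by do ?apply: derM0 => //; apply: der_exp0 => //; exact: derM0.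
  have C10 : C1 <> 0 by apply: (integral_mulf dB) => //; exact: expne.
  have C20 : C2 <> 0.
    by apply: (integral_mulf dB); [apply: (integral_mulf dB)|] => //; apply: expne => //; exact: (integral_mulf dB).
  have degE : (ej + i * dg + r * es = m * dg + N * et + i * (eu + e1))%N.
    have : (j * es = i * (j0 * es) + r * es)%N by rewrite {1}jE mulnDl mulnA.
    have : (i * e1 + i * (j0 * es) = i * e2)%N by rewrite -mulnDr e12.
    rewrite /dg !mulnDr; move: ejE; lia.
  have r0 : r = 0%N.
    apply/eqP; rewrite -leqn0 leqNgt; apply/negP => r_gt0.
    have : R r.
      split=> //; exists (ej + i * dg)%N, C1, (m * dg + N * et + i * (eu + e1))%N, C2.
      by split.
    by move/minj0; rewrite leqNgt ltn_pmod.
  move: degE GC1 jE; rewrite r0 mul0n !addn0 => -> GC1 jE.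
  have [l lE] := ker_proportional0 dds GC1 GC2 dC1 dC2 C20.
  exists (l, i); rewrite /=; have ij : (i <= j)%N by rewrite jE leq_pmulr.
  split=> // jJ.
  have -> : U ^+ J = U ^+ i * U ^+ (J - i) by rewrite -exprD subnKC // ltnW // (leq_ltn_trans ij).
  have -> : U ^+ (J + m - i) = U ^+ (J - i) * U ^+ m.
    by rewrite -exprD; congr (_ ^+ _); lia.
  have -> : F ^+ i = (u * c1) ^+ i * s ^+ j by rewrite /F exprMn -exprM mulnC -jE.
  have -> : a j * s ^+ j * (U ^+ i * U ^+ (J - i)) = C1 * (s ^+ j * U ^+ (J - i)).
    by rewrite /C1; ring.
  by rewrite lE /C2; ring.
have [li liP] := choice key.
pose p := \sum_(j < J) (li j).1 *: 'X^((li j).2).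
have iJ (j : 'I_J) : ((li j).2 <= J)%N.
  by apply: leq_trans (liP j).1 _; exact: ltnW.
exists J, p; split.
  apply: leq_trans (size_sum _ _ _) _; apply/bigmax_leqP => j _.
  apply: leq_trans (size_scale_leq _ _) _; rewrite size_polyXn ltnS.
  exact: leq_trans (iJ j) (leq_addr _ _).
apply: (integral_mulI dB (expne _ N dds)).
rewrite mulrCA aE mulr_sumr /p binform_sum mulr_sumr; apply: eq_bigr => j _.
rewrite binformZ binform_Xn; last exact: leq_trans (iJ j) (leq_addr _ _).
by rewrite mulrC (liP j).2 //; ring.
Qed.

End AffineChart.

(** * The points of a curve outside an affine line *)

Section IdealCongruence.
Variables (B : comNzRingType) (P : set B).
Hypothesis PI : is_ideal P.

Lemma ideal0 : P 0. Proof. by case: PI. Qed.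

Lemma idealD a b : P a -> P b -> P (a + b).
Proof. by case: PI => _ h _; exact: h. Qed.

Lemma idealMl c a : P a -> P (c * a).
Proof. by case: PI => _ _; apply. Qed.

Lemma idealMr c a : P a -> P (a * c).
Proof. by rewrite mulrC; exact: idealMl. Qed.

Lemma idealN a : P a -> P (- a).
Proof. by rewrite -mulN1r; exact: idealMl. Qed.

Lemma idealB a b : P a -> P b -> P (a - b).
Proof. by move=> Pa Pb; apply: idealD => //; exact: idealN. Qed.

Lemma ideal_sum I (r : seq I) (Q : pred I) F :
  (forall i, Q i -> P (F i)) -> P (\sum_(i <- r | Q i) F i).
Proof. by move=> h; apply: big_ind => //; [exact: ideal0 | exact: idealD]. Qed.

Lemma ideal_det_congr n (A A' : 'M[B]_n) :
  (forall i j, P (A i j - A' i j)) -> P (\det A - \det A').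
Proof.
move=> AA'; rewrite /determinant -sumrB; apply: ideal_sum => s _.
rewrite -mulrBr; apply: idealMl.
apply: (big_ind2 (fun x y => P (x - y))) => [|x y z t xy zt|i _] //.
  by rewrite subrr; exact: ideal0.
have -> : x * z - y * t = (x - y) * z + y * (z - t) by ring.
by apply: idealD; [exact: idealMr | exact: idealMl].
Qed.

End IdealCongruence.

Lemma prime_idealX (B : comNzRingType) (P : set B) a n :
  is_prime_ideal P -> P (a ^+ n) -> P a.
Proof.
move=> [PI P1 PM]; elim: n => [|n IH]; first by rewrite expr0 => /P1.
by rewrite exprS => /PM[].
Qed.

Lemma predD_le x y m n : (x <= m.+1 -> y <= n.+1 -> (x + y).-1 <= (m + n).+1)%N.
Proof. by lia. Qed.

Section PointsAtInfinity.
Variables (k : closedFieldType) (B : comNzRingType) (iota : {rmorphism k -> B}).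
Variables (G : grading B).
Hypotheses (dB : integral B) (GC : const_part iota G).
Variables (F U : B) (dg : nat).
Hypothesis chart : affine_chart iota G F U dg.

Let U0 : U <> 0. Proof. by case: chart. Qed.

Lemma exp_neq0 (x : B) m : x <> 0 -> x ^+ m <> 0.
Proof. by move=> x0 /integral_exp0 -/(_ dB). Qed.

(** Write t for F / U, and let a and Y restrict to alpha and q in k[t], with
    deg alpha < deg q. Dividing the alpha t ^ i by q shows that a acts on the span
    of the t ^ i for i < deg q as a strictly lower triangular matrix times Y
    plus a matrix times a power of U. Modulo a prime containing U, the
    determinant of the difference is a power of a, and it vanishes. *)
Lemma infinity_lt_deg (P : set B) m a Y N N' (alpha q : {poly k}) :
  is_prime_ideal P -> P U ->
  (size alpha <= (N + m).+1)%N -> U ^+ N * a = binform iota F U (N + m) alpha ->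
  (size q <= (N' + m).+1)%N -> U ^+ N' * Y = binform iota F U (N' + m) q ->
  (0 < m)%N -> (size alpha < size q)%N -> P a.
Proof.
move=> Pp PU sa aE sq YE m0 aq; have PI : is_ideal P by case: Pp.
have q0 : q != 0 by rewrite -size_poly_eq0; case: (size q) aq.
have [s1|s1] := leqP (size q) 1.
  have : alpha = 0.
    by apply/eqP; rewrite -size_poly_leq0 -ltnS; exact: leq_trans aq s1.
  move=> a0; move: aE; rewrite a0 binform0 => /dB[/(exp_neq0 U0)//|->].
  exact: ideal0.
pose n := (size q).-2.
have sqE : size q = n.+2 by rewrite /n; case: (size q) s1 => [|[]].
pose v i := F ^+ i * U ^+ (n - i).
pose Q i := (alpha * 'X^i) %/ q; pose r i := (alpha * 'X^i) %% q.
have sr i : (size (r i) <= n.+1)%N.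
  by rewrite -ltnS -sqE ltn_modp.
have sQ (i : nat) : (size (Q i) <= i)%N.
  rewrite /Q size_divp // sqE leq_subLR; apply: leq_trans (size_polyMleq _ _) _.
  by rewrite size_polyXn addnS /= leq_add2r -ltnS -sqE.
have vE i : (i <= n)%N -> a * v i =
    Y * binform iota F U n (Q i) + U ^+ m * binform iota F U n (r i).
  move=> iN; apply: (integral_mulI dB (exp_neq0 (m := N + N') U0)).
  have sQn : (size (Q i) <= n.+1)%N by apply: leq_trans (sQ i) _; exact: leqW.
  have sX : (size ('X^i : {poly k}) <= n.+1)%N by rewrite size_polyXn.
  have -> : U ^+ (N + N') * (a * v i) =
      U ^+ N' * binform iota F U (N + m + n) (alpha * 'X^i).
    by rewrite binformM // -aE binform_Xn // exprD /v; ring.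
  have -> : U ^+ (N + N') * (Y * binform iota F U n (Q i) + U ^+ m * binform iota F U n (r i)) =
      U ^+ N * binform iota F U (N' + m + n) (q * Q i) +
      U ^+ (N + N' + m) * binform iota F U n (r i).
    by rewrite binformM // -YE !exprD; ring.
  have saX : (size (alpha * 'X^i)%R <= (N + m + n).+1)%N.
    apply: leq_trans (size_polyMleq _ _) _; rewrite size_polyXn; exact: predD_le.
  have sqQ : (size (q * Q i)%R <= (N' + m + n).+1)%N.
    apply: leq_trans (size_polyMleq _ _) _; exact: predD_le.
  rewrite -!binformU //.
  have -> : (N + m + n + N' = N + N' + m + n)%N by lia.
  have -> : (N' + m + n + N = N + N' + m + n)%N by lia.
  have -> : (n + (N + N' + m) = N + N' + m + n)%N by lia.
  rewrite -binformD; congr binform.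
  by rewrite [LHS](divp_eq _ q) mulrC.
pose A : 'M[B]_n.+1 := \matrix_(i, j)
  (a *+ (i == j) - Y * iota (Q i)`_j - U ^+ m * iota (r i)`_j).
pose A' : 'M[B]_n.+1 := \matrix_(i, j) (a *+ (i == j) - Y * iota (Q i)`_j).
pose vv : 'cV[B]_n.+1 := \col_i v i.
have Av : A *m vv = 0.
  apply/colP => i; rewrite !mxE.
  under eq_bigr => j _ do rewrite !mxE !mulrBl.
  rewrite !sumrB (bigD1 i) //= eqxx mulr1n big1 => [|j ji]; last first.
    by rewrite eq_sym (negPf ji) mulr0n mul0r.
  have iN : (i <= n)%N by rewrite -ltnS.
  rewrite addr0 vE //.
  under eq_bigr => j _ do rewrite -mulrA.
  rewrite -mulr_sumr; under [X in _ - _ - X]eq_bigr => j _ do rewrite -mulrA.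
  by rewrite -mulr_sumr addrAC addrK subrr.
have detA : \det A = 0.
  have : \det A *: vv = 0.
    by rewrite -mul_scalar_mx -mul_adj_mx -mulmxA Av mulmx0.
  move=> /colP/(_ ord0); rewrite !mxE /v expr0 mul1r => /dB[//|].
  by move/(exp_neq0 U0).
have detA' : \det A' = a ^+ n.+1.
  rewrite det_trig.
    rewrite -[n.+1 in RHS]card_ord -prodr_const; apply: eq_bigr => i _.
    by rewrite mxE eqxx mulr1n nth_default ?sQ // rmorph0 mulr0 subr0.
  apply/is_trig_mxP => i j ij; rewrite mxE.
  rewrite nth_default ?rmorph0 ?mulr0 ?subr0; last exact: leq_trans (sQ i) (ltnW ij).
  by case: eqP ij => // ->; rewrite ltnn.
apply: (@prime_idealX _ _ _ n.+1 Pp).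
rewrite -detA' -[\det A']opprK -[- \det A']add0r -detA; apply: idealN => //.
apply: ideal_det_congr => // i j; rewrite !mxE.
have -> : a *+ (i == j) - Y * iota (Q i)`_j - U ^+ m * iota (r i)`_j -
  (a *+ (i == j) - Y * iota (Q i)`_j) = U ^+ m * (- iota (r i)`_j) by ring.
by apply: idealMr => //; case: m m0 {aE YE sa sq vE A A' vv Av detA detA'} => // m _; rewrite exprS; exact: idealMr.
Qed.

Definition relevant (P : set B) := exists e y, [/\ (0 < e)%N, G e y & ~ P y].

(** Let a lie in P1 and not in P2, and let Z of the same degree lie in neither. By the previous
    lemma the polynomials of a and Z have equal degrees; with l the ratio of their leading
    coefficients, a - l Z then lies in P1, and so does Z. *)
Lemma infinity_subset (P1 P2 : set B) :
  is_prime_ideal P1 -> homogeneous_ideal G P1 -> relevant P1 -> P1 U ->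
  is_prime_ideal P2 -> relevant P2 -> P2 U -> P1 `<=` P2.
Proof.
move=> P1p P1h [e1 [y1 [e1_gt0 Gy1 Py1]]] P1U P2p [e2 [y2 [e2_gt0 Gy2 Py2]]] P2U.
have [dg0 GF GU _ chartP] := chart.
have [P1I _ P1M] := P1p; have [P2I _ P2M] := P2p.
have [e [Y [e0 GY P1Y P2Y]]] : exists e Y, [/\ (0 < e)%N, G e Y, ~ P1 Y & ~ P2 Y].
  have n1 : ~ P1 (y1 ^+ e2) by move/(prime_idealX P1p).
  have n2 : ~ P2 (y2 ^+ e1) by move/(prime_idealX P2p).
  have G1 : G (e2 * e1)%N (y1 ^+ e2) by exact: gpartX.
  have G2 : G (e2 * e1)%N (y2 ^+ e1) by rewrite mulnC; exact: gpartX.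
  have [h12|] := pselect (P2 (y1 ^+ e2)); last first.
    by exists (e2 * e1)%N, (y1 ^+ e2); rewrite muln_gt0 e2_gt0.
  have [h21|] := pselect (P1 (y2 ^+ e1)); last first.
    by exists (e2 * e1)%N, (y2 ^+ e1); rewrite muln_gt0 e2_gt0.
  exists (e2 * e1)%N, (y1 ^+ e2 + y2 ^+ e1); rewrite muln_gt0 e2_gt0; split=> //.
  - exact: gpartD.
  - by move=> h; apply: n1; have := idealB P1I h h21; rewrite addrK.
  - by move=> h; apply: n2; have := idealB P2I h h12; rewrite addrC addKr.
move=> x P1x; apply: contrapT => P2x.
have [i P2xi] : exists i, ~ P2 (gcomp G i x).
  apply: contrapT => /forallNP h; apply: P2x; rewrite (gcomp_sum G x).
  by apply: ideal_sum => // i _; apply: contrapT; exact: h.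
pose a1 := gcomp G i x * Y; pose D := (i + e)%N; pose m := (e * D)%N.
have D0 : (0 < D)%N by rewrite addn_gt0 e0 orbT.
have Ga1 : G D a1 by apply: gpartM => //; exact: gcompP.
pose a := a1 ^+ (e * dg); pose Z := Y ^+ (D * dg).
have m0 : (0 < m)%N by rewrite muln_gt0 e0.
have Ga : G (m * dg)%N a by rewrite -mulnA [(D * _)%N]mulnC mulnA; exact: gpartX.
have GZ : G (m * dg)%N Z.
  by rewrite /m (mulnC e) -mulnA (mulnC e) mulnA; exact: gpartX.
have P1a : P1 a.
  have ed : (0 < e * dg)%N by rewrite muln_gt0 e0.
  by rewrite /a -(prednK ed) exprS; do 2 apply: idealMr => //; exact: P1h.
have P2a : ~ P2 a by move/(prime_idealX P2p)/P2M => [].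
have P1Z : ~ P1 Z by move/(prime_idealX P1p).
have P2Z : ~ P2 Z by move/(prime_idealX P2p).
have [N [alpha [sa aE]]] := chartP _ _ Ga.
have [N' [q [sq ZE]]] := chartP _ _ GZ.
have [lt|gt|eq] := ltngtP (size alpha) (size q).
- by apply: P2a; exact: (infinity_lt_deg P2p P2U sa aE sq ZE m0 lt).
- by apply: P2Z; exact: (infinity_lt_deg P2p P2U sq ZE sa aE m0 gt).
have q0 : q != 0.
  apply/eqP => q0; apply: P1Z; move: ZE; rewrite q0 binform0 => /dB[].
    by move/(exp_neq0 U0).
  by move=> ->; exact: ideal0.
pose l := lead_coef alpha / lead_coef q.
have l0 : l != 0.
  rewrite mulf_neq0 ?invr_eq0 ?lead_coef_eq0 //.
  by rewrite -size_poly_eq0 eq size_poly_eq0.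
have P1l : P1 (a - iota l * Z).
  have s1 : (size (alpha - l *: q)%R < size q)%N.
    have sE : (size q) = (size q).-1.+1 by rewrite prednK // size_poly_gt0.
    rewrite [X in (_ < X)%N]sE ltnS; apply/leq_sizeP => j; rewrite leq_eqVlt => /predU1P[<-|lt].
      rewrite coefB coefZ /l !lead_coefE eq divfK ?subrr //.
      by rewrite -lead_coefE lead_coef_eq0.
    rewrite coefB coefZ !nth_default ?mulr0 ?subrr //; first by rewrite sE.
    by rewrite eq sE.
  have s2 : (size (alpha - l *: q)%R <= (N + N' + m).+1)%N.
    apply: leq_trans (ltnW s1) (leq_trans sq _); lia.
  have E : U ^+ (N + N') * (a - iota l * Z) = binform iota F U (N + N' + m) (alpha - l *: q).
    rewrite binformD binformN binformZ.
    have -> : (N + N' + m = N + m + N')%N by lia.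
    rewrite (binformU iota F U N' sa) -aE.
    have -> : (N + m + N' = N' + m + N)%N by lia.
    by rewrite (binformU iota F U N sq) -ZE exprD; ring.
  exact: (infinity_lt_deg P1p P1U s2 E sq ZE m0 s1).
have : P1 (iota l * Z).
  by have := idealB P1I P1a P1l; rewrite opprB addrC subrK.
move/P1M => [Pl|//]; case: P1p => _ + _; apply.
by rewrite -(rmorph1 iota) -(divff l0) rmorphM; exact: idealMr.
Qed.

End PointsAtInfinity.

(** * Regular points *)

Section RegularRings.
Variable O : comNzRingType.

Lemma generated_by0 : generated_by 0 [set 0 : O].
Proof.
exists (fun=> 0); apply/predeqP => x; split=> [->|[c ->]].
  by exists (fun=> 0); rewrite big_ord0.
by rewrite big_ord0.
Qed.

Lemma generated_by1 (g : O) : generated_by 1 [set a | exists c, a = c * g].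
Proof.
exists (fun=> g); apply/predeqP => x; split=> [[c ->]|[c ->]].
  by exists (fun=> c); rewrite big_ord1.
by exists (c ord0); rewrite big_ord1.
Qed.

Lemma proper_ideal_nonunit (I : set O) x y : is_ideal I -> ~ I 1 -> x * y = 1 -> ~ I x.
Proof.
move=> II I1 xy Ix; apply: I1; rewrite -xy; exact: (idealMr II). Qed.

Lemma zero_ideal : is_ideal [set 0 : O].
Proof.
split=> [//|a b -> ->|c a ->]; first by rewrite /= addr0.
by rewrite /= mulr0.
Qed.

Lemma field_regular : (forall x : O, x <> 0 -> exists y, x * y = 1) ->
  regular_local_ring O.
Proof.
move=> inv.
have id0 (I : set O) : is_ideal I -> ~ I 1 -> I = [set 0].
  move=> II I1; apply/predeqP => x; split=> [Ix|->]; last exact: ideal0.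
  apply: contrapT => /inv[y xy]; exact: proper_ideal_nonunit II I1 xy Ix.
have n1 : ~ [set (0 : O)] 1 by move=> /= /eqP; rewrite oner_eq0.
split.
  move=> I II; have [I1|/(id0 _ II)->] := pselect (I 1); last first.
    by exists 0%N; exact: generated_by0.
  exists 1%N; have -> : I = [set a | exists c, a = c * 1]; last exact: generated_by1.
  apply/predeqP => x; split=> [_|_]; first by exists x; rewrite mulr1.
  by rewrite -(mulr1 x); exact: idealMl.
exists [set 0]; split.
- split=> // [|J JI _ J1]; first exact: zero_ideal.
  exact: id0.
- by move=> M' [MI M1 _]; exact: id0.
- exists 0%N; split=> //; last exact: generated_by0.
  split.
    exists (fun=> [set 0]); split=> // i _; split=> //; first exact: zero_ideal.
    move=> a b /= ab; have [->|/inv[y ay]] := pselect (a = 0); first by left.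
    by right; rewrite -[b]mul1r -ay mulrAC ab mul0r.
  move=> [P [Pp /(_ 0%N isT)[_]]]; apply.
  have [PI P1 _] := Pp 1%N isT; have [QI Q1 _] := Pp 0%N isT.
  by rewrite (id0 _ PI P1) (id0 _ QI Q1).
Qed.

(** The nonzero ideals are generated by powers of u, and the maximal ideal is the only
    nonzero prime. *)
Lemma dvr_regular (u : O) : (forall y, u * y <> 1) -> (forall n, u ^+ n <> 0) ->
  (forall x, x <> 0 -> exists n v w, v * w = 1 /\ x = v * u ^+ n) ->
  regular_local_ring O.
Proof.
move=> uU u0 dvr; pose M := [set a | exists c, a = c * u].
have MI : is_ideal M.
  split=> [|a b [x ->] [y ->]|c a [x ->]]; first by exists 0; rewrite mul0r.
    by exists (x + y); rewrite mulrDl.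
  by exists (c * x); rewrite mulrA.
have M1 : ~ M 1 by move=> [c /esym]; rewrite mulrC; exact: uU.
have subM (I : set O) : is_ideal I -> ~ I 1 -> I `<=` M.
  move=> II I1 x Ix; have [->|/dvr[n [v [w [vw xE]]]]] := pselect (x = 0).
    exact: ideal0.
  case: n xE => [|n] xE.
    by case: (proper_ideal_nonunit II I1 vw); move: Ix; rewrite xE mulr1.
  by exists (v * u ^+ n); rewrite xE exprSr mulrA.
have powI (I : set O) x : is_ideal I -> I x -> x <> 0 -> exists n, I (u ^+ n).
  move=> II Ix /dvr[n [v [w [vw xE]]]]; exists n.
  by rewrite -[u ^+ n]mul1r -vw (mulrC v) -mulrA -xE; exact: idealMl.
have dom (a b : O) : a * b = 0 -> a = 0 \/ b = 0.
  move=> ab; have [|a0] := pselect (a = 0); [by left | right].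
  apply: contrapT => b0.
  have [n [v [w [vw aE]]]] := dvr _ a0; have [m [v' [w' [vw' bE]]]] := dvr _ b0.
  apply: (u0 (n + m)%N).
  have -> : u ^+ (n + m) = (v * w) * (v' * w') * u ^+ (n + m) by rewrite vw vw' !mul1r.
  have -> : v * w * (v' * w') * u ^+ (n + m) = (w * w') * ((v * u ^+ n) * (v' * u ^+ m)).
    by rewrite exprD; ring.
  by rewrite -aE -bE ab mulr0.
split.
  move=> I II; have [[x [Ix x0]]|h] := pselect (exists x, I x /\ x <> 0); last first.
    exists 0%N; have -> : I = [set 0]; last exact: generated_by0.
    apply/predeqP => x; split=> [Ix|->]; last exact: ideal0.
    by apply: contrapT => x0; apply: h; exists x.
  have exn : exists n, `[< I (u ^+ n) >].
    by have [n In] := powI _ _ II Ix x0; exists n; apply/asboolP.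
  have [n /asboolP In nmin] := ex_minnP exn; exists 1%N.
  have -> : I = [set a | exists c, a = c * u ^+ n]; last exact: generated_by1.
  apply/predeqP => y; split=> [Iy|[c ->]]; last exact: idealMl.
  have [->|/dvr[m [v [w [vw yE]]]]] := pselect (y = 0); first by exists 0; rewrite mul0r.
  have nm : (n <= m)%N.
    apply: nmin; apply/asboolP.
    by rewrite -[u ^+ m]mul1r -vw (mulrC v) -mulrA -yE; exact: idealMl.
  by exists (v * u ^+ (m - n)); rewrite yE -mulrA -exprD subnK.
exists M; split.
- split=> // J JI MJ J1; apply/predeqP => x; split; last exact: MJ.
  exact: subM.
- move=> M' [M'I M'1 max]; apply/esym; apply: max => //; exact: subM.
- exists 1%N; split; last 1 first.
  + move=> e; rewrite ltnS leqn0 => /eqP -> [g ME].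
    have : M u by exists 1; rewrite mul1r.
    by rewrite ME => -[c]; rewrite big_ord0 -[u]expr1; exact: u0.
  + split.
      exists (fun i => if i is 0%N then [set 0] else M); split=> [[|i] _|[|//] _].
      * split=> //; first exact: zero_ideal.
        by move=> /= /eqP; rewrite oner_eq0.
      * split=> // a b Mab; apply: contrapT => /not_orP[Ma Mb].
        have unitM x : ~ M x -> exists y, x * y = 1.
          move=> Mx; have x0 : x <> 0 by move=> x0; apply: Mx; rewrite x0; exact: ideal0.
          have [[|n] [v [w [vw xE]]]] := dvr _ x0; first by exists w; rewrite xE mulr1.
          by case: Mx; exists (v * u ^+ n); rewrite xE exprSr mulrA.
        have [y ay] := unitM _ Ma; apply: Mb.
        by rewrite -[b]mul1r -ay mulrAC; exact: idealMr.
      * split=> [x ->|/(_ u) h]; first exact: ideal0.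
        by apply: (u0 1%N); apply: h; exists 1; rewrite mul1r.
    move=> [P [Pp Pc]].
    have [P1I P11 _] := Pp 1%N isT; have [P2I P21 _] := Pp 2%N isT.
    have [P01 n01] := Pc 0%N isT; have [P12 n12] := Pc 1%N isT.
    have [x [P1x x0]] : exists x, P 1%N x /\ x <> 0.
      apply: contrapT => h; apply: n01 => x P1x.
      have -> : x = 0 by apply: contrapT => x0; apply: h; exists x.
      by apply: ideal0; case: (Pp 0%N isT).
    have [n P1n] := powI _ _ P1I P1x x0.
    have P1u := prime_idealX (Pp 1%N isT) P1n.
    by apply: n12 => y /(subM _ P2I P21)[c ->]; exact: idealMl.
  + exact: generated_by1.
Qed.

End RegularRings.

Section StalkRegular.
Local Open Scope quotient_scope.
Variables (k : closedFieldType) (B : comNzRingType) (iota : {rmorphism k -> B}).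
Variables (G : grading B) (p : Proj G).
Hypotheses (dB : integral B) (GC : const_part iota G).
Let P := proj_ideal p.
Let Pp : is_prime_ideal P := proj_prime p.
Let PI : is_ideal P. Proof. by case: Pp. Qed.

Lemma const_notin c : c != 0 -> ~ P (iota c).
Proof.
move=> c0 Pc; case: Pp => _ + _; apply.
by rewrite -(rmorph1 iota) -(divff c0) rmorphM; exact: idealMr.
Qed.

Lemma stalk_repr (x : stalk p) : exists y, x = \pi_(stalk p) y.
Proof. by exists (repr x); rewrite reprK. Qed.

Lemma stalk_mul_pi (x y : hfrac p) :
  \pi_(stalk p) x * \pi_(stalk p) y = \pi_(stalk p) (hmul x y).
Proof. exact: pi_hmul. Qed.

Lemma stalk_pi_eq (x y : hfrac p) :
  hnum x * hden y = hnum y * hden x -> \pi_(stalk p) x = \pi_(stalk p) y.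
Proof. by move=> xy; apply: stalk_eqP; exact: hequiv1. Qed.

Lemma stalk_pi_inj (x y : hfrac p) :
  \pi_(stalk p) x = \pi_(stalk p) y -> hnum x * hden y = hnum y * hden x.
Proof.
move=> /eqmodP/hequivP[u [[_ Pu] u0]]; apply/eqP; rewrite -subr_eq0; apply/eqP.
by case/dB: u0 => // u0; case: Pu; rewrite u0; exact: ideal0.
Qed.

Lemma stalk_pi1 (x : hfrac p) : hnum x = hden x -> \pi_(stalk p) x = 1.
Proof. by move=> xx; apply: (@stalk_pi_eq x (hone p)); rewrite /= mulr1 mul1r. Qed.

Lemma stalk_pi_eq0 (x : hfrac p) : \pi_(stalk p) x = 0 <-> hnum x = 0.
Proof.
split=> [x0|x0].
  by have := @stalk_pi_inj x (hzero p) x0; rewrite /= mulr1 mul0r.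
by apply: (@stalk_pi_eq x (hzero p)); rewrite /= x0 !mul0r.
Qed.

Variables (F U : B) (dg : nat).
Hypotheses (dg0 : (0 < dg)%N) (GF : G dg F) (GU : G dg U) (PU : ~ P U).
Hypothesis FU : forall c, F <> iota c * U.

(** The function field of the curve is k(F / U). *)
Definition birational_chart := forall m b, G (m * dg)%N b ->
  exists N (w q : {poly k}), [/\ w != 0, (size w <= N.+1)%N,
    (size q <= (N + m).+1)%N &
    binform iota F U N w * b = binform iota F U (N + m) q].

Hypothesis chart : birational_chart.

Let U0 : U <> 0. Proof. by move=> U0; apply: PU; rewrite U0; exact: ideal0. Qed.

Let expU n : ~ P (U ^+ n). Proof. by move/(prime_idealX Pp). Qed.

Lemma binform_notin M (q : {poly k}) : (forall c, ~ P (F - iota c * U)) ->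
  (size q <= M.+1)%N -> q != 0 -> ~ P (binform iota F U M q).
Proof.
move=> nP; elim: M q => [|M IH] q qM q0 Pq.
  have qE := size1_polyC qM; move: Pq; rewrite /binform big_ord1 !expr0 !mulr1.
  by apply: const_notin; rewrite -polyC_eq0 -qE.
have [q1|q1] := boolP (size q == 1%N).
  have qM' : (size q <= M.+1)%N by rewrite (eqP q1).
  move: Pq; rewrite -addn1 binformU // expr1; case: Pp => _ _ /[apply] -[]// .
  exact: IH.
have /closed_rootP[c /factor_theorem[r qE]] := q1.
have r0 : r != 0 by apply: contraNneq q0 => r0; rewrite qE r0 mul0r.
have rM : (size r <= M.+1)%N.
  by move: qM; rewrite qE size_Mmonic ?monicXsubC // size_XsubC addn2 /= ltnS.
move: Pq; rewrite qE -addn1 binformM ?size_XsubC // binform_linear.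
by case: Pp => _ _ /[apply] -[]; [exact: IH | exact: nP].
Qed.

Lemma binform_at_root M (q : {poly k}) c : (size q <= M.+1)%N -> P (F - iota c * U) ->
  ~~ root q c -> ~ P (binform iota F U M q).
Proof.
move=> qM Pc qc Pq.
have [r rE] := binform_horner iota F U c qM.
have : P (iota q.[c] * U ^+ M).
  have -> : iota q.[c] * U ^+ M = binform iota F U M q - (F - iota c * U) * r.
    by rewrite rE addrK.
  by apply: idealB => //; exact: idealMr.
by case: Pp => _ _ /[apply] -[]; [exact: const_notin | exact: expU].
Qed.

Lemma binform_multiplicity M (q : {poly k}) c : (size q <= M.+1)%N -> q != 0 ->
  P (F - iota c * U) ->
  exists i r, [/\ (i <= M)%N, binform iota F U M q = (F - iota c * U) ^+ i * r,
    G ((M - i) * dg)%N r & ~ P r].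
Proof.
move=> qM q0 Pc; have [i [r]] := multiplicity_XsubC q c; rewrite q0 /= => rc qE.
have r0 : r != 0 by apply: contraNneq q0 => r0; rewrite qE r0 mul0r.
have sE : size q = (size r + i)%N.
  rewrite qE size_Mmonic // ?monic_exp ?monicXsubC // size_exp_XsubC.
  by rewrite addnS.
have [iM rM] : (i <= M)%N /\ (size r <= (M - i).+1)%N.
  have : (0 < size r)%N by rewrite size_poly_gt0.
  by move: qM; rewrite sE; split; lia.
exists i, (binform iota F U (M - i) r); split=> //.
- rewrite qE -{1}(subnK iM) binformM // ?size_exp_XsubC // mulrC; congr (_ * _).
  by rewrite -{1}[i]muln1 binformX ?size_XsubC // binform_linear.
- by apply: binform_part => //; move=> e; exact: const_gpart.
- exact: (binform_at_root rM Pc rc).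
Qed.

(** If no F - c U vanishes at p, then no nonzero form in F and U does, and the stalk is a
    field. If F - c U vanishes at p, then (F - c U) / U is a uniformizer: the multiplicity of the
    root c is a valuation. *)
Lemma stalk_regular : regular_local_ring (stalk p).
Proof.
have [[c Pc]|nP] := pselect (exists c, P (F - iota c * U)); last first.
  apply: field_regular => x; have [y ->] := stalk_repr x.
  move=> /(contra_not (stalk_pi_eq0 y).2) y0.
  have [e [Ga Gs]] := hfrac_homog y.
  have Pa : ~ P (hnum y).
    move=> Pa; have Gad : G (e * dg)%N (hnum y ^+ dg) by rewrite mulnC; exact: gpartX.
    have [N [w [q [w0 wN qN wE]]]] := chart Gad.
    have nP' c : ~ P (F - iota c * U) by move=> Pc; apply: nP; exists c.
    have q0 : q != 0.
      apply/eqP => q0; move: wE; rewrite q0 binform0 => /dB[|/integral_exp0 -/(_ dB)//].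
      by move/(binform_eq0 dB U0 FU wN)/eqP; rewrite (negPf w0).
    apply: (binform_notin nP' qN q0); rewrite -wE; apply: idealMl => //.
    by rewrite -(prednK dg0) exprS; exact: idealMr.
  have h : exists d, G d (hden y) /\ G d (hnum y) by exists e.
  exists (\pi_(stalk p) (HFrac h Pa)); rewrite stalk_mul_pi.
  by apply: stalk_pi1; rewrite /= mulrC.
pose F' := F - iota c * U.
have GF' : G dg F'.
  apply: gpartB => //; rewrite -[dg]add0n; apply: gpartM => //; exact: const_gpart.
have F'0 : F' <> 0 by move/eqP; rewrite subr_eq0 => /eqP; exact: FU.
have PF' : P F' by [].
have valuation m b : b <> 0 -> G (m * dg)%N b -> exists l W r eW er,
    [/\ G eW W /\ G er r, (er + l * dg = eW + m * dg)%N, ~ P W, ~ P r &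
        W * b = F' ^+ l * r].
  move=> b0 Gb; have [N [w [q [w0 wN qN wE]]]] := chart Gb.
  have q0 : q != 0.
    apply/eqP => q0; move: wE; rewrite q0 binform0 => /dB[|//].
    by move/(binform_eq0 dB U0 FU wN)/eqP; rewrite (negPf w0).
  have [i [W [iN WE GW PW]]] := binform_multiplicity wN w0 Pc.
  have [j [r [jN rE Gr Pr]]] := binform_multiplicity qN q0 Pc.
  move: wE; rewrite WE rE -/F' => wE.
  have ij : (i <= j)%N.
    rewrite leqNgt; apply/negP => ji; apply: Pr.
    have -> : r = F' ^+ (i - j) * W * b.
      apply: (integral_mulI dB (a := F' ^+ j)); first by move/integral_exp0 => /(_ dB).
      by rewrite -wE !mulrA -exprD subnKC // ltnW.
    rewrite -(subnSK ji) exprS -!mulrA; exact: idealMr.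
  exists (j - i)%N, W, r, ((N - i) * dg)%N, ((N + m - j) * dg)%N; split=> //.
    by rewrite -!mulnDl; congr (_ * _)%N; lia.
  apply: (integral_mulI dB (a := F' ^+ i)); first by move/integral_exp0 => /(_ dB).
  by rewrite !mulrA wE -exprD subnKC.
have hFU n : exists d, G d (F' ^+ n) /\ G d (U ^+ n).
  by exists (n * dg)%N; split; exact: gpartX.
pose pw n := HFrac (hFU n) (@expU n).
have pwE n : \pi_(stalk p) (pw 1%N) ^+ n = \pi_(stalk p) (pw n).
  elim: n => [|n IH]; first by rewrite expr0; apply/esym/stalk_pi1; rewrite /= !expr0.
  by rewrite exprS IH stalk_mul_pi; apply: stalk_pi_eq; rewrite /= !expr1 !exprS; ring.
apply: (dvr_regular (u := \pi_(stalk p) (pw 1%N))).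
- move=> x; have [y ->] := stalk_repr x; rewrite stalk_mul_pi.
  rewrite -(@stalk_pi1 (hone p)) // => /stalk_pi_inj /=.
  rewrite mulr1 mul1r !expr1 => FE.
  have : P (U * hden y) by rewrite -FE; exact: idealMr.
  by case: Pp => _ _ /[apply] -[//|]; exact: hfrac_den.
- by move=> n; rewrite pwE => /stalk_pi_eq0 /integral_exp0 -/(_ dB).
move=> x; have [y ->] := stalk_repr x.
move=> /(contra_not (stalk_pi_eq0 y).2) y0.
have [e [Ga Gs]] := hfrac_homog y; set a := hnum y in y0 Ga; set s := hden y in Gs.
have Ps : ~ P s by exact: hfrac_den.
have s0 : s <> 0 by move=> s0; apply: Ps; rewrite s0; exact: ideal0.
have Gb : G (e * dg)%N (a * s ^+ dg.-1).
  apply: (gpartM_eq Ga (gpartX dg.-1 Gs)).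
  by rewrite -mulSn prednK // mulnC.
have b0 : a * s ^+ dg.-1 <> 0.
  by apply: (integral_mulf dB y0); move/integral_exp0 => /(_ dB).
have [l [W [r [eW [er [[GW Gr] deg PW Pr WE]]]]]] := valuation _ _ b0 Gb.
have GWs : G (eW + e * dg)%N (W * s ^+ dg).
  by apply: gpartM => //; rewrite mulnC; exact: gpartX.
have GrU : G (eW + e * dg)%N (r * U ^+ l).
  by rewrite -deg; apply: gpartM => //; exact: gpartX.
have PWs : ~ P (W * s ^+ dg).
  by case: Pp => _ _ /[apply] -[//|/(prime_idealX Pp)].
have PrU : ~ P (r * U ^+ l) by case: Pp => _ _ /[apply] -[//|/expU].
have h1 : exists d, G d (r * U ^+ l) /\ G d (W * s ^+ dg) by exists (eW + e * dg)%N.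
have h2 : exists d, G d (W * s ^+ dg) /\ G d (r * U ^+ l) by exists (eW + e * dg)%N.
exists l, (\pi_(stalk p) (HFrac h1 PWs)), (\pi_(stalk p) (HFrac h2 PrU)); split.
  by rewrite stalk_mul_pi; apply: stalk_pi1; rewrite /= mulrC.
rewrite pwE stalk_mul_pi; apply: stalk_pi_eq; rewrite /= -/a -/s.
have -> : a * (W * s ^+ dg * U ^+ l) = W * (a * s ^+ dg.-1) * s * U ^+ l.
  by rewrite -{1}(prednK dg0) exprS; ring.
by rewrite WE; ring.
Qed.

End StalkRegular.

(** * Quotients by a homogeneous irreducible polynomial *)

Lemma quotient_derivation (A B : comNzRingType) (pi : {rmorphism A -> B}) (h : A)
    (d : A -> A) :
  (forall b, exists a, pi a = b) -> (forall a, pi a = 0 <-> exists q, a = h * q) ->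
  derivation d -> divides h (d h) ->
  exists d' : B -> B, derivation d' /\ forall a, d' (pi a) = pi (d a).
Proof.
move=> pis pik dd [x dhE].
have well a a' : pi a = pi a' -> pi (d a) = pi (d a').
  move=> aa; have /pik[q qE] : pi (a - a') = 0 by rewrite rmorphB aa subrr.
  apply/eqP; rewrite -subr_eq0 -rmorphB -derB // qE; apply/eqP/pik.
  by exists (x * q + d q); rewrite derM // dhE; ring.
have [g gE] := choice pis.
have dE a : pi (d (g (pi a))) = pi (d a) by apply: well; rewrite gE.
exists (fun b => pi (d (g b))); split=> //; split=> a b.
  rewrite -{1}(gE a) -{1}(gE b) -rmorphD dE derD // rmorphD.
  by rewrite -(dE (g a)) -(dE (g b)) !gE.
rewrite -{1}(gE a) -{1}(gE b) -rmorphM dE derM // rmorphD !rmorphM.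
by rewrite -(dE (g a)) -(dE (g b)) !gE.
Qed.

Lemma quotient_iter (A B : comNzRingType) (pi : {rmorphism A -> B})
    (d : A -> A) (d' : B -> B) : (forall a, d' (pi a) = pi (d a)) ->
  forall n a, iter n d' (pi a) = pi (iter n d a).
Proof. by move=> dE; elim=> // n IH a; rewrite !iterSr dE IH. Qed.

Section WeightedRing.
Variable k : closedFieldType.
Local Notation R := {mpoly k[3]}.
Local Notation G := (gradR k).

Lemma R_integral : integral R.
Proof. by move=> a b /eqP; rewrite mulf_eq0 => /orP[]/eqP; [left|right]. Qed.

Lemma R_const c : G 0%N c%:MP.
Proof.
apply/dhomogP => m; rewrite msuppC; case: eqP => //= _; rewrite inE => /eqP ->.
exact: wdeg0.
Qed.

Lemma wdeg_eq0 m : wdeg wt m = 0%N -> m = 0%MM.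
Proof.
move/eqP; rewrite /wdeg sum_nat_eq0 => /forallP h; apply/mnmP => i; rewrite mnm0E.
have := h i; rewrite /= muln_eq0 => /orP[|/eqP//].
by case: i {h} => [[|[|[|]]]].
Qed.

Lemma R_const_part : const_part (@mpolyC 3 k) G.
Proof.
move=> b; split=> [Gb|[c ->]]; last exact: R_const.
exists b@_0; apply/mpolyP => m; rewrite mcoeffC.
have [->|m0] := eqVneq 0%MM m; first by rewrite mulr1.
rewrite mulr0; apply: (dhomog_nemf_coeff Gb).
by apply: contra m0 => /eqP /wdeg_eq0 ->.
Qed.

Section Quotient.
Variables (h : R) (hi : irreducible_elt h) (e : nat) (Gh : G e h).

Definition hquot : comNzRingType := pquot (irreducible_nonunit hi).
Definition hpi : {rmorphism R -> hquot} := pquot_pi (irreducible_nonunit hi).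
Definition hiota : {rmorphism k -> hquot} := hpi \o @mpolyC 3 k.
Definition hgrad : grading hquot := pquot_grading (irreducible_nonunit hi) Gh.

Lemma hpi_surj b : exists a, hpi a = b.
Proof. exact: pquot_surj. Qed.

Lemma hpi_ker a : hpi a = 0 <-> divides h a.
Proof. exact: pquot_ker. Qed.

Lemma hpi_part i a : G i a -> hgrad i (hpi a).
Proof. by move=> Ga; exists a. Qed.

Lemma irreducible_prime : prime_elt h.
Proof. exact: mpoly_euclid hi. Qed.

Lemma hquot_integral : integral hquot.
Proof.
move=> a b; have [x <-] := hpi_surj a; have [y <-] := hpi_surj b.
by rewrite -rmorphM => /hpi_ker/irreducible_prime[] /hpi_ker; [left|right].
Qed.

Lemma hquot_const_part : const_part hiota hgrad.
Proof.
move=> b; split=> [[a Ga <-]|[c ->]].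
  by have /R_const_part[c ->] := Ga; exists c.
by apply: hpi_part; exact: R_const.
Qed.

Lemma hquot_trdeg : trdeg_le2 hiota.
Proof.
move=> a b s; have [x <-] := hpi_surj a; have [y <-] := hpi_surj b.
have [z <-] := hpi_surj s; have h0 : h != 0 by case: hi.
have [N [c [cn /hpi_ker rel]]] := mpoly_alg_dep3_mod x y z h0.
exists N, c; split=> //; rewrite -[RHS]rel rmorph_sum; apply: eq_bigr => l _.
rewrite rmorph_sum; apply: eq_bigr => j _; rewrite rmorph_sum.
apply: eq_bigr => i _; rewrite -mul_mpolyC !rmorphM !rmorphXn //.
Qed.

Lemma hquot_lnd d b c : derivation d -> loc_nilpotent d -> shift G b c d ->
  d h = 0 -> exists d', [/\ derivation d', loc_nilpotent d', shift hgrad b c d'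
    & forall a, d' (hpi a) = hpi (d a)].
Proof.
move=> dd dn ds dh.
have dhh : divides h (d h) by rewrite dh; exact: dvd0.
have [d' [dd' dE]] := quotient_derivation hpi_surj hpi_ker dd dhh.
exists d'; split=> //.
- move=> x; have [a <-] := hpi_surj x; have [n an] := dn a.
  by exists n; rewrite (quotient_iter dE) an rmorph0.
- move=> i x [a Ga <-]; rewrite dE; have [->|[j [jE Gj]]] := ds _ _ Ga.
    by left; rewrite rmorph0.
  by right; exists j; split=> //; exact: hpi_part.
Qed.

End Quotient.

End WeightedRing.

(** * The kernel of a homogeneous locally nilpotent derivation of k[x, y, z] *)

Lemma wdeg3 (m : 'X_{1..3}) : wdeg wt m = (3 * m ix + 2 * m iy + m iz)%N.
Proof.
rewrite /wdeg !big_ord_recl big_ord0 addn0 addnA /wt /= mul1n.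
by congr (3 * m _ + 2 * m _ + m _)%N; apply: val_inj.
Qed.

Section KernelPencil.
Variable k : closedFieldType.
Local Notation R := {mpoly k[3]}.
Local Notation G := (gradR k).
Hypothesis k0 : char0 k.
Variable d : R -> R.
Hypotheses (dd : derivation d) (dn : loc_nilpotent d).
Variables (b0 c0 : nat).
Hypothesis ds : shift G b0 c0 d.

Let dR := @R_integral k.
Let R0 : char0 R := char0_alg (@mpolyC 3 k) k0.

Lemma lnd_scale c a : d (c *: a) = c *: d a.
Proof.
rewrite -!mul_mpolyC derMl //.
exact: (@lnd_const _ _ (@mpolyC 3 k) dR k0 _ dd dn).
Qed.

Lemma gpartZ e c a : G e a -> G e (c *: a).
Proof.
by move=> Ga; rewrite -mul_mpolyC -[e]add0n; apply: gpartM => //; exact: R_const.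
Qed.

Lemma sum_unlift n (V : lmodType k) (h : 'I_n.+1) (c : 'I_n -> k) (v : 'I_n.+1 -> V) :
  \sum_i (if unlift h i is Some j then c j else 0) *: v i =
  \sum_j c j *: v (lift h j).
Proof.
rewrite (bigD1_ord h) //= unlift_none scale0r add0r.
by apply: eq_bigr => j _; rewrite liftK.
Qed.

(** By induction: d maps the kernel of d ^ (N + 1) to that of d ^ N, and the kernel of this map is
    at most a line in each degree. *)
Lemma iter_ker_dim N e (v : 'I_N.+1 -> R) :
  (forall e a b, G e a -> G e b -> d a = 0 -> d b = 0 ->
    exists x y : k, (x != 0) || (y != 0) /\ x *: a + y *: b = 0) ->
  (forall i, v i = 0 \/ G e (v i)) -> (forall i, iter N d (v i) = 0) ->
  exists c : 'I_N.+1 -> k, (exists i, c i != 0) /\ \sum_i c i *: v i = 0.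
Proof.
move=> line; elim: N e v => [|N IH] e v Gv vN.
  exists (fun=> 1); split; first by exists ord0; exact: oner_neq0.
  by rewrite big_ord1 (vN ord0 : v ord0 = 0) scaler0.
have Gv' i : G e (v i) by case: (Gv i) => // ->; exact: gpart0.
have step (h : 'I_N.+2) : exists c : 'I_N.+1 -> k, (exists i, c i != 0) /\
    d (\sum_j c j *: v (lift h j)) = 0.
  have Gd j : d (v (lift h j)) = 0 \/ G (e + b0 - c0)%N (d (v (lift h j))).
    by case: (ds (Gv' (lift h j))) => [|[e' [<-]]]; [left | rewrite addnK; right].
  have dN j : iter N d (d (v (lift h j))) = 0 by rewrite -iterSr.
  have [c [ci cs]] := IH _ (fun j => d (v (lift h j))) Gd dN.
  exists c; split=> //; rewrite (der_sum dd) -[RHS]cs.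
  by apply: eq_bigr => j _; rewrite lnd_scale.
have [c [[j cj] dc]] := step ord_max; pose i0 := lift ord_max j.
have [c' [[j' cj'] dc']] := step i0.
have GS (h : 'I_N.+2) (u : 'I_N.+1 -> k) : G e (\sum_j u j *: v (lift h j)).
  by apply: gpart_sum => i _; exact: gpartZ.
have [x [y [xy0 rel]]] := line _ _ _ (GS ord_max c) (GS i0 c') dc dc'.
pose C i := x * (if unlift ord_max i is Some j then c j else 0) +
            y * (if unlift i0 i is Some j then c' j else 0).
exists C; split; last first.
  rewrite -[RHS]rel -(sum_unlift ord_max c v) -(sum_unlift i0 c' v) !scaler_sumr -big_split.
  by apply: eq_bigr => i _; rewrite /C scalerDl !scalerA.
have [x0|x0] := eqVneq x 0; last first.
  by exists i0; rewrite /C unlift_none {1}/i0 liftK mulr0 addr0; exact: mulf_neq0.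
exists (lift i0 j'); rewrite /C x0 mul0r add0r liftK.
by move: xy0; rewrite x0 eqxx /= => y0; exact: mulf_neq0.
Qed.

(** Otherwise every graded piece of the kernel is at most a line. The degrees along d of the
    monomials of degree e are at most linear in e, while their number is quadratic in e,
    which contradicts the previous lemma. *)
Lemma ker_pencil_ex : exists e F U,
  [/\ G e F, G e U, d F = 0 & d U = 0] /\ U <> 0 /\ forall c, F <> c *: U.
Proof.
apply: contrapT => no.
have line e a b : G e a -> G e b -> d a = 0 -> d b = 0 ->
    exists x y : k, (x != 0) || (y != 0) /\ x *: a + y *: b = 0.
  move=> Ga Gb da db; have [->|b1] := pselect (b = 0).
    by exists 0, 1; rewrite oner_neq0 orbT scale0r scaler0 addr0.
  have [[c ->]|h] := pselect (exists c, a = c *: b).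
    by exists 1, (- c); rewrite oner_neq0 scale1r scaleNr subrr.
  case: no; exists e, a, b; split=> //; split=> // c ac; by case: h; exists c.
have [n nP] := choice (fun i : 'I_3 => dn 'X_i).
pose c := (\max_i n i).+1.
have cX i : iter c.+1 d 'X_i = 0.
  by apply: (iter_der_ge0 dd (nP i)); do 2 apply: leqW; exact: leq_bigmax.
(* The monomials below have degree 12 * M, and degree along d at most c * (12 * M) = M ^ 2. *)
pose M := (12 * c)%N; pose N := (M * M).+1.
pose mono t := (U_(ix) *+ (2 * (t %/ M.+1)) + U_(iy) *+ (3 * (t %% M.+1)) +
  U_(iz) *+ (6 * (2 * M - t %/ M.+1 - t %% M.+1)))%MM : 'X_{1..3}.
pose v (t : 'I_N.+1) : R := 'X_[mono t].
have small (t : 'I_N.+1) : (t %/ M.+1 <= M)%N /\ (t %% M.+1 <= M)%N.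
  split; last by rewrite -ltnS ltn_pmod.
  rewrite -ltnS ltn_divLR //; apply: leq_trans (ltn_ord t) _.
  by rewrite /N; lia.
have Gv t : v t = 0 \/ G (12 * M)%N (v t).
  right; rewrite /= /wpart /= dhomogX; apply/eqP.
  have [iM jM] := small t; rewrite -[LHS]/(wdeg wt (mono t)) wdeg3.
  by rewrite !mnmDE !mulmnE !mnm1E /=; lia.
have vN t : iter N d (v t) = 0.
  have [iM jM] := small t; rewrite /v /mono !mpolyXD -!mpolyXn.
  set i := (t %/ _)%N; set j := (t %% _)%N.
  have e1 := iter_derX_eq0 dd (2 * i) (cX ix).
  have e2 := iter_derX_eq0 dd (3 * j) (cX iy).
  have e3 := iter_derX_eq0 dd (6 * (2 * M - i - j)) (cX iz).
  apply: (iter_der_ge0 dd (iter_derM_eq0 dd (iter_derM_eq0 dd e1 e2) e3)).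
  have h : (2 * i + 3 * j + 6 * (2 * M - i - j) <= 12 * M)%N by lia.
  rewrite /N ltnS -!mulnDr; apply: leq_trans (leq_mul (leqnn c) h) _.
  by rewrite mulnA (mulnC c) leqnn.
have [C [[t Ct] rel]] := iter_ker_dim line Gv vN.
have := congr1 (mcoeff (mono t)) rel.
rewrite raddf_sum /= mcoeff0 (bigD1 t) //= big1 ?addr0 => [|t' tt'].
  by rewrite mcoeffZ mcoeffX eqxx mulr1 => /eqP; rewrite (negPf Ct).
rewrite mcoeffZ mcoeffX; case: eqP => [e|_]; last by rewrite mulr0.
case/eqP: tt'; apply: val_inj => /=.
have e1 := congr1 (fun m : 'X_{1..3} => m ix) e.
have e2 := congr1 (fun m : 'X_{1..3} => m iy) e.
move: e1 e2; rewrite /= !mnmDE !mulmnE !mnm1E /=.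
move=> e1 e2.
rewrite (divn_eq t' M.+1) (divn_eq t M.+1).
by congr (_ * _ + _)%N; lia.
Qed.

End KernelPencil.

Lemma interpolation (F : fieldType) (s : seq F) (mu : F -> F) : uniq s ->
  exists q : {poly F}, (size q <= size s)%N /\ forall x, x \in s -> q.[x] = mu x.
Proof.
elim: s => [_|x s IH /= /andP[xs /IH[q [sq qE]]]].
  by exists 0; rewrite size_poly0.
pose w := \prod_(y <- s) ('X - y%:P).
have wx : w.[x] != 0.
  by rewrite -rootE root_prod_XsubC.
pose c := (mu x - q.[x]) / w.[x]; exists (q + c *: w); split.
  apply: leq_trans (size_polyD _ _) _; rewrite geq_max (leq_trans sq) //=.
  by apply: leq_trans (size_scale_leq _ _) _; rewrite size_prod_XsubC.
move=> y; rewrite inE hornerD hornerZ => /predU1P[->|ys].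
  by rewrite divfK // addrC subrK.
have -> : w.[y] = 0.
  by apply/eqP; rewrite -rootE root_prod_XsubC.
by rewrite mulr0 addr0 qE.
Qed.

Section Pencil.
Variable k : closedFieldType.
Local Notation R := {mpoly k[3]}.
Local Notation G := (gradR k).
Hypothesis k0 : char0 k.
Variable d : R -> R.
Hypotheses (dd : derivation d) (dn : loc_nilpotent d).
Variables (b0 c0 : nat).
Hypothesis ds : shift G b0 c0 d.

Let dR := @R_integral k.
Let R0 : char0 R := char0_alg (@mpolyC 3 k) k0.
Let dZ := lnd_scale k0 dd dn.

Lemma R_unit_deg0 u : G 0%N u -> u <> 0 -> u \is a GRing.unit.
Proof.
move=> /R_const_part[c ->] cu; apply: rmorph_unit; rewrite unitfE.
by apply/eqP => c1; apply: cu; rewrite c1 rmorph0.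
Qed.

Variables (dg : nat) (F U : R).
Hypotheses (GF : G dg F) (GU : G dg U) (dF : d F = 0) (dU : d U = 0).
Hypotheses (U0 : U <> 0) (FU : forall c, F <> c *: U).
Hypothesis dg_min : forall e a b, (e < dg)%N -> G e a -> G e b -> d a = 0 ->
  d b = 0 -> b <> 0 -> exists c, a = c *: b.

Definition member (l : k) := F - l *: U.

Lemma member_neq0 l : member l <> 0.
Proof. by move/eqP; rewrite subr_eq0 => /eqP/FU. Qed.

Lemma member_part l : G dg (member l).
Proof. by apply: gpartB => //; exact: gpartZ. Qed.

Lemma member_ker l : d (member l) = 0.
Proof. by rewrite derB // dZ dF dU scaler0 subrr. Qed.

Lemma dg_gt0 : (0 < dg)%N.
Proof.
rewrite lt0n; apply/eqP => dg0.
have [x FE] : exists x, F = x%:MP by apply/R_const_part; move: GF; rewrite dg0.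
have [y UE] : exists y, U = y%:MP by apply/R_const_part; move: GU; rewrite dg0.
have y0 : y != 0 by apply/eqP => y0; apply: U0; rewrite UE y0 rmorph0.
by apply: (@FU (x / y)); rewrite FE UE -mul_mpolyC -mpolyCM divfK.
Qed.

Lemma member_dvd_diff l m h : l != m -> divides h (member l) ->
  divides h (member m) -> divides h F /\ divides h U.
Proof.
move=> lm hl hm.
have hU : divides h U.
  have -> : U = (m - l)^-1%:MP * (member l - member m).
    rewrite /member mul_mpolyC opprB (addrC (F - _)) addrA subrK -scalerBl scalerA.
    by rewrite mulVf ?scale1r // subr_eq0 eq_sym.
  by apply: dvdMl; exact: dvdB.
split=> //; rewrite (_ : F = member l + l%:MP * U).
  by apply: dvdD => //; exact: dvdMl.
by rewrite mul_mpolyC /member subrK.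
Qed.

(** A reducible member of the pencil has a factor in the kernel of lower degree,
    which the minimality of dg determines up to a constant; two members cannot
    share it, as it could be cancelled from F and U. *)
Definition low_factor l e :=
  exists u, [/\ (e < dg)%N, G e u, d u = 0, u <> 0 & (0 < e)%N /\ divides u (member l)].

Lemma member_reducible l : ~ irreducible_elt (member l) -> exists e, low_factor l e.
Proof.
move=> nirr; apply: contrapT => nlow; apply: nirr; split.
- by apply/eqP; exact: member_neq0.
- apply/negP => /unitrPr[v uv].
  have uv0 : member l * v <> 0 by rewrite uv; apply/eqP; exact: oner_neq0.
  have uvG : G 0%N (member l * v) by rewrite uv; exact: gpart1.
  have [j [/eqP + _]] := homogeneous_factor_deg dR (@member_neq0 l) (member_part l) uvG uv0.
  by rewrite addn_eq0 => /andP[/eqP dg0 _]; have := dg_gt0; rewrite dg0.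
move=> b c bc; have bc0 : b * c <> 0 by rewrite -bc; exact: member_neq0.
have bcG : G dg (b * c) by rewrite -bc; exact: member_part.
have b1 : b <> 0 by move=> b1; apply: bc0; rewrite b1 mul0r.
have c1 : c <> 0 by move=> c1; apply: bc0; rewrite c1 mulr0.
have [i Gb] := homogeneous_factor dR bc0 bcG.
have [j [ij Gc]] := homogeneous_factor_deg dR b1 Gb bcG bc0.
have [i0|i0] := posnP i; first by left; apply: R_unit_deg0 b1; move: Gb; rewrite i0.
have [j0|j0] := posnP j; first by right; apply: R_unit_deg0 c1; move: Gc; rewrite j0.
case: nlow; exists i, b; split=> //.
- by rewrite -ij -addn1 leq_add2l.
- by apply: (lnd_ker_factor dR R0 dd dn bc0); rewrite -bc; exact: member_ker.
- by split=> //; rewrite bc; exact: dvdMr (dvd_refl b).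
Qed.

Lemma low_factor_inj l m e : low_factor l e -> low_factor m e -> l = m.
Proof.
move=> [u [ed Gu du u0 [e0 ul]]] [v [_ Gv dv v0 [_ vm]]].
apply: contrapT => /eqP lm.
have [c vE] := dg_min ed Gv Gu dv du u0.
have um : divides u (member m) by apply: dvd_trans vm; rewrite vE -mul_mpolyC; exact: dvdMl (dvd_refl u).
have [[f FE] [g UE]] := member_dvd_diff lm ul um.
have F0 : F <> 0 by move=> F0; apply: (@FU 0); rewrite scale0r.
have [i [iE Gf]] : exists i, (e + i = dg)%N /\ G i f.
  by apply: (homogeneous_factor_deg dR u0 Gu); rewrite -FE.
have [j [jE Gg]] : exists j, (e + j = dg)%N /\ G j g.
  by apply: (homogeneous_factor_deg dR u0 Gu); rewrite -UE.
have ij : j = i by lia.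
have df : d f = 0 by apply: (lnd_ker_factor dR R0 dd dn (b := u)); rewrite mulrC -FE.
have dg0 : d g = 0 by apply: (lnd_ker_factor dR R0 dd dn (b := u)); rewrite mulrC -UE.
have g0 : g <> 0 by move=> g0; apply: U0; rewrite UE g0 mulr0.
have id : (i < dg)%N by lia.
rewrite ij in Gg; have [x fE] := dg_min id Gf Gg df dg0 g0.
by apply: (@FU x); rewrite FE UE fE scalerAr.
Qed.

Lemma member_ndvdU l : ~ divides (member l) U.
Proof.
move=> [x UE]; have U0' : member l * x <> 0 by rewrite -UE.
have GU' : G dg (member l * x) by rewrite -UE.
have [j [jE Gx]] := homogeneous_factor_deg dR (@member_neq0 l) (member_part l) GU' U0'.
have j0 : j = 0%N by lia.
move: Gx; rewrite j0 => /R_const_part[c xE].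
have c'0 : c != 0 by apply/eqP => c'0; apply: U0; rewrite UE xE c'0 rmorph0 mulr0.
apply: (@FU (l + c^-1)); rewrite scalerDl {2}UE xE mulrC mul_mpolyC scalerA mulVf //.
by rewrite scale1r /member addrC subrK.
Qed.

Lemma member_dvd_binform m (q : {poly k}) l : (size q <= m.+1)%N ->
  divides (member l) (binform (@mpolyC 3 k) F U m q - q.[l]%:MP * U ^+ m).
Proof.
move=> /(binform_horner (@mpolyC 3 k) F U l)[r ->].
by exists r; rewrite addrC addKr mul_mpolyC.
Qed.

(** Distinct irreducible members are coprime. *)
Lemma member_prod_dvd (s : seq k) e v : uniq s ->
  (forall l, l \in s -> irreducible_elt (member l) /\ divides (member l) v) ->
  G e v -> (e < size s * dg)%N -> v = 0.
Proof.
elim: s e v => [|l s IH] e v /=; first by rewrite mul0n.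
move=> /andP[ls us] h Gv es; have [hl [w vE]] := h l (mem_head _ _).
apply: contrapT => v0.
have Gv' : G e (member l * w) by rewrite -vE.
have v0' : member l * w <> 0 by rewrite -vE.
have [i [iE Gw]] := homogeneous_factor_deg dR (@member_neq0 l) (member_part l) Gv' v0'.
have w0 : w = 0; last by apply: v0; rewrite vE w0 mulr0.
have hw m : m \in s -> irreducible_elt (member m) /\ divides (member m) w.
  move=> ms; have lm : l != m by apply: contraNneq ls => ->.
  have [hm] := h m (mem_behead (s := l :: s) ms); rewrite vE => /(irreducible_prime hm)[ml|]; last by split.
  by have [_ /member_ndvdU] := member_dvd_diff lm ml (dvd_refl _).
by apply: (IH i w us hw Gw); rewrite mulSn in es; lia.
Qed.

(** Distinct reducible members have low factors of distinct degrees less than dg, and a nonzero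
    element is divisible by finitely many irreducible members only. *)
Lemma good_members n : (exists a, d a <> 0) -> exists s : seq k,
  [/\ uniq s, size s = n & forall l, l \in s ->
     irreducible_elt (member l) /\ exists a, ~ divides (member l) (d a)].
Proof.
move=> [a da].
have [a' [ea [Ga' da']]] : exists a' ea, G ea a' /\ d a' <> 0.
  apply: contrapT => h; apply: da; rewrite (gcomp_sum G a) (der_sum dd) big1 // => i _.
  by apply: contrapT => di; apply: h; exists (gcomp G i a), i; split=> //; exact: gcompP.
have [//|[ev [_ Gv]]] := ds Ga'; set v := d a' in da' Gv.
pose irr l := `[< irreducible_elt (member l) >].
pose dv l := `[< divides (member l) v >].
pose L := [seq (i%:R : k) | i <- iota 0 (n + dg + ev.+1)].
have nat_inj := char0_natr_inj k0.
have Lu : uniq L by rewrite map_inj_uniq // iota_uniq.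
have sL : size L = (n + dg + ev.+1)%N by rewrite size_map size_iota.
have c1 : (count (predC irr) L <= dg)%N.
  rewrite -size_filter; set L1 := filter _ L.
  have low l : exists e, l \in L1 -> low_factor l e.
    have [lL|lL] := boolP (l \in L1); last by exists 0%N.
    move: lL; rewrite mem_filter => /andP[/= /asboolPn /member_reducible[e le] _].
    by exists e.
  have [e eP] := choice low.
  rewrite -(size_map e) -[dg](size_iota 0); apply: uniq_leq_size.
    rewrite map_inj_in_uniq ?filter_uniq // => l m lL mL elm.
    by apply: (low_factor_inj (eP l lL)); rewrite elm; exact: eP.
  by move=> _ /mapP[l /eP[u [ed _ _ _ _]] ->]; rewrite mem_iota.
have c2 : (count (predI irr dv) L <= ev)%N.
  rewrite -size_filter leqNgt; apply/negP => big; apply: da'.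
  apply: (member_prod_dvd (filter_uniq (predI irr dv) Lu) _ Gv).
    by move=> l; rewrite mem_filter => /andP[/andP[/asboolP ? /asboolP ?] _].
  by apply: leq_trans big (leq_pmulr _ dg_gt0).
have c3 : (n <= size (filter (predI irr (predC dv)) L))%N.
  rewrite size_filter; have := count_predC irr L; rewrite sL.
  have : count irr L = (count (predI irr dv) L + count (predI irr (predC dv)) L)%N.
    by elim: (L) => //= x s ->; case: (irr x); case: (dv x) => /=; lia.
  by move: c1 c2; lia.
exists (take n (filter (predI irr (predC dv)) L)); split.
- exact: take_uniq (filter_uniq _ Lu).
- by rewrite size_takel.
- move=> l /mem_take; rewrite mem_filter => /andP[/andP[/asboolP ? /asboolPn ?] _].
  by split=> //; exists a'.
Qed.

(** On an irreducible member every kernel element of degree m * dg is a multiple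
    of U ^ m. Interpolating at m + 1 members gives a binary form in F and U whose
    difference with the element is divisible by all of them, hence zero. *)
Lemma ker_binary_form m a : (exists a, d a <> 0) -> G (m * dg)%N a -> d a = 0 ->
  exists q : {poly k}, (size q <= m.+1)%N /\ a = binform (@mpolyC 3 k) F U m q.
Proof.
move=> dne Ga da; have [s [us ss sP]] := good_members m.+1 dne.
have mult l : exists mu, l \in s -> divides (member l) (a - mu%:MP * U ^+ m).
  have [/sP[li [x ldx]]|] := boolP (l \in s); last by exists 0.
  have Gl := member_part l.
  have [d' [dd' dn' _ dE]] := hquot_lnd li Gl dd dn ds (member_ker l).
  have dx : d' (hpi li x) <> 0 by rewrite dE => /hpi_ker.
  have Um0 : hpi li (U ^+ m) <> 0.
    by rewrite rmorphXn => /integral_exp0 -/(_ (@hquot_integral _ _ li)) /hpi_ker/member_ndvdU.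
  have da' : d' (hpi li a) = 0 by rewrite dE da rmorph0.
  have dU' : d' (hpi li (U ^+ m)) = 0 by rewrite dE der_exp0 ?rmorph0.
  have [c cE] := ker_proportional0 (@hquot_integral _ _ li) k0 (hquot_const_part (hi := li) Gl)
    dd' dn' (@hquot_trdeg _ _ li) dx (hpi_part li Gl Ga) (hpi_part li Gl (gpartX m GU))
    da' dU' Um0.
  exists c => _; apply/(hpi_ker li); rewrite rmorphB rmorphM.
  by apply/eqP; rewrite subr_eq0; apply/eqP.
have [mu muP] := choice mult.
have [q [sq qE]] := interpolation mu us; rewrite ss in sq.
exists q; split=> //; apply/eqP; rewrite -subr_eq0; apply/eqP.
apply: (member_prod_dvd us (e := (m * dg)%N)); last by rewrite ss ltn_mul2r dg_gt0 /=.
  move=> l ls; split; first by have [] := sP l ls.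
  have -> : a - binform (@mpolyC 3 k) F U m q = (a - (mu l)%:MP * U ^+ m) -
     (binform (@mpolyC 3 k) F U m q - (mu l)%:MP * U ^+ m) by ring.
  apply: dvdB; first exact: muP.
  by rewrite -qE //; exact: member_dvd_binform.
apply: gpartB => //; apply: (binform_part (G := G)) => // c; exact: R_const.
Qed.

End Pencil.

(** * Singular points obstruct locally nilpotent derivations *)

Section SingularPoints.
Variable k : closedFieldType.
Local Notation R := {mpoly k[3]}.
Local Notation G := (gradR k).
Local Notation const := (@mpolyC 3 k).
Hypothesis k0 : char0 k.

Let dR := @R_integral k.
Let R0 : char0 R := char0_alg const k0.

Lemma hpi_gcomp (h : R) (hi : irreducible_elt h) e (Gh : G e h) i a :
  gcomp (hgrad hi Gh) i (hpi hi a) = hpi hi (gcomp G i a).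
Proof.
rewrite {1}(gcomp_sum G a) rmorph_sum gcomp_sumr.
have [ia|ai] := ltnP i (gbound G a).
  rewrite (bigD1 (Ordinal ia)) //= (gcomp_part _ (hpi_part hi Gh (gcompP G i a))) eqxx.
  rewrite big1 ?addr0 // => j ji.
  rewrite (gcomp_part _ (hpi_part hi Gh (gcompP G j a))).
  by case: eqP => // e'; case/eqP: ji; apply: val_inj.
rewrite [gcomp G i a]/gcomp ltnNge ai /= rmorph0 big1 // => j _.
rewrite (gcomp_part _ (hpi_part hi Gh (gcompP G j a))).
by case: eqP => // e'; have := ltn_ord j; rewrite -e' ltnNge ai.
Qed.

Lemma hpi_binform (h : R) (hi : irreducible_elt h) F U M (q : {poly k}) :
  hpi hi (binform const F U M q) = binform (hiota hi) (hpi hi F) (hpi hi U) M q.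
Proof.
rewrite /binform rmorph_sum; apply: eq_bigr => i _.
by rewrite !rmorphM !rmorphXn.
Qed.

Lemma proj_eq (B : comNzRingType) (GB : grading B) (P Q : Proj GB) :
  proj_ideal P = proj_ideal Q -> P = Q.
Proof.
case: P Q => [I p1 p2 p3] [J q1 q2 q3] /= IJ; subst J.
by congr MkProj; exact: Prop_irrelevance.
Qed.

Lemma proj_is_relevant (B : comNzRingType) (GB : grading B) (P : Proj GB) :
  relevant GB (proj_ideal P).
Proof.
have [PI _ _] := proj_prime P.
have [a [a0 Pa]] : exists a, gcomp GB 0 a = 0 /\ ~ proj_ideal P a.
  apply: contrapT => h; apply: (@proj_relevant _ _ P) => a a0.
  by apply: contrapT => Pa; apply: h; exists a.
have [i Pi] : exists i, ~ proj_ideal P (gcomp GB i a).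
  apply: contrapT => /forallNP h; apply: Pa; rewrite (gcomp_sum GB a).
  by apply: ideal_sum => // i _; apply: contrapT; exact: h.
exists i, (gcomp GB i a); split=> //; last exact: gcompP.
by rewrite lt0n; apply/eqP => i0; apply: Pi; rewrite i0 a0; exact: ideal0.
Qed.

Lemma affine_birational (B : comNzRingType) (iota : {rmorphism k -> B})
    (GB : grading B) F U dg :
  affine_chart iota GB F U dg -> birational_chart iota GB F U dg.
Proof.
move=> [_ _ _ _ h] m b /h[N [q [sq bE]]]; exists N, 1, q.
rewrite oner_neq0 size_poly1; split=> //.
by rewrite -(expr0 'X) binform_Xn // expr0 mul1r subn0.
Qed.

Variables (f : R) (f9 : G 9%N f) (C1 : irreducible_elt f).
Local Notation pi := (hpi C1).
Local Notation GS := (hgrad C1 f9).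

(** The chart makes the curve regular where U does not vanish. *)
Lemma singular_ideal F U dg (P : Proj GS) : (0 < dg)%N -> GS dg F -> GS dg U ->
  (forall c, F <> hiota C1 c * U) -> birational_chart (hiota C1) GS F U dg ->
  singular_point P -> proj_ideal P U.
Proof.
move=> dg0 GF GU FU ch Ps; apply: contrapT => PU; apply: Ps.
exact: (stalk_regular (@hquot_integral _ _ C1) (hquot_const_part (hi := C1) f9) dg0 GF GU PU FU ch).
Qed.

Section Derivation.
Variable d : R -> R.
Hypotheses (dd : derivation d) (dn : loc_nilpotent d) (dne : exists a, d a <> 0).
Variables (b0 c0 : nat).
Hypothesis ds : shift G b0 c0 d.

Lemma minimal_pencil : exists dg F U, [/\ G dg F, G dg U, d F = 0 & d U = 0] /\
  [/\ U <> 0, F <> 0, forall c, F <> c *: U, forall c, U <> c *: F &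
   forall e a b, (e < dg)%N -> G e a -> G e b -> d a = 0 ->
     d b = 0 -> b <> 0 -> exists c, a = c *: b].
Proof.
pose T e := exists F U, [/\ G e F, G e U, d F = 0 & d U = 0] /\
  U <> 0 /\ forall c, F <> c *: U.
have exT : exists e, `[< T e >].
  have [e [F [U h]]] := ker_pencil_ex k0 dd dn ds.
  by exists e; apply/asboolP; exists F, U.
have [dg /asboolP[F [U [h [U0 FU]]]] dg_min] := ex_minnP exT.
have F0 : F <> 0 by move=> F0; apply: (FU 0); rewrite scale0r.
exists dg, F, U; split=> //; split=> //.
  move=> c UE; have [c'|c'] := eqVneq c 0; first by apply: U0; rewrite UE c' scale0r.
  by apply: (FU c^-1); rewrite UE scalerA mulVf // scale1r.
move=> e a b ed Ga Gb da db b1; apply: contrapT => no.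
have : T e by exists a, b; split=> //; split=> // c ac; apply: no; exists c.
by move/asboolP/dg_min; rewrite leqNgt ed.
Qed.

(** When d f = 0, the derivation passes to the coordinate ring of the curve, and the curve is an
    affine line outside one point. *)
Lemma singular_unique_ker (P Q : Proj GS) : d f = 0 -> (exists a, ~ divides f (d a)) ->
  singular_point P -> singular_point Q -> proj_ideal P `<=` proj_ideal Q.
Proof.
move=> df [a0 fa0] Ps Qs.
have [dg [F [U [[GF GU dF dU] [U0 F0 FU UF dmin]]]]] := minimal_pencil.
have [u [Gu fu du]] : exists u, [/\ G dg u, ~ divides f u & d u = 0].
  have [fU|] := pselect (divides f U); last by exists U.
  have [fF|] := pselect (divides f F); last by exists F.
  case: fU fF => [x UE] [y FE].
  have f0 : f <> 0 by move=> f0; apply: U0; rewrite UE f0 mul0r.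
  have [i [iE Gx]] : exists i, (9 + i = dg)%N /\ G i x.
    by apply: (homogeneous_factor_deg dR f0 f9); rewrite -UE.
  have [j [jE Gy]] : exists j, (9 + j = dg)%N /\ G j y.
    by apply: (homogeneous_factor_deg dR f0 f9); rewrite -FE.
  have ji : j = i by lia.
  have dx : d x = 0 by apply: (lnd_ker_factor dR R0 dd dn (b := f)); rewrite mulrC -UE.
  have dy : d y = 0 by apply: (lnd_ker_factor dR R0 dd dn (b := f)); rewrite mulrC -FE.
  have x0 : x <> 0 by move=> x0; apply: U0; rewrite UE x0 mulr0.
  rewrite ji in Gy; have lt : (i < dg)%N by lia.
  have [c yE] := dmin _ _ _ lt Gy Gx dy dx x0.
  by case: (FU c); rewrite FE UE yE scalerAr.
have [d' [dd' dn' ds' dE]] := hquot_lnd C1 f9 dd dn ds df.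
have dne' : exists a, d' a <> 0 by exists (pi a0); rewrite dE => /hpi_ker.
have u0 : pi u <> 0 by move/hpi_ker.
have du' : d' (pi u) = 0 by rewrite dE du rmorph0.
have dg0 : (0 < dg)%N by exact: (dg_gt0 GF GU U0 FU).
have [F1 [U1 [dg1 [ch dU1 FU1]]]] := lnd_affine_chart (@hquot_integral _ _ C1) k0
  (hquot_const_part (hi := C1) f9) dd' dn' ds' (@hquot_trdeg _ _ C1) dne' (hpi_part C1 f9 Gu) dg0 u0 du'.
have [dg10 GF1 GU1 _ _] := ch; have bch := affine_birational ch.
apply: (infinity_subset (@hquot_integral _ _ C1) ch (proj_prime P) (@proj_homogeneous _ _ P)
  (proj_is_relevant P) _ (proj_prime Q) (proj_is_relevant Q)).
- exact: singular_ideal bch Ps.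
- exact: singular_ideal bch Qs.
Qed.

(** When d f is a nonzero element of the kernel, f is a slice up to d f, so that the
    function field of the curve is that of the base of the pencil. *)
Lemma slice_birational dg F U : G dg F -> G dg U -> d F = 0 -> d U = 0 -> U <> 0 ->
  (forall c, F <> c *: U) ->
  (forall e a b, (e < dg)%N -> G e a -> G e b -> d a = 0 ->
     d b = 0 -> b <> 0 -> exists c, a = c *: b) ->
  d f <> 0 -> d (d f) = 0 ->
  birational_chart (hiota C1) GS (pi F) (pi U) dg /\
  forall c, pi F <> hiota C1 c * pi U.
Proof.
move=> GF GU dF dU U0 FU dmin df d2f; have dg0 := dg_gt0 GF GU U0 FU.
have [//|[et [etE Gt]]] := ds f9; set g := d f in df d2f Gt.
split; last first.
  move=> c /eqP; rewrite -subr_eq0 -[hiota C1 c]/(pi c%:MP) -rmorphM -rmorphB => /eqP.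
  move=> /hpi_ker[x xE]; apply: df.
  have xE' : member F U c = f * x by rewrite -xE mul_mpolyC.
  apply: (lnd_ker_factor dR R0 dd dn (b := x)); rewrite -xE'.
    exact: member_neq0.
  exact: (member_ker k0 dd dn).
move=> m b [a Ga <-].
have [N [J [A [dA GA AE]]]] := slice_expansion dR k0 (@R_const_part k) dd dn ds f9 Gt d2f etE Ga.
pose a1 := (if J is 0%N then 0 else A 0%N) * g ^+ (N * dg.-1).
have Ndg : (N + N * dg.-1 = N * dg)%N by rewrite -mulnS prednK.
have aE : pi (g ^+ (N * dg) * a) = pi a1.
  rewrite -Ndg exprD mulrAC AE /a1 !rmorphM; congr (_ * _).
  case: J {AE a1} => [|J]; first by rewrite big_ord0.
  rewrite big_ord_recl expr0 mulr1 rmorphD [X in _ + X](_ : _ = 0) ?addr0 //.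
  apply/hpi_ker; apply: dvd_sum => i _; rewrite exprS mulrCA; exact: dvdMr (dvd_refl _).
have Ga1 : G ((N * et + m) * dg)%N a1.
  have : (if J is 0%N then 0 else A 0%N) = 0 \/
      G (m * dg + N * et)%N (if J is 0%N then 0 else A 0%N).
    case: (J) => [|J']; first by left.
    by case: (GA 0%N) => [|[e [eE Ge]]]; [left | right; rewrite -eE mul0n addn0].
  rewrite /a1; case=> [->|Ge]; first by rewrite mul0r; exact: gpart0.
  apply: (gpartM_eq Ge (gpartX (N * dg.-1) Gt)).
  by case: (dg) dg0 => // D _; rewrite /= !mulnS !mulnDl; lia.
have dg' n : d (g ^+ n) = 0 by exact: der_exp0.
have da1 : d a1 = 0 by apply: derM0 => //; case: (J) => //; exact: der0.
have [q [sq qE]] := ker_binary_form k0 dd dn ds GF GU dF dU U0 FU dmin dne Ga1 da1.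
have Gg : G (N * et * dg)%N (g ^+ (N * dg)).
  by rewrite (_ : N * et * dg = N * dg * et)%N; [exact: gpartX | lia].
have [w [sw wE]] := ker_binary_form k0 dd dn ds GF GU dF dU U0 FU dmin dne Gg (dg' _).
exists (N * et)%N, w, q; split=> //.
  apply/eqP => w0; move: wE; rewrite w0 binform0 => /integral_exp0 -/(_ dR).
  exact: df.
by rewrite -!hpi_binform -wE -qE -aE rmorphM.
Qed.

(** Two points of the curve where F and U vanish lie on every member of the
    pencil; on an irreducible one there is only one such point, because its
    complement is an affine line. *)
Lemma base_point_unique dg F U (P Q : Proj GS) : G dg F -> G dg U -> d F = 0 -> d U = 0 ->
  U <> 0 -> (forall c, F <> c *: U) ->
  (forall e a b, (e < dg)%N -> G e a -> G e b -> d a = 0 ->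
     d b = 0 -> b <> 0 -> exists c, a = c *: b) ->
  proj_ideal P (pi F) -> proj_ideal P (pi U) ->
  proj_ideal Q (pi F) -> proj_ideal Q (pi U) -> proj_ideal P `<=` proj_ideal Q.
Proof.
move=> GF GU dF dU U0 FU dmin PF PU QF QU; have dg0 := dg_gt0 GF GU U0 FU.
have [t [_ st tP]] := good_members k0 dd dn ds GF GU dF dU U0 FU dmin 1 dne.
have [l lt] : exists l, l \in t.
  by case: t st {tP} => // l t _; exists l; exact: mem_head.
have [hi [a0 ha0]] := tP l lt; set h := member F U l in hi ha0.
have Gh : G dg h := member_part GF GU l.
have dh : d h = 0 := member_ker k0 dd dn dF dU l.
have [d' [dd' dn' ds' dE]] := hquot_lnd hi Gh dd dn ds dh.
have dne' : exists a, d' a <> 0 by exists (hpi hi a0); rewrite dE => /hpi_ker.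
pose u := hpi hi U.
have u0 : u <> 0 by move/hpi_ker/(member_ndvdU GF GU U0 FU).
have Gu : hgrad hi Gh dg u by exact: hpi_part.
have du : d' u = 0 by rewrite /u dE dU rmorph0.
have hB := @hquot_integral _ _ hi.
have hC := hquot_const_part (hi := hi) Gh.
have [F1 [U1 [dg1 [ch dU1 _]]]] :=
  lnd_affine_chart hB k0 hC dd' dn' ds' (@hquot_trdeg _ _ hi) dne' Gu dg0 u0 du.
have [dg10 _ GU1 U10 _] := ch.
pose push (I : Proj GS) : set (hquot hi) :=
  [set b | exists r, proj_ideal I (pi r) /\ hpi hi r = b].
have pushE (I : Proj GS) r : proj_ideal I (pi F) -> proj_ideal I (pi U) ->
    push I (hpi hi r) -> proj_ideal I (pi r).
  move=> IF IU [r' [Ir' rr']]; have [II _ _] := proj_prime I.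
  have /hpi_ker[x xE] : hpi hi (r' - r) = 0 by rewrite rmorphB rr' subrr.
  have -> : pi r = pi r' - pi (h * x) by rewrite -xE rmorphB opprB addrC subrK.
  apply: idealB => //; rewrite rmorphM; apply: idealMr => //.
  rewrite /h /member -mul_mpolyC rmorphB rmorphM; apply: idealB => //; exact: idealMl.
have push_prime (I : Proj GS) : proj_ideal I (pi F) -> proj_ideal I (pi U) ->
    is_prime_ideal (push I).
  move=> IF IU; have [II I1 IM] := proj_prime I; split.
  - split.
    + by exists 0; rewrite !rmorph0; split=> //; exact: ideal0.
    + move=> _ _ [r [Ir <-]] [s [Is <-]]; exists (r + s); rewrite !rmorphD; split=> //.
      exact: idealD.
    + move=> c _ [r [Ir <-]]; have [s <-] := hpi_surj c.
      by exists (s * r); rewrite !rmorphM; split=> //; exact: idealMl.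
  - by rewrite -(rmorph1 (hpi hi)) => /(pushE _ _ IF IU); rewrite rmorph1.
  - move=> a b; have [r <-] := hpi_surj a; have [s <-] := hpi_surj b.
    rewrite -rmorphM => /(pushE _ _ IF IU); rewrite rmorphM => /IM[Ir|Is].
      by left; exists r.
    by right; exists s.
have push_relevant (I : Proj GS) : proj_ideal I (pi F) -> proj_ideal I (pi U) ->
    relevant (hgrad hi Gh) (push I).
  move=> IF IU; have [e [_ [e0 [r Gr <-] Ir]]] := proj_is_relevant I.
  exists e, (hpi hi r); split=> //; first exact: hpi_part.
  by move/(pushE _ _ IF IU).
have push_homog (I : Proj GS) : homogeneous_ideal (hgrad hi Gh) (push I).
  move=> _ [r [Ir <-]] i; rewrite hpi_gcomp; exists (gcomp G i r); split=> //.
  rewrite -(hpi_gcomp C1 f9); exact: proj_homogeneous.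
have pushU1 (I : Proj GS) : proj_ideal I (pi F) -> proj_ideal I (pi U) -> push I U1.
  move=> IF IU; apply: (@prime_idealX _ _ _ dg (push_prime I IF IU)).
  have [s ds0] := dne'.
  have G1 : hgrad hi Gh (dg * dg1)%N (U1 ^+ dg) by exact: gpartX.
  have G2 : hgrad hi Gh (dg * dg1)%N (u ^+ dg1) by rewrite mulnC; exact: gpartX.
  have ud0 : u ^+ dg1 <> 0 by move/integral_exp0 => /(_ hB).
  have [c ->] := ker_proportional0 hB k0 hC dd' dn' (@hquot_trdeg _ _ hi) ds0 G1 G2
    (der_exp0 dd' dg dU1) (der_exp0 dd' dg1 du) ud0.
  have [pI _ _] := push_prime I IF IU.
  apply: idealMl => //; rewrite -(prednK dg10) exprS; apply: idealMr => //.
  by exists U.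
have sub := infinity_subset hB ch (push_prime P PF PU) (push_homog P)
  (push_relevant P PF PU) (pushU1 P PF PU) (push_prime Q QF QU) (push_relevant Q QF QU)
  (pushU1 Q QF QU).
move=> s Ps; have [r rE] := hpi_surj s; rewrite -rE in Ps *.
by apply: pushE => //; apply: sub; exists r.
Qed.

(** Both F / U and U / F are rational coordinates on the curve, so F and U vanish at every
    singular point. *)
Lemma singular_unique_slice (P Q : Proj GS) : d f <> 0 -> d (d f) = 0 ->
  singular_point P -> singular_point Q -> proj_ideal P `<=` proj_ideal Q.
Proof.
move=> df d2f Ps Qs.
have [dg [F [U [[GF GU dF dU] [U0 F0 FU UF dmin]]]]] := minimal_pencil.
have dg0 := dg_gt0 GF GU U0 FU.
have [ch1 FU1] := slice_birational GF GU dF dU U0 FU dmin df d2f.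
have [ch2 UF1] := slice_birational GU GF dU dF F0 UF dmin df d2f.
have GF' := hpi_part C1 f9 GF; have GU' := hpi_part C1 f9 GU.
by apply: (base_point_unique GF GU dF dU U0 FU dmin);
  [exact: singular_ideal ch2 Ps | exact: singular_ideal ch1 Ps
  |exact: singular_ideal ch2 Qs | exact: singular_ideal ch1 Qs].
Qed.

End Derivation.

(** A derivation killing f may be divided by f until f no longer divides it: the degree of
    d a0 drops each time. *)
Lemma lnd_divide n d b c a0 ea ev : derivation d -> loc_nilpotent d -> shift G b c d ->
  d f = 0 -> G ea a0 -> d a0 <> 0 -> G ev (d a0) -> (ev < n)%N ->
  exists d' b' c', [/\ derivation d', loc_nilpotent d', shift G b' c' d', d' f = 0 &
    exists a, ~ divides f (d' a)].
Proof.
elim: n d b c ev => // n IH d b c ev dd dn ds df Ga0 da0 Gv evn.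
have [[a fa]|no] := pselect (exists a, ~ divides f (d a)).
  by exists d, b, c; split=> //; exists a.
have f0 : f <> 0 by case: (C1) => /eqP.
have div a : exists q, d a = f * q.
  by apply: contrapT => h; apply: no; exists a.
have [d1 d1E] := choice div.
have can x y : f * x = f * y -> x = y by exact: (integral_mulI dR f0).
have dd1 : derivation d1.
  split=> x y; apply: can.
    by rewrite -d1E derD // !d1E mulrDr.
  by rewrite -d1E derM // !d1E; ring.
have d1f : d1 f = 0 by apply: can; rewrite -d1E df mulr0.
have it m x : iter m d x = f ^+ m * iter m d1 x.
  elim: m => [|m IHm]; first by rewrite expr0 mul1r.
  by rewrite !iterS IHm derMl ?der_exp0 // d1E exprSr mulrA.
have dn1 : loc_nilpotent d1.
  move=> x; have [m mx] := dn x; exists m; move: mx; rewrite it => /dR[|//].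
  by move/integral_exp0 => /(_ dR).
have ds1 : shift G b (c + 9) d1.
  move=> e x Gx; have [x0|[e' [e'E Ge']]] := ds _ _ Gx.
    by left; apply: can; rewrite -d1E x0 mulr0.
  have [->|dx0] := pselect (d1 x = 0); first by left.
  have fx0 : f * d1 x <> 0 by move/dR => [].
  rewrite d1E in Ge'; have [i [iE Gi]] := homogeneous_factor_deg dR f0 f9 Ge' fx0.
  by right; exists i; split=> //; lia.
have d1a0 : d1 a0 <> 0 by move=> h; apply: da0; rewrite d1E h mulr0.
have fx0 : f * d1 a0 <> 0 by rewrite -d1E.
rewrite d1E in Gv; have [i [iE Gi]] := homogeneous_factor_deg dR f0 f9 Gv fx0.
by apply: (IH d1 b (c + 9)%N i) => //; lia.
Qed.

Theorem lnd_singular_unique d b c (P Q : Proj GS) : derivation d -> loc_nilpotent d ->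
  shift G b c d -> (exists a, d a <> 0) -> d (d f) = 0 ->
  singular_point P -> singular_point Q -> P = Q.
Proof.
move=> dd dn ds dne d2f.
suff sub (P' Q' : Proj GS) : singular_point P' -> singular_point Q' ->
    proj_ideal P' `<=` proj_ideal Q'.
  by move=> Ps Qs; apply: proj_eq; apply/seteqP; split; exact: sub.
have [df|df] := pselect (d f = 0); last exact: (singular_unique_slice dd dn dne ds df d2f).
have [a [ea [Ga da]]] : exists a ea, G ea a /\ d a <> 0.
  have [a da] := dne; apply: contrapT => h; apply: da.
  rewrite (gcomp_sum G a) (der_sum dd) big1 // => i _.
  by apply: contrapT => di; apply: h; exists (gcomp G i a), i; split=> //; exact: gcompP.
have [//|[ev [_ Gv]]] := ds _ _ Ga.
have [d' [b' [c' [dd' dn' ds' d'f fa]]]] := lnd_divide dd dn ds df Ga da Gv (ltnSn ev).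
have dne' : exists a, d' a <> 0.
  by have [x fx] := fa; exists x => h; apply: fx; rewrite h; exact: dvd0.
exact: (singular_unique_ker dd' dn' ds' d'f fa).
Qed.

End SingularPoints.

(** * The graded ring A = R[W] / (W ^ n + f) *)

(** The product of the highest components of two elements is a component of their product. *)
Lemma graded_integral (B : comNzRingType) (G : grading B) :
  (forall i j a b, G i a -> G j b -> a * b = 0 -> a = 0 \/ b = 0) -> integral B.
Proof.
move=> hom a b ab; apply: contrapT => /not_orP[a0 b0].
have top (c : B) : c <> 0 -> exists i, gcomp G i c <> 0 /\
    forall j, (i < j)%N -> gcomp G j c = 0.
  move=> c0; have [i ci] : exists i, gcomp G i c != 0.
    apply: contrapT => /forallNP h; apply: c0; apply: (gcomp_eq0 (G := G)) => i.
    by apply/eqP; apply: contrapT => /negP/h.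
  have [N cN] := gcomp_bounded G c.
  case: (@ex_maxnP (fun i => gcomp G i c != 0) N); first by exists i.
    by move=> j; apply: contraTT; rewrite -ltnNge => /ltnW /cN ->; rewrite eqxx.
  move=> m /eqP cm mm; exists m; split=> // j jm; apply/eqP; apply: contraTT jm.
  by rewrite -leqNgt; exact: mm.
have [i [ai li]] := top a a0; have [j [bj lj]] := top b b0.
have := congr1 (gcomp G (i + j)) ab; rewrite gcomp0.
pose N := maxn i.+1 (gbound G a).
rewrite {1}(@gcomp_big _ G a N) ?leq_maxr // mulr_suml gcomp_sumr.
have iN : (i < N)%N by rewrite leq_max ltnSn.
rewrite (bigD1 (Ordinal iN)) //= gcompMl; last exact: gcompP.
rewrite big1 ?addr0 => [|i' ii'].
  by move/(hom _ _ _ _ (gcompP G i a) (gcompP G j b)) => [].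
have [le|lt] := leqP i' (i + j); last by apply: gcompMl_lt lt; exact: gcompP.
rewrite -(subnKC le) gcompMl; last exact: gcompP.
have {}ii' : i' != i :> nat by apply: contra ii' => /eqP e; apply/eqP/val_inj.
have [lt|ge] := ltnP i i'; first by rewrite li ?mul0r.
by rewrite lj ?mulr0 //; lia.
Qed.

Section Cover.
Variable k : closedFieldType.
Local Notation R := {mpoly k[3]}.
Hypothesis k0 : char0 k.
Variables (f : R) (n : nat).
Hypotheses (f9 : gradR k 9%N f) (n_gt1 : (1 < n)%N) (n3 : ~~ (3 %| n)%N).
Hypothesis f0 : f <> 0.
Local Notation A := (cyclic_cover f n).
Local Notation G := (cover_grading n_gt1 f9).

Let n_gt0 : (0 < n)%N := ltnW n_gt1.

Definition cover_iota (r : R) : A := cover_pi f n r%:P.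
Definition cover_w : A := cover_pi f n 'X.
Local Notation iota := cover_iota.
Local Notation w := cover_w.

Fact cover_iotaD : zmod_morphism iota.
Proof. by move=> a b; rewrite /iota polyCB rmorphB. Qed.

Fact cover_iotaM : monoid_morphism iota.
Proof. by split=> [|a b]; rewrite /iota ?polyC1 ?rmorph1 // polyCM rmorphM. Qed.

HB.instance Definition _ := GRing.isZmodMorphism.Build R A iota cover_iotaD.
HB.instance Definition _ := GRing.isMonoidMorphism.Build R A iota cover_iotaM.

Lemma cover_piE (p : {poly R}) : cover_pi f n p = \sum_(i < size p) iota p`_i * w ^+ i.
Proof.
rewrite -{1}[p]coefK poly_def rmorph_sum; apply: eq_bigr => i _.
by rewrite -mul_polyC rmorphM rmorphXn.
Qed.

Lemma cover_wn : w ^+ n = - iota f.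
Proof.
have : cover_pi f n (cover_poly f n) = 0.
  by apply/(cover_ker f n_gt1); exists 1; rewrite mulr1.
by rewrite /cover_poly rmorphD rmorphXn => /eqP; rewrite addr_eq0 => /eqP.
Qed.

Lemma cover_pi_small (p : {poly R}) : (size p <= n)%N -> cover_pi f n p = 0 -> p = 0.
Proof.
move=> pn /(cover_ker f n_gt1)[q pE]; apply: contrapT => /eqP p0.
have q0 : q != 0 by apply: contraNneq p0 => q0; rewrite pE q0 mulr0.
move: pn; rewrite pE size_monicM ?cover_poly_monic // size_cover_poly // addSn /=.
by rewrite -[X in (_ <= X)%N]addn0 leq_add2l leqNgt size_poly_gt0 q0.
Qed.

Lemma cover_wX j : w ^+ j = iota ((- f) ^+ (j %/ n)) * w ^+ (j %% n).
Proof.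
by rewrite {1}(divn_eq j n) exprD mulnC exprM cover_wn rmorphXn rmorphN.
Qed.

Lemma cover_iotaMw_eq0 r j : iota r * w ^+ j = 0 -> r = 0.
Proof.
have small r' i : (i < n)%N -> iota r' * w ^+ i = 0 -> r' = 0.
  move=> i_n; rewrite /iota /w -rmorphXn -rmorphM => /cover_pi_small h.
  have : r'%:P * 'X^i = 0.
    by apply: h; apply: leq_trans (size_polyMleq _ _) _; rewrite size_polyXn addnS /=;
      apply: leq_trans (leq_add (size_polyC_leq1 _) (leqnn _)) _.
  by move/(congr1 (fun p : {poly R} => p`_i)); rewrite coefCM coefXn eqxx mulr1 coef0.
rewrite cover_wX mulrA -rmorphM => /(small _ _ (ltn_pmod j n_gt0)) /R_integral[//|].
by move/integral_exp0 => /(_ (@R_integral k))/eqP; rewrite oppr_eq0 => /eqP/f0.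
Qed.

Lemma cover_iota_inj r : iota r = 0 -> r = 0.
Proof. by move=> r0; apply: (@cover_iotaMw_eq0 r 0); rewrite expr0 mulr1. Qed.

Lemma cover_w_neq0 j : w ^+ j <> 0.
Proof.
move=> wj; have : (1 : R) = 0.
  by apply: (@cover_iotaMw_eq0 1 j); rewrite wj mulr0.
by move/eqP; rewrite oner_eq0.
Qed.

Lemma cover_gen (a : A) : exists c : 'I_n -> R, a = \sum_(i < n) iota (c i) * w ^+ i.
Proof.
have [p <-] := cover_surj a; rewrite cover_piE.
exists (fun i : 'I_n => \sum_(j < size p | (j %% n)%N == i) p`_j * (- f) ^+ (j %/ n)).
under [RHS]eq_bigr => i _ do rewrite rmorph_sum mulr_suml.
rewrite [RHS](exchange_big_dep xpredT) //=; apply: eq_bigr => j _.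
rewrite (big_pred1 (Ordinal (ltn_pmod j n_gt0))) /=; last first.
  by move=> i; apply/eqP/eqP => [e|->//]; apply: val_inj.
by rewrite cover_wX mulrA rmorphM.
Qed.

Lemma cover_iota_part e r : gradR k e r -> G (n * e)%N (iota r).
Proof.
move=> Gr; exists r%:P => //; apply: poly_partC; apply/dhomogP => m.
move/(dhomogP _ _ _ Gr) => <-.
by rewrite /wdeg big_distrr; apply: eq_bigr => i _; rewrite /= /wt_cover -mulnA.
Qed.

Lemma cover_w_part : G 9%N w.
Proof. exact: cover_grading_w. Qed.

Lemma coprime_n9 : coprime n 9.
Proof. by rewrite (_ : 9 = 3 ^ 2)%N // coprimeXr // coprime_sym prime_coprime. Qed.

Lemma modn9_inj i j : (9 * i = 9 * j %[mod n])%N -> (i = j %[mod n])%N.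
Proof.
wlog ij : i j / (j <= i)%N => [h|].
  by case: (leqP j i) => [/h//|/ltnW/h h' /esym e]; apply/esym; exact: h'.
move=> /eqP; rewrite eqn_mod_dvd ?leq_mul2l // -mulnBr Gauss_dvdr ?coprime_n9 //.
by rewrite -eqn_mod_dvd // => /eqP.
Qed.

(** Since 9 is invertible modulo n, the degree of a homogeneous element determines
    the exponent of w modulo n. *)
Lemma cover_part i a : G i a -> a <> 0 ->
  exists r j e, [/\ (j < n)%N, a = iota r * w ^+ j, gradR k e r & (n * e + 9 * j)%N = i].
Proof.
move=> [p Pp <-] p0.
have coef j : p`_j <> 0 -> exists e, gradR k e p`_j /\ (n * e + 9 * j)%N = i.
  move=> pj; have := Pp j; case: leqP => [le Gj|//].
  have [m pm] : exists m, m \in msupp p`_j.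
    have : msupp p`_j != [::] by rewrite msupp_eq0; apply/eqP.
    by case: (msupp _) => // m s _; exists m; exact: mem_head.
  have wdegE m' : wdeg (wt_cover n) m' = (n * wdeg wt m')%N.
    by rewrite /wdeg big_distrr; apply: eq_bigr => l _; rewrite /= /wt_cover -mulnA.
  have deg m' : m' \in msupp p`_j -> (n * wdeg wt m' = i - 9 * j)%N.
    by move/(dhomogP _ _ _ Gj) => <-; rewrite -wdegE.
  exists (wdeg wt m); split; last by rewrite (deg m pm) subnK.
  apply/dhomogP => m' pm'; apply/eqP.
  by rewrite -(eqn_pmul2l n_gt0); apply/eqP; rewrite [LHS](deg m' pm') -(deg m pm).
have [j0 pj0] : exists j, p`_j <> 0.
  apply: contrapT => /forallNP h; apply: p0; rewrite (_ : p = 0) ?rmorph0 //.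
  by apply/polyP => j; rewrite coef0; apply: contrapT; exact: h.
have [e0 [Ge0 e0E]] := coef _ pj0; pose j1 := (j0 %% n)%N.
have jmod j : p`_j <> 0 -> (j %% n)%N = j1.
  move=> /coef[e [_ eE]]; apply: modn9_inj.
  have := congr1 (fun x => x %% n)%N (etrans eE (esym e0E)).
  by rewrite -[(n * e)%N]mulnC -[(n * e0)%N]mulnC !modnMDl.
pose e1 := (e0 + 9 * (j0 %/ n))%N.
have e1E : (n * e1 + 9 * j1)%N = i.
  by have := divn_eq j0 n; move: e0E; rewrite /e1 /j1; lia.
exists (\sum_(j < size p) p`_j * (- f) ^+ (j %/ n)), j1, e1; split=> //.
- exact: ltn_pmod.
- rewrite cover_piE rmorph_sum mulr_suml; apply: eq_bigr => j _.
  have [->|pj] := pselect (p`_j = 0); first by rewrite mul0r !rmorph0 !mul0r.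
  by rewrite cover_wX (jmod _ pj) mulrA rmorphM.
- apply: gpart_sum => j _; have [->|pj] := pselect (p`_j = 0).
    by rewrite mul0r; exact: gpart0.
  have [e [Ge eE]] := coef _ pj.
  have Gf : gradR k ((j %/ n) * 9)%N ((- f) ^+ (j %/ n)) by apply: gpartX; exact: gpartN.
  apply: (gpartM_eq Ge Gf); apply/eqP; rewrite -(eqn_pmul2l n_gt0); apply/eqP.
  have := jmod _ pj; have := divn_eq j n; move: eE e1E; lia.
Qed.

Lemma cover_integral : integral A.
Proof.
apply: (@graded_integral _ G) => i j a b Ga Gb ab; apply: contrapT => /not_orP[a0 b0].
have [r [l [e [_ aE _ _]]]] := cover_part Ga a0.
have [r' [l' [e' [_ bE _ _]]]] := cover_part Gb b0.
have : r * r' = 0.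
  apply: (@cover_iotaMw_eq0 _ (l + l')); rewrite -[RHS]ab aE bE rmorphM exprD; ring.
by move=> /R_integral[r0|r0]; [apply: a0; rewrite aE r0|apply: b0; rewrite bE r0]; rewrite rmorph0 mul0r.
Qed.

Lemma cover_char0 : char0 A.
Proof.
move=> m; apply/eqP; rewrite -(rmorph_nat iota) => /cover_iota_inj /eqP.
by rewrite -(rmorph_nat (@mpolyC 3 k)) mpolyC_eq0 (negPf (k0 m)).
Qed.

End Cover.

(** * Homogeneous locally nilpotent derivations of A *)

Section Rigid.
Variable k : closedFieldType.
Local Notation R := {mpoly k[3]}.
Hypothesis k0 : char0 k.
Variables (f : R) (n : nat).
Hypotheses (f9 : gradR k 9%N f) (n_gt1 : (1 < n)%N) (n3 : ~~ (3 %| n)%N).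
Hypothesis f0 : f <> 0.
Local Notation A := (cyclic_cover f n).
Local Notation G := (cover_grading n_gt1 f9).
Local Notation iota := (@cover_iota k f n).
Local Notation w := (cover_w f n).

Let n_gt0 : (0 < n)%N := ltnW n_gt1.
Let dA : integral A := cover_integral f9 n_gt1 n3 f0.
Let A0 : char0 A := cover_char0 k0 n_gt1 f0.
Let iota0 := @cover_iotaMw_eq0 k f n n_gt1 f0.

Variables (D : A -> A).
Hypotheses (Dd : derivation D) (Dn : loc_nilpotent D).
Variables (b c : nat).
Hypothesis Ds : shift G b c D.

Lemma cover_der_eq0 : (forall r, D (iota r) = 0) -> D w = 0 -> forall a, D a = 0.
Proof.
move=> Di Dw a; have [r ->] := cover_gen n_gt1 a.
by rewrite (der_sum Dd) big1 // => i _; rewrite derM0 // der_exp0.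
Qed.

(** The degrees of the elements of R are divisible by n, so the degrees of their images under D
    agree modulo n, and a single power of w occurs in these. *)
Lemma cover_der_restrict : ~ (forall a, D a = 0) ->
  exists j (d : R -> R) b' c', [/\ (j < n)%N, forall r, D (iota r) = iota (d r) * w ^+ j,
    derivation d, shift (gradR k) b' c' d & (9 * j + c = b %[mod n])%N /\ exists r, d r <> 0].
Proof.
move=> Dne.
have [r0 [e0 [Gr0 Dr0]]] : exists r0 e0, gradR k e0 r0 /\ D (iota r0) <> 0.
  apply: contrapT => h; have Di r : D (iota r) = 0.
    rewrite (gcomp_sum (gradR k) r) rmorph_sum (der_sum Dd) big1 // => i _.
    by apply: contrapT => di; apply: h; exists (gcomp (gradR k) i r), i; split=> //; exact: gcompP.
  apply: Dne; apply: cover_der_eq0 => //.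
  have := Di f; rewrite -[iota f]opprK -(cover_wn f n_gt1) derN // derX // => /eqP.
  rewrite oppr_eq0 => /eqP /dA[/dA[/(char0_neq0 A0 n_gt0)//|]|//].
  by move/(@cover_w_neq0 k f n n_gt1 f0).
have [//|[i0 [i0E Gi0]]] := Ds (cover_iota_part f9 n_gt1 Gr0).
have [s0 [j [t0 [jn s0E Gs0 t0E]]]] := cover_part n3 Gi0 Dr0.
have jb : (9 * j + c = b %[mod n])%N.
  have : (n * t0 + (9 * j + c) = n * e0 + b)%N by rewrite -i0E -t0E addnA.
  by move/(congr1 (fun x => x %% n)%N); rewrite ![(n * _)%N]mulnC !modnMDl.
have hom e r : gradR k e r -> exists s, D (iota r) = iota s * w ^+ j /\
    (s = 0 \/ exists t, (t + e0 = e + t0)%N /\ gradR k t s).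
  move=> Gr; have [Dr|Dr] := pselect (D (iota r) = 0).
    by exists 0; rewrite Dr rmorph0 mul0r; split=> //; left.
  have [//|[i [iE Gi]]] := Ds (cover_iota_part f9 n_gt1 Gr).
  have [s [l [t [ln sE Gs tE]]]] := cover_part n3 Gi Dr.
  have lb : (n * t + (9 * l + c) = n * e + b)%N by rewrite -iE -tE addnA.
  have lj : l = j.
    rewrite -[l](modn_small ln) -[j](modn_small jn); apply: (modn9_inj n3).
    have : (9 * l + c = b %[mod n])%N.
      by move/(congr1 (fun x => x %% n)%N): lb; rewrite ![(n * _)%N]mulnC !modnMDl.
    by rewrite -jb => /eqP; rewrite eqn_modDr => /eqP.
  exists s; rewrite -lj; split=> //; right; exists t; split=> //.
  apply/eqP; rewrite -(eqn_pmul2l n_gt0) !mulnDr; apply/eqP.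
  by move: lb t0E i0E; rewrite lj; lia.
have all r : exists s, D (iota r) = iota s * w ^+ j.
  have /choice[s sP] i : exists s, D (iota (gcomp (gradR k) i r)) = iota s * w ^+ j.
    by have [s [sE _]] := hom _ _ (gcompP (gradR k) i r); exists s.
  exists (\sum_(i < gbound (gradR k) r) s i).
  rewrite {1}(gcomp_sum (gradR k) r) !rmorph_sum (der_sum Dd) mulr_suml.
  by apply: eq_bigr => i _; exact: sP.
have [d dE] := choice all.
have inj x y : iota x * w ^+ j = iota y * w ^+ j -> x = y.
  move=> /eqP; rewrite -subr_eq0 -mulrBl -rmorphB => /eqP/iota0/eqP.
  by rewrite subr_eq0 => /eqP.
exists j, d, t0, e0; split=> //.
- split=> x y; apply: inj; rewrite -dE.
    by rewrite rmorphD (derD Dd) !dE rmorphD mulrDl.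
  by rewrite rmorphM (derM Dd) !dE rmorphD !rmorphM; ring.
- move=> e r Gr; have [s [sE sP]] := hom _ _ Gr.
  by rewrite (_ : d r = s) //; apply: inj; rewrite -dE.
- split=> //; exists r0 => dr0; apply: Dr0; by rewrite dE dr0 rmorph0 mul0r.
Qed.

(** If w divides D w then D w = 0 and d f = 0. Otherwise j = n - 1 and D w lies in R;
    then d f = - n D w, and degrees along D force D (D w) = 0. *)
Lemma cover_lnd_restrict : ~ (forall a, D a = 0) -> exists (d : R -> R) b' c',
  [/\ derivation d, loc_nilpotent d, shift (gradR k) b' c' d, (exists r, d r <> 0) & d (d f) = 0].
Proof.
move=> Dne; have [j [d [b' [c' [jn dE dd ds [jb dne]]]]]] := cover_der_restrict Dne.
exists d, b', c'.
have wn0 i : w ^+ i <> 0 := @cover_w_neq0 k f n n_gt1 f0 i.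
have iter_d m r : D w = 0 -> iter m D (iota r) = iota (iter m d r) * (w ^+ j) ^+ m.
  move=> Dw; elim: m => [|m IH]; first by rewrite expr0 mulr1.
  have Dwj : D ((w ^+ j) ^+ m) = 0 by do 2 apply: der_exp0 => //.
  by rewrite iterS IH derM // Dwj mulr0 addr0 dE exprS !mulrA.
have [Dw|Dw] := pselect (D w = 0).
  split=> // [r|].
    have [m mr] := Dn (iota r); exists m; move: mr; rewrite iter_d // -exprM.
    exact: iota0.
  have df : d f = 0; last by rewrite df der0.
  apply: (@iota0 _ j); rewrite -dE -[iota f]opprK -(cover_wn f n_gt1) derN // derX //.
  by rewrite Dw mulr0 oppr0.
have [//|[i [iE Gi]]] := Ds (cover_w_part f9 n_gt1).
have [h [l [e [ln hE Gh eE]]]] := cover_part n3 Gi Dw.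
have lj : (l = j.+1 %[mod n])%N.
  apply: (modn9_inj n3); apply/eqP; rewrite -(eqn_modDr c) mulnS -addnA; apply/eqP.
  have -> : (9 + (9 * j + c) = 9 + b %[mod n])%N by rewrite -modnDmr jb modnDmr.
  by rewrite -iE -eE -addnA [(n * e)%N]mulnC modnMDl.
have w0 : w <> 0 by have := wn0 1%N; rewrite expr1.
have jn1 : j = n.-1.
  apply/eqP; rewrite -eqSS prednK // eqn_leq jn leqNgt; apply/negP => j1n.
  move: lj; rewrite (modn_small ln) (modn_small j1n) => lj.
  by apply: Dw; apply: (lnd_dvd_ker dA A0 Dd Dn (b := iota h * w ^+ j)); rewrite hE lj exprS; ring.
have l0 : l = 0%N by move: lj; rewrite (modn_small ln) jn1 prednK // modnn.
move: hE; rewrite l0 expr0 mulr1 => hE.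
have df : d f = - (n%:R * h).
  apply/eqP; rewrite -subr_eq0 opprK; apply/eqP; apply: (@iota0 _ j).
  rewrite rmorphD mulrDl -dE -[iota f]opprK -(cover_wn f n_gt1) derN // derX //.
  by rewrite hE rmorphM rmorph_nat jn1; ring.
have h0 : iota h <> 0 by rewrite -hE.
have dh : d h = 0.
  apply: contrapT => dh; have [m wm] := lnd_deg_ex Dn w0.
  have DDw : D (D w) <> 0 by rewrite hE dE => /iota0.
  case: m wm => [/lnd_deg_ker//|[/(lnd_deg_der)/lnd_deg_ker//|m]] wm.
  have w1 := lnd_deg_der (lnd_deg_der wm).
  have i0 : iota (d h) <> 0 by move/(cover_iota_inj n_gt1 f0).
  have [t it] := lnd_deg_ex Dn i0.
  have := lnd_degM dA A0 Dd it (lnd_degX dA A0 Dd j wm); rewrite -dE -hE => w2.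
  have := lnd_deg_uniq Dd w1 w2; rewrite jn1.
  have : (1 <= n.-1)%N by rewrite -ltnS prednK.
  by case: (n.-1) => // q _; lia.
have w1 : lnd_deg D w 1 by split=> //=; rewrite hE dE dh rmorph0 mul0r.
split=> //; last first.
  by rewrite df derN // derM // dh (der_natr dd) mul0r mulr0 addr0 oppr0.
move=> r; have [r0|r0] := pselect (iota r = 0).
  by exists 0%N; exact: (cover_iota_inj n_gt1 f0 r0).
have [m] := lnd_deg_ex Dn r0; have [N] := ubnP m; elim: N m r r0 => // N IH m r r0 mN rm.
have [dr|dr] := pselect (d r = 0); first by exists 1%N.
have dr0 : iota (d r) <> 0 by move/(cover_iota_inj n_gt1 f0).
have [t it] := lnd_deg_ex Dn dr0.
have tm : (t < m)%N.
  have E := lnd_degM dA A0 Dd it (lnd_degX dA A0 Dd j w1); rewrite -dE in E.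
  case: m rm {mN} => [/lnd_deg_ker|m /lnd_deg_der rm].
    by rewrite dE => /iota0.
  by have := lnd_deg_uniq Dd rm E; lia.
have [p pE] := IH t (d r) dr0 (leq_trans tm mN) it.
by exists p.+1; rewrite iterSr.
Qed.

End Rigid.

(** A nonzero D induces a derivation of R that leaves room for one singular point only. *)
Theorem cover_rigid (k : closedFieldType) (f : {mpoly k[3]}) n (f9 : gradR k 9%N f)
    (C1 : irreducible_elt f) (n_gt1 : (1 < n)%N) b c (D : cyclic_cover f n -> cyclic_cover f n) :
  char0 k -> at_least_two_singular_points f9 C1 -> ~~ (3 %| n)%N ->
  derivation D -> loc_nilpotent D -> shift (cover_grading n_gt1 f9) b c D ->
  forall a, D a = 0.
Proof.
move=> k0 [P [Q [PQ Ps Qs]]] n3 Dd Dn Ds; apply: contrapT => Dne.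
have f0 : f <> 0 by case: (C1) => /eqP.
have [d [b' [c' [dd dn ds dne d2f]]]] := cover_lnd_restrict k0 n3 f0 Dd Dn Ds Dne.
exact: PQ (lnd_singular_unique k0 dd dn ds dne d2f Ps Qs).
Qed.

(** * Automorphisms preserving the grading *)

Section Jets.
Variable k : fieldType.
Implicit Types u v : {poly k}.

Lemma coefM0 u v : (u * v)`_0 = u`_0 * v`_0.
Proof. by rewrite coefM big_ord1. Qed.

Lemma coefM1 u v : (u * v)`_1 = u`_0 * v`_1 + u`_1 * v`_0.
Proof. by rewrite coefM !big_ord_recl big_ord0 addr0. Qed.

Lemma coefM2 u v : (u * v)`_2 = u`_0 * v`_2 + u`_1 * v`_1 + u`_2 * v`_0.
Proof. by rewrite coefM !big_ord_recl big_ord0 /= addr0 !addrA. Qed.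

Lemma coefM3 u v : (u * v)`_3 = u`_0 * v`_3 + u`_1 * v`_2 + u`_2 * v`_1 + u`_3 * v`_0.
Proof. by rewrite coefM !big_ord_recl big_ord0 /= addr0 !addrA. Qed.

Definition jetE := (coefM0, coefM1, coefM2, coefM3).

(** A form of weighted degree 9 expanded in powers of z; the first two coefficients are those
    prescribed for f. *)
Definition ninth (p q r s al be ga : k) (x y z h : {poly k}) : {poly k} :=
  p%:P * (x * x * x) + q%:P * (x * (y * y * y))
  + (r%:P * (x * x * y) + s%:P * (y * y * y * y)) * z + al%:P * (x * (y * y)) * (z * z)
  + (be%:P * (x * x) + ga%:P * (y * y * y)) * (z * z * z) + z * z * z * z * h.

Section NinthCoefficients.
Variables (p q r s al be ga : k) (x y z h : {poly k}).
Local Notation N := (ninth p q r s al be ga x y z h).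
Hypothesis z0 : z`_0 = 0.

Lemma ninth0 : N`_0 = p * x`_0 ^+ 3 + q * (x`_0 * y`_0 ^+ 3).
Proof. by rewrite /ninth !(coefD, coefCM, jetE) z0; ring. Qed.

Lemma ninth1 : N`_1 = p * (3%:R * x`_0 ^+ 2 * x`_1)
  + q * (x`_1 * y`_0 ^+ 3 + 3%:R * x`_0 * y`_0 ^+ 2 * y`_1)
  + (r * (x`_0 ^+ 2 * y`_0) + s * y`_0 ^+ 4) * z`_1.
Proof. by rewrite /ninth !(coefD, coefCM, jetE) z0; ring. Qed.

Hypotheses (x1 : x`_1 = 0) (y1 : y`_1 = 0) (x2 : x`_2 = 0) (z2 : z`_2 = 0).

Lemma ninth2 : N`_2 = q * (3%:R * x`_0 * y`_0 ^+ 2 * y`_2)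
  + al * (x`_0 * y`_0 ^+ 2) * z`_1 ^+ 2.
Proof. by rewrite /ninth !(coefD, coefCM, jetE) z0 x1 y1 x2 z2; ring. Qed.

Hypotheses (y2 : y`_2 = 0) (y3 : y`_3 = 0) (z3 : z`_3 = 0).

Lemma ninth3 : N`_3 = p * (3%:R * x`_0 ^+ 2 * x`_3) + q * (x`_3 * y`_0 ^+ 3)
  + (be * x`_0 ^+ 2 + ga * y`_0 ^+ 3) * z`_1 ^+ 3.
Proof. by rewrite /ninth !(coefD, coefCM, jetE) z0 x1 y1 x2 z2 y2 y3 z3; ring. Qed.

End NinthCoefficients.

Variables (p q r s al be ga : k).
Local Notation nf := (ninth p q r s al be ga).

(** The substitutions x -> a x + b y z + c z ^ 3, y -> d y + e z ^ 2, z -> l z that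
    multiply f by a constant, read off from the expansion of f in powers of z up to
    degree 3 at the points (1, 0), (0, 1) and (1, 1). *)
Lemma ninth_jets (a b c d e l la : k) :
  (3%:R * p) * s - r * q != 0 -> p != 0 -> q != 0 -> (3%:R != 0 :> k) ->
  la != 0 ->
  (forall x y : k, exists h h', nf
      ((a * x)%:P + (b * y)%:P * 'X + c%:P * 'X^3) ((d * y)%:P + e%:P * 'X^2) (l%:P * 'X) h =
    la%:P * nf x%:P y%:P 'X h') ->
  [/\ a = l ^+ 3, d = l ^+ 2, b = 0, e = 0 & c = 0] /\ la = l ^+ 9.
Proof.
move=> det p0 q0 three la0 H.
have eqX x y : exists X Y Z h h' : {poly k},
   [/\ nf X Y Z h = la%:P * nf x%:P y%:P 'X h',
      [/\ X`_0 = a * x, X`_1 = b * y, X`_2 = 0 & X`_3 = c],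
      [/\ Y`_0 = d * y, Y`_1 = 0, Y`_2 = e & Y`_3 = 0] &
      [/\ Z`_0 = 0, Z`_1 = l, Z`_2 = 0 & Z`_3 = 0]].
  have [h [h' E]] := H x y; do 5 eexists; split; first exact: E.
  - by split; rewrite !coefE /=; ring.
  - by split; rewrite !coefE /=; ring.
  - by split; rewrite !coefE /=; ring.
have cE (c' : k) i : (c'%:P)`_i.+1 = 0 by rewrite coefC.
have c0 (c' : k) : (c'%:P)`_0 = c' by rewrite coefC.
have [w0 w1 w2 w3] : [/\ ('X : {poly k})`_0 = 0, ('X : {poly k})`_1 = 1,
  ('X : {poly k})`_2 = 0 & ('X : {poly k})`_3 = 0] by rewrite !coefX.
have div (u v : k) : u != 0 -> u * v = 0 -> v = 0.
  by move=> u0 /eqP; rewrite mulf_eq0 (negPf u0) => /eqP.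
have fin (u v : k) : u - v = 0 -> u = v by move/eqP; rewrite subr_eq0 => /eqP.
(* The coefficients of z ^ 0 and z ^ 1. *)
have T0 x y : p * (a * x) ^+ 3 + q * ((a * x) * (d * y) ^+ 3) = la * (p * x ^+ 3 + q * (x * y ^+ 3)).
  have [X [Y [Z [h [h' [E [X0 X1 X2 X3] [Y0 Y1 Y2 Y3] [Z0 Z1 Z2 Z3]]]]]]] := eqX x y.
  have := congr1 (fun v : {poly k} => v`_0) E.
  by rewrite coefCM !ninth0 // ?c0 X0 Y0.
have T1 x y : p * (3%:R * (a * x) ^+ 2 * (b * y)) + q * (b * y * (d * y) ^+ 3)
    + (r * ((a * x) ^+ 2 * (d * y)) + s * (d * y) ^+ 4) * l =
    la * (r * (x ^+ 2 * y) + s * y ^+ 4).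
  have [X [Y [Z [h [h' [E [X0 X1 X2 X3] [Y0 Y1 Y2 Y3] [Z0 Z1 Z2 Z3]]]]]]] := eqX x y.
  have := congr1 (fun v : {poly k} => v`_1) E.
  rewrite coefCM !ninth1 // ?c0 !cE w1 X0 X1 Y0 Y1 Z1 => E'.
  by apply: fin; move: E' => /eqP; rewrite -subr_eq0 => /eqP <-; ring.
have laE : la = a ^+ 3.
  apply/esym/fin/(div p) => //; have := T0 1 0 => /eqP; rewrite -subr_eq0 => /eqP <-; ring.
have a0 : a != 0.
  by apply: contraNneq la0 => a0; rewrite laE a0 expr0n.
have da : d ^+ 3 = a ^+ 2.
  apply/fin/(div (q * a)); first exact: mulf_neq0.
  by have := T0 1 1 => /eqP; rewrite laE -subr_eq0 => /eqP <-; ring.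
have a2 : a ^+ 2 != 0 by rewrite expf_neq0.
have lin (u v w : k) : u = v -> w = u - v -> w = 0 by move=> -> ->; rewrite subrr.
have bs : q * b = (a - l * d) * s.
  have E : q * b * d ^+ 3 + s * d * l * d ^+ 3 - a * a ^+ 2 * s = 0.
    by apply: (lin _ _ _ (T1 0 1)); rewrite laE; ring.
  by apply/fin/(div (a ^+ 2)) => //; rewrite da in E; rewrite -E; ring.
have br : 3%:R * p * b = (a - l * d) * r.
  have E : 3%:R * p * a ^+ 2 * b + q * b * d ^+ 3 + (r * a ^+ 2 * d + s * d * d ^+ 3) * l
      - a * a ^+ 2 * (r + s) = 0.
    by apply: (lin _ _ _ (T1 1 1)); rewrite laE; ring.
  apply/fin/(div (a ^+ 2)) => //; rewrite da in E; rewrite bs in E; rewrite -E; ring.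
have b0 : b = 0.
  apply/(div _ _ det); transitivity (3%:R * p * b * s - q * b * r); first by ring.
  by rewrite br bs; ring.
have ald : a = l * d.
  apply/eqP; rewrite -subr_eq0; apply/eqP; apply: contrapT => /eqP ne.
  have r0 : r = 0 by apply/(div _ _ ne); rewrite -br b0 mulr0.
  have s0 : s = 0 by apply/(div _ _ ne); rewrite -bs b0 mulr0.
  by move: det; rewrite r0 s0 mulr0 mul0r subrr eqxx.
have d0 : d != 0.
  by apply: contraNneq a0 => d0; rewrite ald d0 mulr0.
have dl : d = l ^+ 2.
  have d2 : d ^+ 2 != 0 by rewrite expf_neq0.
  apply/fin/(div (d ^+ 2)) => //; apply: (lin _ _ _ da); rewrite ald; ring.
have al' : a = l ^+ 3 by rewrite ald dl; ring.
have e0 : e = 0.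
  have [X [Y [Z [h [h' [E [X0 X1 X2 X3] [Y0 Y1 Y2 Y3] [Z0 Z1 Z2 Z3]]]]]]] := eqX 1 1.
  have := congr1 (fun v : {poly k} => v`_2) E.
  have X1' : X`_1 = 0 by rewrite X1 b0 mul0r.
  rewrite coefCM !ninth2 // ?c0 ?cE // w1 X0 Y0 Y2 Z1 => E'.
  have nz : q * (3%:R * a * d ^+ 2) != 0 by rewrite !mulf_neq0 ?expf_neq0.
  apply: (div _ _ nz); apply: (lin _ _ _ E'); rewrite laE al' dl; ring.
have c'0 : c = 0.
  have [X [Y [Z [h [h' [E [X0 X1 X2 X3] [Y0 Y1 Y2 Y3] [Z0 Z1 Z2 Z3]]]]]]] := eqX 1 0.
  have := congr1 (fun v : {poly k} => v`_3) E.
  have X1' : X`_1 = 0 by rewrite X1 b0 mul0r.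
  have Y2' : Y`_2 = 0 by rewrite Y2 e0.
  rewrite coefCM !ninth3 // ?c0 ?cE // w1 X0 X3 Y0 Z1 => E'.
  have nz : p * (3%:R * a ^+ 2) != 0 by rewrite !mulf_neq0 ?expf_neq0.
  apply: (div _ _ nz); apply: (lin _ _ _ E'); rewrite laE al' dl; ring.
by split=> //; rewrite laE al' -exprM.
Qed.

End Jets.

Section GroupCalculation.
Variable k : closedFieldType.
Local Notation R := {mpoly k[3]}.
Local Notation x := ('X_ix : R).
Local Notation y := ('X_iy : R).
Local Notation z := ('X_iz : R).

Definition mono3 i j l : 'X_{1..3} := (U_(ix) *+ i + U_(iy) *+ j + U_(iz) *+ l)%MM.

Lemma mono3E i j l : 'X_[mono3 i j l] = x ^+ i * y ^+ j * z ^+ l.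
Proof. by rewrite /mono3 !mpolyXD -!mpolyXn. Qed.

Lemma mono3_ix i j l : mono3 i j l ix = i.
Proof. by rewrite /mono3 !mnmDE !mulmnE !mnm1E /=; lia. Qed.

Lemma mono3_iy i j l : mono3 i j l iy = j.
Proof. by rewrite /mono3 !mnmDE !mulmnE !mnm1E /=; lia. Qed.

Lemma mono3_iz i j l : mono3 i j l iz = l.
Proof. by rewrite /mono3 !mnmDE !mulmnE !mnm1E /=; lia. Qed.

Lemma ord3P (T : 'I_3 -> Prop) : T ix -> T iy -> T iz -> forall i, T i.
Proof.
move=> Tx Ty Tz [[|[|[|//]]] lt]; [move: Tx|move: Ty|move: Tz];
  by congr (T _); apply: val_inj.
Qed.

Lemma mono3_eta (m : 'X_{1..3}) : m = mono3 (m ix) (m iy) (m iz).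
Proof. by apply/mnmP; apply: ord3P; rewrite ?mono3_ix ?mono3_iy ?mono3_iz. Qed.

Lemma homog_expand e (r : R) : gradR k e r ->
  r = \sum_(i < (e %/ 3).+1) \sum_(j < (e %/ 2).+1)
        if (3 * i + 2 * j <= e)%N then
          r@_(mono3 i j (e - 3 * i - 2 * j)) *: (x ^+ i * y ^+ j * z ^+ (e - 3 * i - 2 * j))
        else 0.
Proof.
move=> Gr; apply/mpolyP => m; rewrite raddf_sum /=.
under eq_bigr => i _ do rewrite raddf_sum /=.
have term i j : (if (3 * i + 2 * j <= e)%N then
    r@_(mono3 i j (e - 3 * i - 2 * j)) *: (x ^+ i * y ^+ j * z ^+ (e - 3 * i - 2 * j))
    else 0)@_m = if [&& i == m ix, j == m iy & wdeg wt m == e] then r@_m else 0.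
  rewrite wdeg3; case: leqP => h; last first.
    by rewrite mcoeff0; case: and3P => // -[/eqP e1 /eqP e2 /eqP e3]; lia.
  rewrite -mono3E mcoeffZ mcoeffX; case: and3P => [[/eqP e1 /eqP e2 /eqP e3]|no].
    have -> : mono3 i j (e - 3 * i - 2 * j) = m.
      by rewrite [RHS]mono3_eta; congr mono3; lia.
    by rewrite eqxx mulr1.
  case: eqP => [E|_]; last by rewrite mulr0.
  by case: no; rewrite -E mono3_ix mono3_iy mono3_iz !eqxx; split=> //; apply/eqP; lia.
under eq_bigr => i _ do (under eq_bigr => j _ do rewrite term).
have [me|me] := eqVneq (wdeg wt m) e; last first.
  rewrite (dhomog_nemf_coeff Gr me) big1 // => i _; rewrite big1 // => j _.
  by case: ifP.
have lei : (m ix < (e %/ 3).+1)%N by move: me; rewrite wdeg3 ltnS leq_divRL //; lia.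
have lej : (m iy < (e %/ 2).+1)%N by move: me; rewrite wdeg3 ltnS leq_divRL //; lia.
rewrite (bigD1 (Ordinal lei)) //= [X in _ + X]big1 ?addr0 => [|i im]; last first.
  rewrite big1 // => j _; case: and3P => // -[/eqP e1 _ _].
  by case/eqP: im; apply: val_inj.
rewrite (bigD1 (Ordinal lej)) //= [X in _ + X]big1 ?addr0 ?eqxx // => j jm.
by case: and3P => // -[_ /eqP e1 _]; case/eqP: jm; apply: val_inj.
Qed.

Lemma homog1 (r : R) : gradR k 1 r -> exists l, r = l *: z.
Proof.
move/homog_expand => ->; rewrite !big_ord_recl !big_ord0 /=.
by exists r@_(mono3 0 0 1); rewrite !addr0 !expr0 !mul1r expr1.
Qed.

Lemma homog2 (r : R) : gradR k 2 r -> exists d e, r = d *: y + e *: z ^+ 2.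
Proof.
move/homog_expand => ->; rewrite !big_ord_recl !big_ord0 /=.
exists r@_(mono3 0 1 0), r@_(mono3 0 0 2).
by rewrite !addr0 !expr0 !mul1r expr1 mulr1 addrC.
Qed.

Lemma homog3 (r : R) : gradR k 3 r -> exists a b c, r = a *: x + b *: (y * z) + c *: z ^+ 3.
Proof.
move/homog_expand => ->; rewrite !big_ord_recl !big_ord0 /=.
exists r@_(mono3 1 0 0), r@_(mono3 0 1 1), r@_(mono3 0 0 3).
by rewrite !addr0 ?add0r !expr0 !mul1r !mulr1 !expr1; ring.
Qed.

Variables (f : R) (f9 : gradR k 9%N f) (p q r s : k).
Hypothesis C3 : at_z0 f = x * (p *: x ^+ 2 + q *: y ^+ 3).
Hypothesis C4 : at_z0 f^`M(iz) = y * (r *: x ^+ 2 + s *: y ^+ 3).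

Lemma mono3_eq i j l i' j' l' :
  (mono3 i j l == mono3 i' j' l') = [&& i == i', j == j' & l == l'].
Proof.
apply/eqP/and3P => [E|[/eqP-> /eqP-> /eqP->]//].
by split; apply/eqP; [have := congr1 (fun m : 'X_{1..3} => m ix) E
  | have := congr1 (fun m : 'X_{1..3} => m iy) E
  | have := congr1 (fun m : 'X_{1..3} => m iz) E];
  rewrite /= ?mono3_ix ?mono3_iy ?mono3_iz.
Qed.

Lemma at_z0_coef (g : R) i j : (at_z0 g)@_(mono3 i j 0) = g@_(mono3 i j 0).
Proof.
rewrite /at_z0 comp_mpolyEX raddf_sum [in RHS](mpolyE g) raddf_sum /=.
apply: eq_bigr => m _; rewrite !mcoeffZ; congr (_ * _).
rewrite comp_mpolyX !big_ord_recl big_ord0 mulr1 !(tnth_nth 0) /=.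
have -> : lift ord0 (lift ord0 ord0) = iz by apply: val_inj.
have -> : lift ord0 ord0 = iy by apply: val_inj.
have -> : ord0 = ix by apply: val_inj.
have [mz|mz] := eqVneq (m iz) 0%N.
  by rewrite mz expr0 mulr1 [in RHS](mono3_eta m) mz mono3E expr0 mulr1.
rewrite expr0n (negPf mz) !mulr0 mcoeff0 mcoeffX (mono3_eta m) mono3_eq.
by rewrite (negPf mz) !andbF.
Qed.

(** The hypotheses on f(x, y, 0) and f_z(x, y, 0) determine the coefficients of z ^ 0 and z ^ 1. *)
Lemma f_expand : exists al be ga (h : R), f =
  p%:MP * (x * x * x) + q%:MP * (x * (y * y * y))
  + (r%:MP * (x * x * y) + s%:MP * (y * y * y * y)) * z + al%:MP * (x * (y * y)) * (z * z)
  + (be%:MP * (x * x) + ga%:MP * (y * y * y)) * (z * z * z) + z * z * z * z * h.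
Proof.
have c3 i j : f@_(mono3 i j 0) =
    p *+ ((i == 3) && (j == 0))%N + q *+ ((i == 1) && (j == 3))%N.
  rewrite -at_z0_coef C3.
  have -> : x * (p *: x ^+ 2 + q *: y ^+ 3) = p *: 'X_[mono3 3 0 0] + q *: 'X_[mono3 1 3 0].
    by rewrite !mono3E -!mul_mpolyC; ring.
  by rewrite mcoeffD !mcoeffZ !mcoeffX !mono3_eq !andbT !(eq_sym _ i) !(eq_sym _ j) !mulr_natr.
have c4 i j : f@_(mono3 i j 1) =
    r *+ ((i == 2) && (j == 1))%N + s *+ ((i == 0) && (j == 4))%N.
  have -> : f@_(mono3 i j 1) = (f^`M(iz))@_(mono3 i j 0).
    rewrite mcoeff_mderiv mono3_iz; congr (f@_ _).
    by apply/mnmP; apply: ord3P; rewrite /mono3 !mnmDE !mulmnE !mnm1E /=; lia.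
  rewrite -at_z0_coef C4.
  have -> : y * (r *: x ^+ 2 + s *: y ^+ 3) = r *: 'X_[mono3 2 1 0] + s *: 'X_[mono3 0 4 0].
    by rewrite !mono3E -!mul_mpolyC; ring.
  by rewrite mcoeffD !mcoeffZ !mcoeffX !mono3_eq !andbT !(eq_sym _ i) !(eq_sym _ j) !mulr_natr.
have := homog_expand f9; rewrite !big_ord_recl !big_ord0 /= /bump /=.
rewrite !(c3, c4) /= !addr0 !add0r => fE.
pose co i j l := f@_(mono3 i j l).
have {}fE : f = co 0 0 9 *: (x ^+ 0 * y ^+ 0 * z ^+ 9) + (co 0 1 7 *: (x ^+ 0 * y ^+ 1 * z ^+ 7) +
    (co 0 2 5 *: (x ^+ 0 * y ^+ 2 * z ^+ 5) + (co 0 3 3 *: (x ^+ 0 * y ^+ 3 * z ^+ 3) +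
     s *: (x ^+ 0 * y ^+ 4 * z ^+ 1)))) +
  (co 1 0 6 *: (x ^+ 1 * y ^+ 0 * z ^+ 6) + (co 1 1 4 *: (x ^+ 1 * y ^+ 1 * z ^+ 4) +
    (co 1 2 2 *: (x ^+ 1 * y ^+ 2 * z ^+ 2) + q *: (x ^+ 1 * y ^+ 3 * z ^+ 0))) +
  (co 2 0 3 *: (x ^+ 2 * y ^+ 0 * z ^+ 3) + r *: (x ^+ 2 * y ^+ 1 * z ^+ 1) +
   p *: (x ^+ 3 * y ^+ 0 * z ^+ 0))) := fE.
clearbody co.
exists (co 1 2 2), (co 2 0 3), (co 0 3 3).
exists (co 0 0 9 *: z ^+ 5 + co 0 1 7 *: (y * z ^+ 3) +
  co 0 2 5 *: (y ^+ 2 * z) + co 1 0 6 *: (x * z ^+ 2) + co 1 1 4 *: (x * y)).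
rewrite fE -!mul_mpolyC {fE}.
move: (co 0 0 9)%:MP (co 0 1 7)%:MP (co 0 2 5)%:MP (co 0 3 3)%:MP (co 1 0 6)%:MP
  (co 1 1 4)%:MP (co 1 2 2)%:MP (co 2 0 3)%:MP p%:MP q%:MP r%:MP s%:MP x y z.
by clear; move=> *; ring.
Qed.


End GroupCalculation.

Definition alg_rmorph (k : fieldType) (B : comAlgType k) (u : B -> B) (ul : linear u)
    (um : monoid_morphism u) : {rmorphism B -> B} :=
  HB.pack u (GRing.isMonoidMorphism.Build _ _ _ um)
    (GRing.isZmodMorphism.Build _ _ _ (zmod_morphism_linear ul)).

Section GradedHom.
Variable k : closedFieldType.
Local Notation R := {mpoly k[3]}.
Local Notation x := ('X_ix : R).
Local Notation y := ('X_iy : R).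
Local Notation z := ('X_iz : R).
Variables (f : R) (f9 : gradR k 9%N f) (p q r s : k).
Hypothesis C3 : at_z0 f = x * (p *: x ^+ 2 + q *: y ^+ 3).
Hypothesis C4 : at_z0 f^`M(iz) = y * (r *: x ^+ 2 + s *: y ^+ 3).
Hypothesis k0 : char0 k.
Hypotheses (p0 : p != 0) (q0 : q != 0) (det : (3%:R * p) * s - r * q != 0).
Hypothesis f0 : f <> 0.
Variable n : nat.
Hypotheses (n_gt1 : (1 < n)%N) (n3 : ~~ (3 %| n)%N).
Local Notation A := (cyclic_cover f n).
Local Notation G := (cover_grading n_gt1 f9).
Local Notation iota := (@cover_iota k f n).
Local Notation w := (cover_w f n).

Let n_gt0 : (0 < n)%N := ltnW n_gt1.

Lemma cover_scaleE (c : k) (a : A) : c *: a = iota c%:MP * a.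
Proof. by []. Qed.

Lemma cover_part_R e a : G (n * e)%N a -> exists u, gradR k e u /\ a = iota u.
Proof.
move=> Ga; have [->|a0] := pselect (a = 0).
  by exists 0; rewrite rmorph0; split=> //; exact: gpart0.
have [u [j [e' [jn aE Gu eE]]]] := cover_part n3 Ga a0.
have j0 : j = 0%N.
  rewrite -(modn_small jn) -[RHS](mod0n n); apply: (modn9_inj n3).
  have := congr1 (fun x => x %% n)%N eE.
  by rewrite ![(n * _)%N]mulnC modnMDl modnMl muln0 mod0n.
exists u; rewrite aE j0 expr0 mulr1; split=> //.
move: eE; rewrite j0 muln0 addn0 => /eqP; rewrite eqn_pmul2l // => /eqP <-.
exact: Gu.
Qed.

Lemma cover_part_w a : G 9%N a -> exists mu, a = mu *: w.
Proof.
move=> Ga; have [->|a0] := pselect (a = 0); first by exists 0; rewrite scale0r.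
have [u [j [e [jn aE Gu eE]]]] := cover_part n3 Ga a0.
have j1 : j = 1%N.
  rewrite -(modn_small jn) -[RHS](modn_small n_gt1); apply: (modn9_inj n3).
  have := congr1 (fun x => x %% n)%N eE.
  by rewrite ![(n * _)%N]mulnC modnMDl muln1.
have e0 : e = 0%N.
  by move: eE; rewrite j1; case: (e) => // e''; move: n_gt0; lia.
move: Gu; rewrite e0 => /R_const_part[mu uE]; exists mu.
by rewrite aE j1 expr1 uE cover_scaleE.
Qed.

Lemma cover_hom_ext (phi psi : {rmorphism A -> A}) :
  (forall c : k, phi (iota c%:MP) = psi (iota c%:MP)) ->
  (forall i, phi (iota 'X_i) = psi (iota 'X_i)) -> phi w = psi w -> phi =1 psi.
Proof.
move=> hc hX hw a; have [u ->] := cover_gen n_gt1 a.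
rewrite !rmorph_sum; apply: eq_bigr => i _; rewrite !rmorphM !rmorphXn hw; congr (_ * _).
exact: (mpoly_rmorph_ext (u := phi \o iota) (v := psi \o iota)).
Qed.

(** Restriction to the line through (a, b, 0) parallel to the z-axis. *)
Definition eval_xy (a b : k) : {rmorphism R -> {poly k}} :=
  mmap polyC (tnth [tuple a%:P; b%:P; 'X]).

Lemma eval_xyC a b c : eval_xy a b c%:MP = c%:P.
Proof. exact: mmapC. Qed.

Lemma eval_xyX a b : [/\ eval_xy a b x = a%:P, eval_xy a b y = b%:P & eval_xy a b z = 'X].
Proof. by rewrite /eval_xy /= !mmapX !mmap1U. Qed.

Lemma rmorph_ninth (u : {rmorphism R -> {poly k}}) al be ga h : (forall c, u c%:MP = c%:P) ->
  u (p%:MP * (x * x * x) + q%:MP * (x * (y * y * y))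
  + (r%:MP * (x * x * y) + s%:MP * (y * y * y * y)) * z + al%:MP * (x * (y * y)) * (z * z)
  + (be%:MP * (x * x) + ga%:MP * (y * y * y)) * (z * z * z) + z * z * z * z * h) =
  ninth p q r s al be ga (u x) (u y) (u z) (u h).
Proof. by move=> uC; rewrite !(rmorphD, rmorphM) !uC. Qed.

Lemma bezout_root (l mu : k) : l != 0 -> mu != 0 -> mu ^+ n = l ^+ 9 ->
  exists t : k, [/\ t != 0, t ^+ n = l & t ^+ 9 = mu].
Proof.
move=> l0 mu0 lm; have := coprime_n9 n3; rewrite /coprime => /eqP g1.
have [u v uv _] := @egcdnP n 9 n_gt0; rewrite g1 in uv.
exists (l ^+ u / mu ^+ v); split.
- by rewrite mulf_neq0 ?invr_eq0 ?expf_neq0.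
- rewrite expr_div_n -!exprM (mulnC v) (exprM mu) lm -exprM (mulnC 9) uv exprD expr1.
  by rewrite mulrC mulrA mulVf ?mul1r // expf_neq0.
- rewrite expr_div_n -!exprM (mulnC u) (exprM l) -lm -exprM (mulnC n) uv exprD expr1.
  by rewrite mulrC mulrA mulVf ?mul1r // expf_neq0.
Qed.

(** The pieces of degrees 3n, 2n and n are those of degrees 3, 2 and 1 of R, and the piece of
    degree 9 is spanned by w. So phi is a substitution in R that multiplies f by the constant
    mu ^ n, where phi w = mu w. *)
Lemma graded_hom_torus (phi : {rmorphism A -> A}) :
  (forall c : k, phi (iota c%:MP) = iota c%:MP) -> injective phi ->
  (forall i a, G i a -> G i (phi a)) ->
  exists t : k, t != 0 /\ forall a, phi a = phi_fun G t a.
Proof.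
move=> phiC phi_inj phiG.
have var i : exists u, gradR k (wt i) u /\ phi (iota 'X_i) = iota u.
  by apply: cover_part_R; apply: phiG; apply: cover_iota_part; exact: gradR_var.
have [_ [/homog3[a [b [c ->]]] phix]] := var ix.
have [_ [/homog2[d [e ->]] phiy]] := var iy.
have [_ [/homog1[l ->] phiz]] := var iz.
have [mu phiw] := cover_part_w (phiG _ _ (cover_w_part f9 n_gt1)).
pose lq := [tuple a *: x + b *: (y * z) + c *: z ^+ 3; d *: y + e *: z ^+ 2; l *: z].
have phi_comp u : phi (iota u) = iota (u \mPo lq).
  apply: (mpoly_rmorph_ext (u := phi \o iota) (v := iota \o comp_mpoly lq)) => [c'|].
    by rewrite /= phiC comp_mpolyC.
  by apply: ord3P; rewrite /= comp_mpolyXU.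
have mu0 : mu != 0.
  apply/eqP => mu0; apply: (@cover_w_neq0 k f n n_gt1 f0 1); rewrite expr1.
  by apply: phi_inj; rewrite phiw mu0 scale0r rmorph0.
have iE : iota (f \mPo lq) = iota ((mu ^+ n)%:MP * f).
  rewrite -(phi_comp f) -[iota f]opprK -(cover_wn f n_gt1) rmorphN rmorphXn phiw cover_scaleE.
  by rewrite exprMn cover_wn // mulrN opprK rmorphM -rmorphXn /= -rmorphXn.
have fE : f \mPo lq = (mu ^+ n)%:MP * f.
  apply/eqP; rewrite -subr_eq0; apply/eqP; apply: (cover_iota_inj n_gt1 f0).
  by rewrite raddfB /= iE subrr.
have [al [be [ga [h fexp]]]] := f_expand f9 C3 C4.
have three : (3%:R != 0 :> k) by exact: k0.
have [|[aE dE b0 e0 c0] la] := ninth_jets (al := al) (be := be) (ga := ga) (a := a) (b := b) (c := c)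
  (d := d) (e := e) (l := l) det p0 q0 three (expf_neq0 n mu0).
  move=> x0 y0; have [ex ey ez] := eval_xyX x0 y0.
  exists (eval_xy x0 y0 (h \mPo lq)), (eval_xy x0 y0 h).
  have := congr1 (eval_xy x0 y0) fE; rewrite {1}fexp [in RHS]fexp rmorphM eval_xyC.
  rewrite (rmorph_ninth _ _ _ _ (eval_xyC x0 y0)) ex ey ez.
  rewrite -[LHS]/((eval_xy x0 y0 \o comp_mpoly lq) _) rmorph_ninth => [|c']; last first.
    by rewrite /= comp_mpolyC eval_xyC.
  rewrite /= !comp_mpolyXU /= -!mul_mpolyC.
  rewrite !(rmorphD, rmorphM, rmorphXn) /= !eval_xyC ex ey ez => <-.
  by congr ninth; rewrite ?rmorphM //; ring.
have l0 : l != 0.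
  by apply: contraNneq (expf_neq0 n mu0) => l0; rewrite la l0 expr0n.
have [t [t0 tn t9]] := bezout_root l0 mu0 la; exists t; split=> // a'.
pose psi := alg_rmorph (phi_fun_linear G t) (phi_fun_monoid_morphism G t).
have part i u : G i u -> psi u = t ^+ i *: u by exact: phi_fun_part.
apply: (cover_hom_ext (phi := phi) (psi := psi)) => [c'||].
- have G0 := cover_iota_part f9 n_gt1 (R_const c'); rewrite muln0 in G0.
  by rewrite phiC (part _ _ G0) expr0 scale1r.
- have Gi i : G (n * wt i)%N (iota 'X_i) by apply: cover_iota_part; exact: gradR_var.
  apply: ord3P; rewrite (part _ _ (Gi _)) exprM tn ?phix ?phiy ?phiz cover_scaleE -rmorphM mul_mpolyC.
  + by rewrite aE b0 c0 !scale0r !addr0.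
  + by rewrite dE e0 scale0r addr0.
  + by rewrite expr1.
- by rewrite phiw (part _ _ (cover_w_part f9 n_gt1)) t9.
Qed.

End GradedHom.

(** * Homogeneous components of a derivation *)

Section DerivationComponents.
Variables (B : comNzRingType) (G : grading B).

Lemma derivation_homog (D : B -> B) : {morph D : a b / a + b} ->
  (forall i j a b, G i a -> G j b -> D (a * b) = D a * b + a * D b) -> derivation D.
Proof.
move=> Da Dh; split=> // a b.
have D0 : D 0 = 0 by apply: (addrI (D 0)); rewrite -Da !addr0.
have Ds I (r : seq I) (P : pred I) F :
    D (\sum_(i <- r | P i) F i) = \sum_(i <- r | P i) D (F i) by exact: (big_morph D Da D0).
have aE := gcomp_sum G a; have bE := gcomp_sum G b.
set A := gbound G a in aE; set N := gbound G b in bE.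
transitivity (\sum_(i < A) \sum_(j < N)
    (D (gcomp G i a) * gcomp G j b + gcomp G i a * D (gcomp G j b))).
  rewrite {1}aE {1}bE big_distrlr /= Ds; apply: eq_bigr => i _.
  by rewrite Ds; apply: eq_bigr => j _; exact: (Dh _ _ _ _ (gcompP G i a) (gcompP G j b)).
rewrite [in D a]aE [in X in _ + X]aE [in X in X + _]bE [in D b]bE !Ds !big_distrlr -big_split /=.
by apply: eq_bigr => i _; rewrite -big_split.
Qed.

(** The map extending a family of additive maps on the graded pieces. *)
Section Pieces.
Variable T : nat -> B -> B.
Hypothesis TD : forall i, {morph T i : a b / a + b}.

Definition piecewise a := \sum_(i < gbound G a) T i (gcomp G i a).

Let T0 i : T i 0 = 0.
Proof. by apply: (addrI (T i 0)); rewrite -TD !addr0. Qed.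

Lemma piecewise_big a N : (gbound G a <= N)%N -> piecewise a = \sum_(i < N) T i (gcomp G i a).
Proof.
move=> aN; rewrite /piecewise -(sum_trunc (fun i => T i (gcomp G i a)) aN).
apply: eq_bigr => i _; case: ifP => // h.
by rewrite /gcomp h T0.
Qed.

Lemma piecewiseD : {morph piecewise : a b / a + b}.
Proof.
move=> a b; pose N := maxn (gbound G (a + b)) (maxn (gbound G a) (gbound G b)).
have [h1 h2 h3] : [/\ gbound G (a + b) <= N, gbound G a <= N & gbound G b <= N]%N.
  by rewrite !leq_max !leqnn ?orbT.
rewrite (piecewise_big h1) (piecewise_big h2) (piecewise_big h3) -big_split.
by apply: eq_bigr => i _; rewrite gcompD TD.
Qed.

Lemma piecewise_part i a : G i a -> piecewise a = T i a.
Proof.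
move=> Ga; pose N := maxn i.+1 (gbound G a).
rewrite (@piecewise_big a N) ?leq_maxr //.
have iN : (i < N)%N by rewrite leq_max ltnSn.
rewrite (bigD1 (Ordinal iN)) //= (gcomp_part _ Ga) eqxx big1 ?addr0 // => j ji.
rewrite (gcomp_part _ Ga); case: eqP => // e.
by case/eqP: ji; apply: val_inj.
Qed.

End Pieces.

Definition euler := piecewise (fun i a => i%:R * a).

Lemma eulerD : {morph euler : a b / a + b}.
Proof. by apply: piecewiseD => i a b; rewrite mulrDr. Qed.

Lemma euler_part i a : G i a -> euler a = i%:R * a.
Proof. by apply: piecewise_part => j u v; rewrite mulrDr. Qed.

Lemma euler_derivation : derivation euler.
Proof.
apply: derivation_homog => [|i j a b Ga Gb]; first exact: eulerD.
by rewrite (euler_part (gpartM Ga Gb)) (euler_part Ga) (euler_part Gb) natrD; ring.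
Qed.

Lemma euler_gcomp i a : gcomp G i (euler a) = i%:R * gcomp G i a.
Proof.
rewrite /euler /piecewise gcomp_sumr [in RHS](gcomp_sum G a) gcomp_sumr mulr_sumr.
apply: eq_bigr => j _; have Gj := gcompP G j a.
rewrite (gcomp_part i Gj) -[j%:R * _]/(j%:R * gcomp G j a).
have Gj' : G j (j%:R * gcomp G j a) by rewrite -[j in G j]add0n; apply: gpartM => //; exact: gpart_natr.
by rewrite (gcomp_part i Gj'); case: eqP => [->|_]; rewrite ?mulr0.
Qed.

Variable D : B -> B.
Hypothesis Dd : derivation D.

(** The homogeneous component of D of degree b - c. *)
Definition der_comp b c := piecewise (fun i a =>
  if (c <= i + b)%N then gcomp G (i + b - c) (D a) else 0).

Lemma der_compD b c : {morph der_comp b c : u v / u + v}.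
Proof.
by apply: piecewiseD => i u v; case: ifP; rewrite ?addr0 // derD // gcompD.
Qed.

Lemma der_comp_part b c i a : G i a ->
  der_comp b c a = if (c <= i + b)%N then gcomp G (i + b - c) (D a) else 0.
Proof.
by apply: piecewise_part => j u v; case: ifP; rewrite ?addr0 // derD // gcompD.
Qed.

Lemma der_comp_shift b c : shift G b c (der_comp b c).
Proof.
move=> e a Ga; rewrite (der_comp_part b c Ga); case: ifP => h; last by left.
by right; exists (e + b - c)%N; rewrite subnK //; split=> //; exact: gcompP.
Qed.

Lemma der_comp_derivation b c : derivation (der_comp b c).
Proof.
apply: derivation_homog => [|i j u v Gu Gv]; first exact: der_compD.
have half i' j' u' v' : G i' u' -> G j' v' ->
    (if (c <= i' + j' + b)%N then gcomp G (i' + j' + b - c) (u' * D v') else 0) =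
    u' * der_comp b c v'.
  move=> Gu' Gv'; rewrite (der_comp_part b c Gv').
  case: (leqP c (j' + b)) => h.
    have -> : (c <= i' + j' + b)%N by lia.
    by rewrite (_ : i' + j' + b - c = i' + (j' + b - c))%N ?gcompMl //; lia.
  rewrite mulr0; case: ifP => // h'; apply: gcompMl_lt Gu' _; lia.
rewrite (der_comp_part b c (gpartM Gu Gv)) derM // gcompD.
have := half _ _ _ _ Gu Gv; have := half _ _ _ _ Gv Gu; rewrite (addnC j i) !(mulrC v).
by case: ifP => _ <- <- //; rewrite addr0.
Qed.

End DerivationComponents.

(** * Automorphisms of A *)

Section Automorphism.
Variable k : closedFieldType.
Local Notation R := {mpoly k[3]}.
Hypothesis k0 : char0 k.
Variables (f : R) (f9 : gradR k 9%N f) (C1 : irreducible_elt f).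
Hypothesis C2 : at_least_two_singular_points f9 C1.
Variable n : nat.
Hypotheses (n_gt1 : (1 < n)%N) (n3 : ~~ (3 %| n)%N).
Local Notation A := (cyclic_cover f n).
Local Notation G := (cover_grading n_gt1 f9).
Local Notation iota := (@cover_iota k f n).
Local Notation w := (cover_w f n).

Let n_gt0 : (0 < n)%N := ltnW n_gt1.
Let f0 : f <> 0. Proof. by case: (C1) => /eqP. Qed.
Let dA : integral A := cover_integral f9 n_gt1 n3 f0.
Let A0 : char0 A := cover_char0 k0 n_gt1 f0.

Lemma cover_der_gen (D : A -> A) : derivation D -> (forall c : k, D (iota c%:MP) = 0) ->
  (forall i, D (iota 'X_i) = 0) -> D w = 0 -> forall a, D a = 0.
Proof.
move=> Dd Dc DX Dw; apply: (cover_der_eq0 n_gt1 Dd) => // r.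
rewrite (mpolyE r) rmorph_sum (der_sum Dd) big1 // => m _.
rewrite -mul_mpolyC rmorphM; apply: (derM0 Dd); first exact: Dc.
rewrite mpolyXE_id rmorph_prod.
apply: (big_ind (fun a => D a = 0)) => [|a b|i _]; first exact: der1.
  exact: derM0.
by rewrite rmorphXn; exact: (der_exp0 Dd _ (DX i)).
Qed.

Variables (phi phi' : {rmorphism A -> A}).
Hypotheses (phiC : forall c : k, phi (iota c%:MP) = iota c%:MP).
Hypotheses (phiK : cancel phi phi') (phi'K : cancel phi' phi).

(** The derivation whose eigenspace for i is the image of the graded piece of degree i. *)
Definition conj_euler (a : A) : A := phi (euler G (phi' a)).

Lemma conj_euler_derivation : derivation conj_euler.
Proof.
have [eD eM] := euler_derivation G.
split=> a b; rewrite /conj_euler; first by rewrite rmorphD eD rmorphD.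
by rewrite rmorphM eM rmorphD !rmorphM !phi'K.
Qed.

Lemma conj_euler_eigen i a : G i a -> conj_euler (phi a) = i%:R * phi a.
Proof. by move=> Ga; rewrite /conj_euler phiK (euler_part Ga) rmorphM rmorph_nat. Qed.

Lemma eigen_conj_euler i a : conj_euler a = i%:R * a -> G i (phi' a).
Proof.
move=> aE; have eE : euler G (phi' a) = i%:R * phi' a.
  by apply: (can_inj phiK); rewrite rmorphM rmorph_nat phi'K.
rewrite (_ : phi' a = gcomp G i (phi' a)); first exact: gcompP.
apply: (gcomp_ext (G := G)) => j; rewrite (gcomp_part _ (gcompP G i (phi' a))).
case: eqP => [->//|ji].
have E : j%:R * gcomp G j (phi' a) = i%:R * gcomp G j (phi' a).
  rewrite -euler_gcomp eE.
  have Gi : G 0%N i%:R by exact: gpart_natr.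
  by rewrite -{1}[j]add0n (gcompMl _ _ Gi).
have /dA[] : (j%:R - i%:R) * gcomp G j (phi' a) = 0 by rewrite mulrBl E subrr.
  move=> /eqP; rewrite subr_eq0 => /eqP ij; case: ji.
  exact: (char0_natr_inj A0 ij).
by [].
Qed.

Local Notation E := conj_euler.
Local Notation Ed := conj_euler_derivation.

Lemma phi_expand a : exists N (c : nat -> A), (forall l, G l (c l)) /\
  a = \sum_(l < N) phi (c l).
Proof.
have [N [c [Gc cE]]] := gpart_gen G (phi' a).
by exists N, c; split=> //; rewrite -rmorph_sum -cE phi'K.
Qed.

(** The highest component of a diagonalizable derivation is locally nilpotent: if a is
    a sum of eigenvectors of eigenvalues less than N, the top component of
    (E - (N - 1)) ... (E - 1) E a is the N-th iterate of the component of E. *)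
Lemma top_comp_nilpotent b : (0 < b)%N -> (forall b' a, (b < b')%N -> der_comp G E b' 0 a = 0) ->
  loc_nilpotent (der_comp G E b 0).
Proof.
move=> b_gt0 top; pose T := der_comp G E b 0.
have Td : derivation T := der_comp_derivation G Ed b 0.
have step N j a : (forall i, (N < i)%N -> gcomp G i a = 0) ->
    (forall i, (N + b < i)%N -> gcomp G i (E a - j%:R * a) = 0) /\
    gcomp G (N + b) (E a - j%:R * a) = T (gcomp G N a).
  move=> aN; have comp i : (N + b <= i)%N -> gcomp G i (E a - j%:R * a) =
      if i == (N + b)%N then T (gcomp G N a) else 0.
    move=> le; have ia : gcomp G i a = 0 by apply: aN; lia.
    have -> : gcomp G i (E a - j%:R * a) = gcomp G i (E a).
      rewrite gcompD gcompN -{2}[i]add0n (gcompMl _ _ (gpart_natr G j)) ia.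
      by rewrite mulr0 subr0.
    have aE : a = \sum_(l < N.+1) gcomp G l a.
      apply: (gcomp_ext (G := G)) => l.
      rewrite (gcompE N.+1 (c := fun l => gcomp G l a)) => [|l']; last exact: gcompP.
      by case: ltnP => // /aN.
    rewrite {1}aE (der_sum Ed) gcomp_sumr.
    have term (l : 'I_N.+1) : gcomp G i (E (gcomp G l a)) =
        if i == (l + b)%N then T (gcomp G l a) else 0.
      have lN : (l <= N)%N by rewrite -ltnS.
      case: eqP => [->|ne].
        by rewrite /T (der_comp_part Ed b 0 (gcompP G l a)) /= subn0.
      have := top (i - l)%N (gcomp G l a); rewrite (der_comp_part Ed _ 0 (gcompP G l a)) /=.
      by rewrite subn0 subnKC; [apply; lia | lia].
    under eq_bigr => l _ do rewrite term.
    rewrite big_ord_recr /= [X in X + _]big1 ?add0r // => l _.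
    by case: eqP => // e; have := ltn_ord l; lia.
  split; last by rewrite comp // eqxx.
  by move=> i lt; rewrite comp ?(ltnW lt) //; case: eqP => // e; lia.
have hom i a : G i a -> exists m, iter m T a = 0.
  move=> Ga; have [N [c [Gc aE]]] := phi_expand a; exists N.
  pose P m := \sum_(l < N) (\prod_(j < m) (l%:R - j%:R)) * phi (c l).
  have PS m : P m.+1 = E (P m) - m%:R * P m.
    rewrite /P (der_sum Ed) mulr_sumr -sumrB; apply: eq_bigr => l _.
    have prod0 : E (\prod_(j < m) (l%:R - j%:R)) = 0.
      apply: (big_ind (fun a => E a = 0)) => [|u v u0 v0|j _]; first exact: (der1 Ed).
        exact: (derM0 Ed u0 v0).
      by rewrite (derB Ed) !(der_natr Ed) subrr.
    by rewrite big_ord_recr /= (derMl Ed) // (conj_euler_eigen (Gc l)); ring.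
  have PN : P N = 0.
    rewrite /P big1 // => l _; rewrite (bigD1 l) //= subrr !mul0r //.
  have key m : (forall i', (i + m * b < i')%N -> gcomp G i' (P m) = 0) /\
      gcomp G (i + m * b) (P m) = iter m T a.
    elim: m => [|m [IH1 IH2]].
      have -> : P 0%N = a.
        by rewrite aE; apply: eq_bigr => l _; rewrite big_ord0 mul1r.
      rewrite mul0n addn0 (gcomp_part _ Ga) eqxx; split=> // i' lt.
      by rewrite (gcomp_part _ Ga) gtn_eqF.
    have [h1 h2] := step _ m _ IH1; rewrite PS mulSn (addnC b) addnA.
    by split=> //; rewrite h2 IH2.
  by have [_] := key N; rewrite PN gcomp0 => <-.
move=> a; have [m mP] : exists m, forall i : 'I_(gbound G a), iter m T (gcomp G i a) = 0.
  have [m mP] := choice (fun i : 'I_(gbound G a) => hom _ _ (gcompP G i a)).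
  exists (\max_i m i)%N => i; exact: (iter_der_ge0 Td (mP i) (leq_bigmax _)).
by exists m; rewrite (gcomp_sum G a) (iter_der_sum Td) big1.
Qed.

Lemma conj_euler_const (c : k) : E (iota c%:MP) = 0.
Proof.
have G0 := cover_iota_part f9 n_gt1 (R_const c); rewrite muln0 in G0.
by rewrite -phiC (conj_euler_eigen G0) mul0r.
Qed.

(** Since A has no nonzero homogeneous locally nilpotent derivation, the components of negative
    degree vanish, and so does the highest one if its degree is positive. *)
Lemma conj_euler_graded i a : G i a -> G i (E a).
Proof.
have down c a' : (0 < c)%N -> der_comp G E 0 c a' = 0.
  move=> c0; have Td := der_comp_derivation G Ed 0 c; have Ts := der_comp_shift (G := G) Ed 0 c.
  refine (cover_rigid k0 C2 n3 Td _ Ts a') => u.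
  exists (gbound G u); rewrite {2}(gcomp_sum G u) (iter_der_sum Td) big1 // => j _.
  case: (shift_iter (gbound G u) Td Ts (gcompP G j u)) => // -[e [+ _]].
  by have := ltn_ord j; rewrite muln0 addn0; nia.
have up b a' : (0 < b)%N -> der_comp G E b 0 a' = 0.
  move=> b0; apply: contrapT => nz.
  pose T b' := `[< (0 < b')%N /\ exists u, der_comp G E b' 0 u <> 0 >].
  have exT : exists b', T b' by exists b; apply/asboolP; split=> //; exists a'.
  have [M bounded] : exists M, forall b', T b' -> (b' <= M)%N.
    have gen e u : exists M, forall b', (M <= b')%N -> gcomp G (e + b') (E u) = 0.
      have [M Mu] := gcomp_bounded G (E u); exists M => b' h; apply: Mu.
      exact: leq_trans h (leq_addl _ _).
    have [Mw Pw] := gen 9%N w.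
    have [MX PX] := choice (fun i : 'I_3 => gen (n * wt i)%N (iota 'X_i)).
    exists (Mw + \sum_i MX i)%N => b' /asboolP[_ [u nu]]; rewrite leqNgt; apply/negP => lt.
    apply: nu; apply: (cover_der_gen (der_comp_derivation G Ed b' 0)) => [c|j|].
    - have G0 := cover_iota_part f9 n_gt1 (R_const c).
      by rewrite (der_comp_part Ed _ _ G0) /= conj_euler_const gcomp0.
    - have Gj := cover_iota_part f9 n_gt1 (gradR_var k j).
      rewrite (der_comp_part Ed _ _ Gj) /= subn0; apply: PX.
      by move: lt; rewrite (bigD1 j) //=; lia.
    - rewrite (der_comp_part Ed _ _ (cover_w_part f9 n_gt1)) /= subn0; apply: Pw; lia.
  have [m /asboolP[m0 [u nu]] mmax] := ex_maxnP exT bounded.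
  apply: nu; refine (cover_rigid k0 C2 n3 (der_comp_derivation G Ed m 0) _ (der_comp_shift Ed m 0) u).
  apply: top_comp_nilpotent => // b' v lt; apply: contrapT => nv.
  have : T b' by apply/asboolP; split; [exact: leq_trans m0 (ltnW lt) | exists v].
  by move/mmax; rewrite leqNgt lt.
move=> Ga; rewrite (_ : E a = gcomp G i (E a)); first exact: gcompP.
apply: (gcomp_ext (G := G)) => j; rewrite (gcomp_part _ (gcompP G i (E a))).
case: eqP => [->//|/eqP ji]; have [lt|gt|e] := ltngtP j i; last by rewrite e eqxx in ji.
  have := down (i - j)%N a; rewrite (der_comp_part Ed _ _ Ga) addn0 leq_subr subKn; last exact: ltnW.
  by apply; rewrite subn_gt0.
have := up (j - i)%N a; rewrite (der_comp_part Ed _ _ Ga) /= subn0 subnKC; last exact: ltnW.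
by apply; rewrite subn_gt0.
Qed.

(** Both gradings are therefore compatible: the pieces of one are sums of their
    intersections with the pieces of the other. *)
Lemma compatible_gradings i N (c : nat -> A) : (forall l, G l (c l)) ->
  G i (\sum_(l < N) phi (c l)) -> forall l, (l < N)%N -> G i (phi (c l)).
Proof.
move=> Gc Ga l lN.
rewrite (_ : phi (c l) = gcomp G i (phi (c l))); first exact: gcompP.
apply: (gcomp_ext (G := G)) => m; rewrite (gcomp_part _ (gcompP G i (phi (c l)))).
case: eqP => [->//|mi].
have Ecomp u : E (gcomp G m u) = gcomp G m (E u).
  rewrite [in RHS](gcomp_sum G u) (der_sum Ed) gcomp_sumr.
  rewrite [in LHS](gcomp_sum G u) gcomp_sumr (der_sum Ed); apply: eq_bigr => j _.
  rewrite (gcomp_part _ (gcompP G j u)) (gcomp_part _ (conj_euler_graded (gcompP G j u))).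
  by case: eqP => // _; exact: (der0 Ed).
have Gpsi l' : G l' (phi' (gcomp G m (phi (c l')))).
  apply: eigen_conj_euler; rewrite Ecomp (conj_euler_eigen (Gc l')).
  by rewrite -{1}[m]add0n (gcompMl _ _ (gpart_natr G l')).
have sum0 : \sum_(l < N) phi' (gcomp G m (phi (c l))) = 0.
  rewrite -rmorph_sum -gcomp_sumr (gcomp_part _ Ga).
  by case: eqP => // _; rewrite rmorph0.
apply: (can_inj phi'K); rewrite rmorph0.
exact: (gpart_indep Gpsi sum0 lN).
Qed.

End Automorphism.

(** * The automorphism group *)

Lemma coprime_exp_inj (F : fieldType) m n (c d : F) : (0 < m)%N -> coprime m n -> c != 0 -> d != 0 ->
  c ^+ m = d ^+ m -> c ^+ n = d ^+ n -> c = d.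
Proof.
move=> m0 /eqP mn c0 d0 em en; have [a b ab _] := @egcdnP m n m0; rewrite mn in ab.
have E (e : F) : e != 0 -> e = (e ^+ m) ^+ a / (e ^+ n) ^+ b.
  move=> e0; rewrite -!exprM -(mulnC a) ab exprD expr1 (mulnC n).
  by rewrite [LHS](_ : _ = e ^+ (b * n) * e / e ^+ (b * n)) // mulrAC divff ?mul1r ?expf_neq0.
by rewrite (E c c0) (E d d0) em en.
Qed.

Section AutomorphismGroup.
Variable k : closedFieldType.
Local Notation R := {mpoly k[3]}.
Local Notation x := ('X_ix : R).
Local Notation y := ('X_iy : R).
Variables (f : R) (f9 : gradR k 9%N f) (C1 : irreducible_elt f).
Hypothesis C2 : at_least_two_singular_points f9 C1.
Variables (p q r s : k).
Hypothesis C3 : at_z0 f = x * (p *: x ^+ 2 + q *: y ^+ 3).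
Hypothesis C4 : at_z0 f^`M(iz) = y * (r *: x ^+ 2 + s *: y ^+ 3).
Hypothesis k0 : char0 k.
Hypotheses (p0 : p != 0) (q0 : q != 0) (det : (3%:R * p) * s - r * q != 0).
Variable n : nat.
Hypotheses (n_gt1 : (1 < n)%N) (n3 : ~~ (3 %| n)%N).
Local Notation A := (cyclic_cover f n).
Local Notation G := (cover_grading n_gt1 f9).
Local Notation iota := (@cover_iota k f n).
Local Notation w := (cover_w f n).

Let f0 : f <> 0. Proof. by case: (C1) => /eqP. Qed.

Lemma cover_z_neq0 : iota 'X_iz <> 0.
Proof.
move=> /(cover_iota_inj n_gt1 f0) /(congr1 (mcoeff U_(iz))) /eqP.
by rewrite mcoeffX eqxx mcoeff0 oner_eq0.
Qed.

Lemma cover_z_part : G n (iota 'X_iz).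
Proof. by have := cover_iota_part f9 n_gt1 (gradR_var k iz); rewrite muln1. Qed.

Lemma cover_min_degree : exists m v, [/\ (0 < m)%N, G m v, v <> 0 &
  forall i u, (0 < i)%N -> G i u -> u <> 0 -> (m <= i)%N].
Proof.
have low i u : (0 < i)%N -> G i u -> u <> 0 -> (minn n 9 <= i)%N.
  move=> i0 Gu u0; have [_ [j [e [_ _ _ iE]]]] := cover_part n3 Gu u0.
  move: iE i0; case: e => [|e]; case: j => [|j]; lia.
have [le|lt] := leqP n 9.
  exists n, (iota 'X_iz); split; [exact: ltnW | exact: cover_z_part | exact: cover_z_neq0 |].
  by move: low; rewrite (minn_idPl le).
exists 9%N, w; split=> //; first exact: cover_w_part.
  by rewrite -[w]expr1; exact: (cover_w_neq0 n_gt1 f0).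
by move: low; rewrite (minn_idPr (ltnW lt)).
Qed.

Section OneAutomorphism.
Variables (phi phi' : {rmorphism A -> A}).
Hypotheses (phiC : forall c : k, phi (iota c%:MP) = iota c%:MP).
Hypotheses (phiK : cancel phi phi') (phi'K : cancel phi' phi).

Let phi_inj := can_inj phiK.

Let phiZ c a : phi (c *: a) = c *: phi a.
Proof. by rewrite !cover_scaleE rmorphM phiC. Qed.

Lemma two_pow_inj i j : 2%:R ^+ i = 2%:R ^+ j :> k -> i = j.
Proof. by rewrite -!natrX => /(char0_natr_inj k0) /eqP; rewrite eqn_exp2l // => /eqP. Qed.

(** The conjugate of the element 2 of the torus respects the grading, hence lies in the
    torus. *)
Lemma conj_two : exists t : k, t != 0 /\
  forall a, phi (phi_fun G 2%:R (phi' a)) = phi_fun G t a.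
Proof.
have two : 2%:R != 0 :> k by exact: k0.
pose two_aut := alg_rmorph (phi_fun_linear G 2%:R) (phi_fun_monoid_morphism G 2%:R).
pose psi : {rmorphism A -> A} := phi \o (two_aut \o phi').
apply: (graded_hom_torus C3 C4 k0 p0 q0 det f0 n3 (phi := psi)) => [c||i a Ga] /=.
- have G0 := cover_iota_part f9 n_gt1 (R_const c); rewrite muln0 in G0.
  by rewrite -{1}phiC phiK (phi_fun_part _ G0) expr0 scale1r phiC.
- apply: (inj_comp phi_inj); apply: inj_comp (can_inj phi'K).
  by apply: (can_inj (g := phi_fun G 2%:R^-1)); apply: phi_funK; rewrite mulVf.
have [N [c [Gc aE]]] := phi_expand f9 n_gt1 phi'K a.
rewrite aE in Ga *; have Gphi := compatible_gradings k0 C2 n3 phiC phiK phi'K Gc Ga.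
rewrite -rmorph_sum phiK (phi_funE _ _ Gc) rmorph_sum.
apply: (big_ind (fun u => G i u)) => [|u v|l _]; [exact: gpart0|exact: gpartD|].
by rewrite phiZ; apply: alg_gpartZ; exact: Gphi.
Qed.

(** phi multiplies degrees by a constant since it matches the eigenvalues of the element 2 with those of
    an element t of the torus; it preserves the least positive degree, so the constant is 1. *)
Lemma aut_graded i a : G i a -> G i (phi a).
Proof.
have [t [t0 conj]] := conj_two.
have match_deg j u e : G j u -> gcomp G e (phi u) <> 0 -> t ^+ e = 2%:R ^+ j.
  move=> Gu ue; apply/eqP; rewrite -subr_eq0.
  have := conj (phi u); rewrite phiK (phi_fun_part _ Gu) phiZ => /(congr1 (gcomp G e)).
  have gcompZ c b : gcomp G e (c *: b) = c *: gcomp G e b.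
    have G0 := cover_iota_part f9 n_gt1 (R_const c); rewrite muln0 in G0.
    by rewrite !cover_scaleE -{1}[e]add0n gcompMl.
  rewrite gcompZ.
  have -> : gcomp G e (phi_fun G t (phi u)) = t ^+ e *: gcomp G e (phi u).
    rewrite (gcompE _ (c := fun l => t ^+ l *: gcomp G l (phi u))) => [|l]; last by apply: alg_gpartZ; exact: gcompP.
    by case: ltnP => // h; rewrite /gcomp ltnNge h scaler0.
  move/eqP; rewrite eq_sym -subr_eq0 -scalerBl scaler_eq0.
  by case/orP => [e0|/eqP/ue[]]; exact: e0.
have has_comp u : u <> 0 -> exists e, gcomp G e (phi u) <> 0.
  move=> u0; apply: contrapT => h; apply: u0; apply: phi_inj; rewrite rmorph0.
  rewrite (gcomp_sum G (phi u)) big1 // => e _.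
  by apply: contrapT => ue; apply: h; exists (val e).
have [d zd] := has_comp _ cover_z_neq0; have td := match_deg _ _ _ cover_z_part zd.
have deg j u e : G j u -> gcomp G e (phi u) <> 0 -> (j * d = n * e)%N.
  move=> Gu ue; have te := match_deg _ _ _ Gu ue; apply: two_pow_inj.
  by rewrite !exprM -te -td -!exprM mulnC.
have n0 : (0 < n)%N := ltnW n_gt1.
have [m [v [m0 Gv v0 low]]] := cover_min_degree.
have dn : d = n.
  have d0 : (0 < d)%N.
    case: posnP => // d0; move: td; rewrite d0 expr0 -(expr0 (2%:R : k)) => /two_pow_inj.
    by move: n0; lia.
  apply/eqP; rewrite eqn_leq; apply/andP; split.
    have [N [c [Gc vE]]] := phi_expand f9 n_gt1 phi'K v.
    have Gphi l : (l < N)%N -> G m (phi (c l)).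
      by apply: (compatible_gradings k0 C2 n3 phiC phiK phi'K Gc); rewrite -vE.
    have [l cl] : exists l : 'I_N, c l <> 0.
      apply: contrapT => h; apply: v0; rewrite vE big1 // => l _.
      by rewrite [c l](_ : _ = 0) ?rmorph0 //; apply: contrapT => cl; apply: h; exists l.
    have : (l * d = n * m)%N.
      apply: (deg _ _ _ (Gc l)); rewrite (gcomp_part _ (Gphi _ (ltn_ord l))) eqxx.
      by move=> e; apply: cl; apply: phi_inj; rewrite e rmorph0.
    move=> e; have l0 : (0 < l)%N by nia.
    have := low _ _ l0 (Gc l) cl; nia.
  have [e ve] := has_comp _ v0; have e1 := deg _ _ _ Gv ve.
  have e0 : (0 < e)%N by nia.
  have := low _ _ e0 (gcompP G e (phi v)) ve; nia.
move=> Ga; rewrite (_ : phi a = gcomp G i (phi a)); first exact: gcompP.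
apply: (gcomp_ext (G := G)) => e; rewrite (gcomp_part _ (gcompP G i (phi a))).
case: eqP => [->//|ne]; apply: contrapT => ae; apply: ne; apply/eqP.
by have := deg _ _ _ Ga ae; rewrite dn mulnC => /eqP; rewrite eqn_pmul2l // eq_sym.
Qed.

End OneAutomorphism.

Lemma kaut_torus (phi : kaut k A) : torus G phi.
Proof.
pose phi1 := alg_rmorph (kaut_linear phi) (kaut_monoid_morphism phi).
pose phi2 := alg_rmorph (kaut_linear (kaut_inv phi)) (kaut_monoid_morphism (kaut_inv phi)).
have K1 : cancel phi1 phi2.
  by move=> a; exact: (congr1 (fun u : kaut k A => u a) (kaut_mulV phi)).
have K2 : cancel phi2 phi1.
  by move=> a; exact: (congr1 (fun u : kaut k A => u a) (kaut_mulVr phi)).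
have C c : phi1 (iota c%:MP) = iota c%:MP.
  rewrite -[iota _]mulr1 -cover_scaleE.
  have -> : phi1 (c *: 1) = c *: phi1 1 by rewrite /= -[c *: 1]addr0 kaut_linear
    (_ : phi 0 = 0) ?addr0 //; exact: (rmorph0 phi1).
  by rewrite rmorph1.
have [t [t0 phit]] := graded_hom_torus C3 C4 k0 p0 q0 det f0 n3 C (can_inj K1) (aut_graded C K1 K2).
by exists (KStar t0) => //; apply: kautP => a /=; rewrite -phit.
Qed.

Lemma phi_t_inj : injective (phi_t G).
Proof.
move=> u v uv.
have pow i a : G i a -> a <> 0 -> val u ^+ i = val v ^+ i.
  move=> Ga a0; apply/eqP; rewrite -subr_eq0.
  have := congr1 (fun h : kaut k A => h a) uv; rewrite /= !(phi_fun_part _ Ga) => /eqP.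
  rewrite -subr_eq0 -scalerBl scaler_eq0.
  by case/orP => [e0|/eqP/a0[]]; exact: e0.
have un := pow _ _ cover_z_part cover_z_neq0.
have u9 : val u ^+ 9 = val v ^+ 9.
  apply: (pow _ _ (cover_w_part f9 n_gt1)).
  by rewrite -[w]expr1; exact: (cover_w_neq0 n_gt1 f0).
by apply: val_inj; exact: (coprime_exp_inj (ltnW n_gt1) (coprime_n9 n3)
  (kstar_neq0 u) (kstar_neq0 v) un u9).
Qed.

End AutomorphismGroup.

Lemma phi_t_morph (k : fieldType) (B : comAlgType k) (G : alg_grading B) :
  {morph phi_t G : u v / (u * v)%g}.
Proof.
move=> u v; apply: kautP => a /=; have [N [c [Gc ->]]] := gpart_gen G a.
rewrite !(phi_funE _ _ Gc) phi_fun_sum; apply: eq_bigr => i _.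
rewrite (phi_fun_part _ (alg_gpartZ _ (Gc i))) scalerA -exprMn.
by rewrite mulrC.
Qed.

Lemma det_mx22 (k : fieldType) (a b c d : k) : \det (mx22 a b c d) = a * d - b * c.
Proof.
rewrite (expand_det_row _ 0) !big_ord_recl big_ord0 /= /cofactor !det_mx11 !mxE /=.
by rewrite addr0 expr0 expr1 mul1r mulN1r mulrN.
Qed.

Lemma char0_pchar (k : fieldType) : [pchar k] =i pred0 -> char0 k.
Proof. by move=> /pcharf0P k0 m; rewrite k0. Qed.

Theorem theorem1p3 (k : closedFieldType) (char0 : [pchar k] =i pred0)
    (f : {mpoly k[3]}) (f9 : gradR k 9%N f)
    (C1 : irreducible_elt f)
    (C2 : at_least_two_singular_points f9 C1)
    (p q : k) (p_neq0 : p != 0) (q_neq0 : q != 0)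
    (C3 : at_z0 f = 'X_ix * (p *: 'X_ix ^+ 2 + q *: 'X_iy ^+ 3))
    (r s : k)
    (C4 : at_z0 f^`M(iz) = 'X_iy * (r *: 'X_ix ^+ 2 + s *: 'X_iy ^+ 3))
    (C4_det : \det (mx22 (3%:R * p) r q s) != 0)
    (n : nat) (n_ge2 : (2 <= n)%N) (n_not3 : ~~ (3 %| n)%N) :
  [set: kaut k (cyclic_cover f n)] = torus (cover_grading n_ge2 f9) /\
  group_isomorphic (kaut k (cyclic_cover f n)) (kstar k).
Proof.
have k0 := char0_pchar char0.
rewrite det_mx22 in C4_det.
have full phi : torus (cover_grading n_ge2 f9) phi.
  exact: (kaut_torus C2 C3 C4 k0 p_neq0 q_neq0 C4_det n_ge2 n_not3).
split; first by apply/seteqP; split=> phi // _; exact: full.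
have lift phi : exists t, phi_t (cover_grading n_ge2 f9) t = phi.
  by have [t _ tphi] := full phi; exists t.
have [h hP] := choice lift.
have inj : injective (phi_t (cover_grading n_ge2 f9)) by exact: (phi_t_inj C1 n_not3).
exists h; split.
  by exists (phi_t (cover_grading n_ge2 f9)) => [//|t]; apply: inj; rewrite hP.
by move=> phi psi; apply: inj; rewrite phi_t_morph !hP.
Qed.
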